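(* Let $\alpha>-1$, $0<c\le n+1+\alpha$ and $1\le p,q\le\infty$. Then $K_c^\alpha: L^p_\alpha\to L^q_\alpha$ is bounded if and only if $p,q$ satisfy one of the following conditions: (i) $p=1$ and $q<\dfrac{n+1+\alpha}{c}$. (ii) $1<p<\dfrac{n+1+\alpha}{n+1+\alpha-c}$ and $$\frac1q\ge\frac1p+\frac{c}{n+1+\alpha}-1.$$ (iii) $p=\dfrac{n+1+\alpha}{n+1+\alpha-c}$ and $q<\infty$. (iv) $p>\dfrac{n+1+\alpha}{n+1+\alpha-c}$.
   Context: Let $n\ge 1$ be an integer, $\mathbb{B}_n$ the open unit ball of $\mathbb{C}^n$, $\langle z,w\rangle=\sum_{j=1}^n z_j\overline{w_j}$, and $dv$ the normalized volume measure on $\mathbb{B}_n$, so $v(\mathbb{B}_n)=1$. For $\alpha>-1$ let $dv_\alpha(z)=c_\alpha(1-|z|^2)^\alpha\,dv(z)$ with $c_\alpha=\Gamma(n+\alpha+1)/[n!\,\Gamma(\alpha+1)]$, so that $v_\alpha(\mathbb{B}_n)=1$. For $1\le p<\infty$, $L^p_\alpha=L^p(\mathbb{B}_n,dv_\alpha)$; $L^\infty_\alpha=L^\infty$ is the space of essentially bounded measurable functions on $\mathbb{B}_n$ with the essential supremum norm. For $c\in\mathbb{R}$ and $\alpha>-1$ define $$K_c^\alpha f(z)=\int_{\mathbb{B}_n}\frac{f(w)}{(1-\langle z,w\rangle)^c}\,dv_\alpha(w),$$ where the power is the principal branch ($\operatorname{Re}(1-\langle z,w\rangle)>0$). Conventions: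 $1/\infty=0$; when $c=n+1+\alpha$ the quotient $\frac{n+1+\alpha}{n+1+\alpha-c}$ is read as $+\infty$ (so (iii) reads $p=\infty$, $q<\infty$, and (iv) is void). *)

(* Defs.v *)
From HB Require Import structures.
From mathcomp Require Import all_boot all_order all_algebra.
From mathcomp Require Import all_classical all_reals all_analysis.
From mathcomp Require Import measurable_realfun.
From mathcomp Require Import complex.

Set Implicit Arguments.
Unset Strict Implicit.
Unset Printing Implicit Defensive.
Import Order.TTheory GRing.Theory Num.Theory ComplexField.Normc.

Local Open Scope classical_set_scope.
Local Open Scope ring_scope.

(* The library declares this instance, but canonical inference finds the one for
   subprobabilities instead. *)
Lemma sigma_finite_product d1 d2 (T1 : measurableType d1)
    (T2 : measurableType d2) (R : realType)
    (m1 : {sigma_finite_measure set T1 -> \bar R})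
    (m2 : {sigma_finite_measure set T2 -> \bar R}) :
  sigma_finite setT (m1 \x m2)%E.
Proof.
have /sigma_finiteP[F [TF ndF Foo]] := sigma_finiteT m1.
have /sigma_finiteP[G [TG ndG Goo]] := sigma_finiteT m2.
exists (fun n => F n `*` G n).
  rewrite -setXTT TF TG predeqE => -[x y]; split.
    move=> [/= [n _ Fnx] [k _ Gky]]; exists (maxn n k) => //; split.
    - by move: x Fnx; exact/subsetPset/ndF/leq_maxl.
    - by move: y Gky; exact/subsetPset/ndG/leq_maxr.
  by move=> [n _ []/= ? ?]; split; exists n.
move=> k; have [? ?] := Foo k; have [? ?] := Goo k.
split; first exact: measurableX.
by rewrite product_measure1E// lte_mul_pinfty// ge0_fin_numE.
Qed.

Section complex_measurable.
Variable R : realType.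

Definition complex_pair (z : R[i]) : measurableTypeR R * measurableTypeR R := (complex.Re z, complex.Im z).

HB.instance Definition _ := isPointed.Build R[i] 0.

Let cset : set (set R[i]) := g_sigma_algebra_preimage complex_pair.

Let cset0 : cset set0.
Proof. by exists set0 => //; rewrite preimage_set0 setI0. Qed.

Let csetC A : cset A -> cset (~` A).
Proof.
move=> -[B mB] <-{A}.
by exists (~` B); [exact: measurableC|rewrite !setTI preimage_setC].
Qed.

Let cset_bigcup (F : (set R[i])^nat) :
  (forall i, cset (F i)) -> cset (\bigcup_i F i).
Proof.
exact: (@bigcupT_measurable _
  (g_sigma_algebra_preimageType complex_pair)).
Qed.

(* Borel sets of R[i], transported from R * R. *)
HB.instance Definition _ := @isMeasurable.Build
  (preimage_display complex_pair) R[i] cset cset0 csetC cset_bigcup.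

Definition pair_complex (x : measurableTypeR R * measurableTypeR R) : R[i] := (x.1 +i* x.2)%C.

Lemma measurable_complex_pair : measurable_fun [set: R[i]] complex_pair.
Proof. by move=> _ B mB; exists B. Qed.

Lemma measurable_pair_complex : measurable_fun setT pair_complex.
Proof.
move=> _ _ [B mB <-]; rewrite !setTI.
by rewrite (_ : _ @^-1` _ = B)//; apply/seteqP; split => -[].
Qed.

End complex_measurable.

Section complex_lebesgue.
Variable R : realType.
Local Open Scope ereal_scope.

HB.instance Definition _ := isMeasurableFun.Build _ _ _ _
  (@pair_complex R) (@measurable_pair_complex R).

Definition complex_lebesgue : set R[i] -> \bar R :=
  pushforward (@lebesgue_measure R \x @lebesgue_measure R) (@pair_complex R).

Let cl0 : complex_lebesgue set0 = 0.
Proof. exact: measure0. Qed.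
Let cl_ge0 A : 0 <= complex_lebesgue A.
Proof. exact: measure_ge0. Qed.
Let cl_sigma_additive : semi_sigma_additive complex_lebesgue.
Proof. exact: measure_semi_sigma_additive. Qed.

HB.instance Definition _ := isMeasure.Build _ _ _ complex_lebesgue
  cl0 cl_ge0 cl_sigma_additive.

Let cl_sigma_finite : sigma_finite setT complex_lebesgue.
Proof.
have [F UF mF] :=
  sigma_finite_product (@lebesgue_measure R) (@lebesgue_measure R).
exists (fun k => @complex_pair R @^-1` F k).
  by rewrite -preimage_bigcup -UF preimage_setT.
move=> k; have [mFk Fk] := mF k; split; first by exists (F k); rewrite ?setTI.
rewrite /complex_lebesgue /pushforward.
by rewrite (_ : _ @^-1` _ = F k)//; apply/seteqP; split => -[].
Qed.

HB.instance Definition _ := Measure_isSigmaFinite.Build _ _ _ complex_lebesgue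
  cl_sigma_finite.
End complex_lebesgue.

Section power_measure.
Context d (T : measurableType d) (R : realType).
Local Open Scope ereal_scope.

Section cons_measure.
Variable n : nat.

Definition tuple_cons (x : T * n.-tuple T) : n.+1.-tuple T :=
  [tuple of x.1 :: x.2].

Let measurable_tuple_cons : measurable_fun setT tuple_cons.
Proof. exact: measurable_cons. Qed.

HB.instance Definition _ := isMeasurableFun.Build _ _ _ _
  tuple_cons measurable_tuple_cons.

Variables (m1 : {sigma_finite_measure set T -> \bar R})
  (m2 : {sigma_finite_measure set (n.-tuple T) -> \bar R}).

Definition cons_measure : set (n.+1.-tuple T) -> \bar R :=
  pushforward (m1 \x m2) tuple_cons.

Let cm0 : cons_measure set0 = 0.
Proof. exact: measure0. Qed.
Let cm_ge0 A : 0 <= cons_measure A.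
Proof. exact: measure_ge0. Qed.
Let cm_sigma_additive : semi_sigma_additive cons_measure.
Proof. exact: measure_semi_sigma_additive. Qed.

HB.instance Definition _ := isMeasure.Build _ _ _ cons_measure
  cm0 cm_ge0 cm_sigma_additive.

Let cm_sigma_finite : sigma_finite setT cons_measure.
Proof.
pose uncons (t : n.+1.-tuple T) := (thead t, [tuple of behead t]).
have muncons : measurable_fun setT uncons.
  apply/measurable_fun_pairP; split; first exact: measurable_tnth.
  exact: measurable_behead.
have [F UF mF] := sigma_finite_product m1 m2.
exists (fun k => uncons @^-1` F k).
  by rewrite -preimage_bigcup -UF preimage_setT.
move=> k; have [mFk Fk] := mF k; split.
  by rewrite -[X in measurable X]setTI; exact: muncons.
rewrite /cons_measure /pushforward (_ : _ @^-1` _ = F k)//.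
have consK : cancel tuple_cons uncons.
  by move=> [x t]; congr pair; apply/val_inj.
by apply/seteqP; split => x; rewrite /= consK.
Qed.

HB.instance Definition _ := Measure_isSigmaFinite.Build _ _ _ cons_measure
  cm_sigma_finite.

End cons_measure.

Fixpoint power_measure (m : {sigma_finite_measure set T -> \bar R}) (n : nat) :
    {sigma_finite_measure set (n.-tuple T) -> \bar R} :=
  if n is k.+1 then cons_measure m (power_measure m k)
  else \d_ [tuple].

End power_measure.

Notation Cn R n := (n.-tuple R[i]).

Section ball.
Variables (R : realType) (n : nat).
Implicit Types z w : Cn R n.

Definition hdot z w : R[i] := \sum_(j < n) tnth z j * (tnth w j)^*%C.

Definition sqnorm z : R := \sum_(j < n) normc (tnth z j) ^+ 2.

Definition Bn : set (Cn R n) := [set z | sqnorm z < 1].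

Lemma measurable_sqnorm : measurable_fun setT sqnorm.
Proof.
rewrite /sqnorm; apply: measurable_sum => j.
have mp : measurable_fun setT (fun z : Cn R n => complex_pair (tnth z j)).
  apply: (measurableT_comp (@measurable_complex_pair R)).
  exact: measurable_tnth.
have /measurable_fun_pairP[m1 m2] := mp.
rewrite (_ : (fun z => _) = (fun z : Cn R n =>
  (complex_pair (tnth z j)).1 ^+ 2 + (complex_pair (tnth z j)).2 ^+ 2)).
  by apply: measurable_funD; apply: measurable_funX.
apply/funext => z; case: (tnth z j) => a b /=.
by rewrite sqr_sqrtr// addr_ge0// sqr_ge0.
Qed.

Lemma measurable_Bn : measurable Bn.
Proof.
rewrite (_ : Bn = sqnorm @^-1` `]-oo, 1[%classic).
  by rewrite -[X in measurable X]setTI; exact: measurable_sqnorm.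
by apply/seteqP; split => z; rewrite /= in_itv.
Qed.

End ball.
Arguments Bn {R n}.
Arguments measurable_Bn {R n}.

(* Meaningful for x > 0 only. *)
Definition Gamma {R : realType} (x : R) : R :=
  \int[lebesgue_measure]_(t in `]0%R, +oo[) (t `^ (x - 1) * expR (- t)).

Section weighted_measure.
Variables (R : realType) (n : nat).
Local Open Scope ereal_scope.

Definition lebesgue_Cn : {sigma_finite_measure set (Cn R n) -> \bar R} :=
  power_measure (@complex_lebesgue R) n.

Let vol_ge0 : (0 <= (fine (lebesgue_Cn Bn))^-1)%R.
Proof. by rewrite invr_ge0 fine_ge0. Qed.

(* Normalized volume measure on the unit ball, extended by 0 to C^n. *)
Definition vol : {measure set (Cn R n) -> \bar R} :=
  mscale (NngNum vol_ge0) (mrestr lebesgue_Cn measurable_Bn).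

Definition c_ (alpha : R) : R :=
  (Gamma (n%:R + alpha + 1) / (n`!%:R * Gamma (alpha + 1)))%R.

Definition weight (alpha : R) (z : Cn R n) : R :=
  (c_ alpha * (1 - sqnorm z) `^ alpha)%R.

Definition vol_ (alpha : R) (A : set (Cn R n)) : \bar R :=
  \int[vol]_(z in A) (weight alpha z)%:E.

Variable alpha : R.

Let Gamma_ge0 (x : R) : (0 <= Gamma x)%R.
Proof. by apply: Rintegral_ge0 => t _; rewrite mulr_ge0 ?powR_ge0 ?expR_ge0. Qed.

Let weight_ge0 z : 0 <= (weight alpha z)%:E.
Proof. by rewrite lee_fin !mulr_ge0 ?invr_ge0 ?mulr_ge0 ?powR_ge0 ?Gamma_ge0. Qed.

Let measurable_weight : measurable_fun setT (EFin \o weight alpha).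
Proof.
apply/measurable_EFinP/measurable_funM => //.
apply: (measurableT_comp (measurable_powR alpha)).
by apply: measurable_funB => //; exact: measurable_sqnorm.
Qed.

Let vol0 : vol_ alpha set0 = 0.
Proof. by rewrite /vol_ integral_set0. Qed.
Let vol_ge0' A : 0 <= vol_ alpha A.
Proof. by apply: integral_ge0 => z _; exact: weight_ge0. Qed.
Let vol_sigma_additive : semi_sigma_additive (vol_ alpha).
Proof. exact: semi_sigma_additive_nng_induced measurable_weight weight_ge0. Qed.

HB.instance Definition _ := isMeasure.Build _ _ _ (vol_ alpha)
  vol0 vol_ge0' vol_sigma_additive.

End weighted_measure.

Section complex_power.
Variable R : realType.
Implicit Types u : R[i].

(* Principal argument, in ]-pi, pi]. *)
Definition Carg u : R :=
  let t := acos (complex.Re u / normc u) in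
  if 0 <= complex.Im u then t else - t.

(* Principal branch of u ^ c = exp (c (ln |u| + i Carg u)), for u != 0. *)
Definition cpowR u (c : R) : R[i] :=
  ((normc u `^ c)%:C *
   (cos (c * Carg u) +i* sin (c * Carg u)))%C.

End complex_power.

Section operator.
Variables (R : realType) (n : nat).
Implicit Types f : Cn R n -> R[i].

(* Meaningful when the real and imaginary parts of f are integrable; this is
   the case below, as the kernel w |-> (1 - <z, w>) ^ - c is bounded on the ball
   for each z in the ball and Lp alpha p is contained in Lp alpha 1. *)
Definition Cintegral (mu : {measure set (Cn R n) -> \bar R}) (D : set (Cn R n))
    f : R[i] :=
  ((\int[mu]_(w in D) complex.Re (f w)) +i*
   (\int[mu]_(w in D) complex.Im (f w)))%C.

Definition Kop (c alpha : R) f : Cn R n -> R[i] := fun z =>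
  Cintegral (vol_ alpha) Bn (fun w => f w / cpowR (1 - hdot z w) c).

(* Functions on the ball are represented by functions on C^n of which only the
   restriction to Bn matters. *)
Definition normLp (alpha : R) (p : \bar R) f : \bar R :=
  'N[vol_ alpha]_p[(fun z => (normc (f z))%:E) \_ Bn].

Definition Lp (alpha : R) (p : \bar R) : set (Cn R n -> R[i]) :=
  [set f | measurable_fun Bn f /\ (normLp alpha p f < +oo)%E].

Definition bounded_Lp (alpha : R) (p q : \bar R)
    (T : (Cn R n -> R[i]) -> Cn R n -> R[i]) : Prop :=
  exists M : R, forall f, Lp alpha p f ->
    Lp alpha q (T f) /\ (normLp alpha q (T f) <= M%:E * normLp alpha p f)%E.

End operator.

(* Main.v *)
(* Write N = n + 1 + alpha. A point w with |1 - <z, w>| < r and 1 - |w|^2 < h,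
   h <= 2 r, has a coordinate bounded away from 0; slicing along it shows that
   such points have v_alpha-measure O(h^(1 + alpha) r^n). Dyadic decompositions
   in r and h turn this into the Forelli-Rudin estimates
     int |1 - <z, w>|^(- a) dv_alpha(w) = O(1) for a < N,
     int |1 - <z, w>|^(- N) (1 - |w|^2)^(- s) dv_alpha(w)
       = O((1 - |z|^2)^(- s)) for 0 < s < 1 + alpha,
   and Schur's test, with powers of 1 - |w|^2 as test weights when
   1/q = 1/p + c/N - 1, gives the boundedness on the critical line; the other
   bounded cases follow since v_alpha is finite.
   Conversely, let Q k be the box of size r_k = 2^(- k) / 4 around (1 - r_k) e_1
   in the first coordinate, of size sqrt r_k in the others. Then v_alpha (Q k)
   is comparable to r_k^N and Re (1 - <z, w>)^(- c) >= C max(r_j, r_k)^(- c) for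
   z in Q j and w in Q k, so linear combinations of the indicators of the Q k
   show that K_c^alpha is unbounded in the remaining cases. *)
Require Import Defs.
From HB Require Import structures.
From mathcomp Require Import all_boot all_order all_algebra.
From mathcomp Require Import all_classical all_reals all_analysis.
From mathcomp Require Import measurable_realfun ess_sup_inf complex ring lra.

Set Implicit Arguments.
Unset Strict Implicit.
Unset Printing Implicit Defensive.
Import Order.TTheory GRing.Theory Num.Theory ComplexField.Normc.
Import numFieldNormedType.Exports.

Local Open Scope classical_set_scope.
Local Open Scope ring_scope.

(** * Dyadic decompositions *)

(** Polar coordinates and unitary invariance are avoided: the geometry rests on 2 Re (1 - <z, w>) =
    (1 - |z|^2) + (1 - |w|^2) + |z - w|^2. This explains h <= 2 r, as 1 - |w|^2 <= 2 |1 - <z, w>|,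
    and it puts w within sqrt (2 r) of z in each coordinate. One coordinate gains a further sqrt r
    because <z, w> is affine in the conjugate of w_j, with a slope z_j that is not small. On the
    critical line c = N (1 - 1/p) + N/q, so the kernel splits into two powers of |1 - <z, w>|^(- N)
    with exactly the exponents that Hoelder's inequality asks for. In the converse the obstacle is
    oscillation: the power c multiplies the argument of 1 - <z, w>, and c can be large. The boxes
    are therefore narrowed by a factor e depending on c, until 1 - <z, w> is almost real. One box
    against itself gives the inequality between exponents; at the excluded endpoints the divergence
    is only in the number of scales, whence the use of many disjoint boxes. *)

Lemma eq_ler (R : realType) (x y : R) : x = y -> x <= y.
Proof. by move->. Qed.

(** The factor adds the constants for the two signs: 1 when t >= 0, from g <= y, and L^(- t) when t
    < 0, from y / L <= g. *)
Lemma powR_le_of_comparable (R : realType) (L t y g : R) :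
  0 < L -> 0 < y -> y / L <= g -> g <= y ->
  g `^ t <= (1 + L `^ (- t)) * y `^ t.
Proof.
move=> L0 y0 yg gy.
have yL0 : 0 < y / L by exact: divr_gt0.
have g0 : 0 < g by exact: lt_le_trans yg.
have yt := powR_ge0 y t.
have h2 := powR_ge0 L (- t).
have [t0|t0] := leP 0 t.
  have : g `^ t <= y `^ t by apply: ge0_ler_powR => //; rewrite nnegrE; lra.
  by nra.
have : g `^ t <= (y / L) `^ t.
  rewrite -[t]opprK !(powRN _ (- t)) lef_pV2 ?posrE ?powR_gt0//.
  by apply: ge0_ler_powR => //; rewrite ?nnegrE; lra.
have L00 := ltW L0.
rewrite powRM ?invr_ge0//; last lra.
rewrite -powR_inv1// -powRrM mulN1r.
by nra.
Qed.

Lemma powR_ge_of_comparable (R : realType) (L t y g : R) :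
  0 < L -> 0 < y -> y / L <= g -> g <= y ->
  y `^ t / (1 + L `^ t) <= g `^ t.
Proof.
move=> L0 y0 yg gy.
have g0 : 0 < g by apply: lt_le_trans yg; exact: divr_gt0.
have := powR_le_of_comparable (- t) L0 y0 yg gy.
have yt := powR_gt0 t y0; have gt := powR_gt0 t g0; have Lt := powR_gt0 t L0.
rewrite opprK !powRN ler_pdivlMr// mulrC ler_pdivrMr// mulrC => h.
by rewrite ler_pdivrMr//; lra.
Qed.

Section geometric_integral.
Context d (T : measurableType d) (R : realType).
Variable mu : {measure set T -> \bar R}.
Local Open Scope ereal_scope.

Lemma ge0_integral_bigcup_geometric (F : (set T)^nat) (f : T -> \bar R)
    (A rho : R) :
  (forall j, measurable (F j)) -> trivIset setT F ->
  measurable_fun (\bigcup_j F j) f ->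
  (forall x, (\bigcup_j F j) x -> 0 <= f x) ->
  (0 <= A)%R -> (0 < rho < 1)%R ->
  (forall j, \int[mu]_(x in F j) f x <= (A * rho ^+ j)%:E) ->
  \int[mu]_(x in \bigcup_j F j) f x <= (A / (1 - rho))%:E.
Proof.
move=> mF tF mf f0 A0 /andP[rho0 rho1] Ff.
rewrite ge0_integral_bigcup//.
apply: (@le_trans _ _ (\sum_(j <oo) (A * rho ^+ j)%:E)).
  by apply: lee_nneseries => // j _ _; apply: integral_ge0 => x Fx; apply: f0;
    exists j.
apply: lime_le.
  by apply: is_cvg_nneseries => j _ _;
    rewrite lee_fin mulr_ge0// exprn_ge0// ltW.
near=> m.
rewrite sumEFin lee_fin.
have := @geometric_le_lim R m A rho A0 rho0.
rewrite /series/= => h; apply: h.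
by rewrite ger0_norm ?ltW.
Unshelve. all: by end_near. Qed.

End geometric_integral.

Section dyadic.
Context d (T : measurableType d) (R : realType).
Variables (mu : {measure set T -> \bar R}) (E : set T).
Variables (phi : T -> \bar R) (g : T -> R) (C k t : R).
Hypotheses (mE : measurable E) (mphi : measurable_fun E phi)
  (phi0 : forall x, E x -> (0 <= phi x)%E) (mg : measurable_fun E g)
  (C0 : 0 <= C).

Let phig0 x : E x -> (0 <= phi x * (g x `^ t)%:E)%E.
Proof. by move=> Ex; rewrite mule_ge0 ?phi0// lee_fin powR_ge0. Qed.

Let mphig : measurable_fun E (fun x => phi x * (g x `^ t)%:E)%E.
Proof.
apply: emeasurable_funM => //; apply/measurable_EFinP.
exact: (measurableT_comp (measurable_powR t)).
Qed.

Let shell a b := E `&` [set x | a <= g x] `&` [set x | g x < b].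

Let mshell a b : measurable (shell a b).
Proof.
rewrite /shell -setIA setIIr; apply: measurableI.
  by rewrite -preimage_itvcy; exact: mg.
by rewrite -preimage_itvNyo; exact: mg.
Qed.

Let msub b : measurable (E `&` [set x | g x < b]).
Proof. by rewrite -preimage_itvNyo; exact: mg. Qed.

Let shell_le y M : 0 < y ->
  (\int[mu]_(x in E `&` [set x | (g x < y)%R]) phi x <= M%:E)%E ->
  (\int[mu]_(x in shell (y / 2)%R y) (phi x * (g x `^ t)%:E)
    <= ((1 + 2 `^ (- t)) * y `^ t * M)%:E)%E.
Proof.
move=> y0 hM.
have c0 : 0 <= (1 + 2 `^ (- t)) * y `^ t :> R.
  by rewrite mulr_ge0 ?addr_ge0 ?powR_ge0.
apply: (@le_trans _ _ (\int[mu]_(x in shell (y / 2)%R y)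
    (((1 + 2 `^ (- t)) * y `^ t)%:E * phi x))%E).
  apply: ge0_le_integral => //.
  - by move=> x [[Ex _] _]; exact: phig0.
  - by apply: measurable_funS mphig => // x [[]].
  - by apply: emeasurable_funM => //; apply: measurable_funS mphi => // x [[]].
  - move=> x [[Ex /= gx1] /= gx2]; rewrite muleC; apply: lee_wpmul2r.
      exact: phi0.
    by rewrite lee_fin powR_le_of_comparable// ltW.
rewrite ge0_integralZl//; last 2 first.
- by apply: measurable_funS mphi => // x [[]].
- by move=> x [[Ex _] _]; exact: phi0.
rewrite [leRHS]EFinM; apply: lee_wpmul2l; first by rewrite lee_fin.
apply: le_trans hM; apply: ge0_subset_integral => //.
- by apply: measurable_funS mphi => // x [].
- by move=> x [Ex _]; exact: phi0.
- by move=> x [[Ex _] gx]; split.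
Qed.

(** The numerator bounds the variation of g^t over one dyadic shell, the denominator sums a
    geometric series of ratio 2^(- s). *)
Definition dyadic_const (s : R) : R := (1 + 2 `^ (- t)) / (1 - 2 `^ (- s)).

Let two_lt1 s : 0 < s -> 0 < (2 `^ (- s) : R) < 1.
Proof.
move=> s0; rewrite powR_gt0//= powRN invf_lt1 ?powR_gt0//.
rewrite -[ltLHS](powRr0 2); rewrite /powR; case: ifPn => [|_];
  first by rewrite pnatr_eq0.
by rewrite ltr_expR mul0r mulr_gt0// ln_gt0// ltr1n.
Qed.

Lemma dyadic_const_ge0 s : 0 < s -> 0 <= dyadic_const s.
Proof.
move=> /two_lt1 /andP[_ h]; apply: divr_ge0; last by rewrite subr_ge0 ltW.
by rewrite addr_ge0 ?powR_ge0.
Qed.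

Let powRX (a s : R) j : 0 < a -> (a ^+ j) `^ s = (a `^ s) ^+ j.
Proof.
move=> a0; elim: j => [|j IH]; first by rewrite !expr0 powR1.
by rewrite !exprS powRM ?exprn_ge0 ?ltW// IH.
Qed.

(** The shell y / 2 <= g < y has phi-mass O(y^k) and so contributes O(y^(k + t)); over y = H / 2^j
    this is a geometric series, convergent because k + t > 0. *)
Lemma ge0_integral_powR_le (H : R) : 0 < H -> 0 < k + t ->
  (forall x, E x -> 0 < g x < H) ->
  (forall h, 0 < h -> h <= H ->
    (\int[mu]_(x in E `&` [set x | (g x < h)%R]) phi x <= (C * h `^ k)%:E)%E) ->
  (\int[mu]_(x in E) (phi x * (g x `^ t)%:E)
    <= (dyadic_const (k + t) * C * H `^ (k + t))%:E)%E.
Proof.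
move=> H0 kt gH hC.
pose y j : R := H * 2^-1 ^+ j.
have y0 j : 0 < y j by rewrite mulr_gt0// exprn_gt0.
have yS j : y j / 2 = y j.+1 by rewrite /y exprSr mulrA.
have yle i j : (i <= j)%N -> y j <= y i.
  by move=> ij; apply: ler_wpM2l; [exact: ltW|apply: ler_wiXn2l => //; lra].
pose F j := shell (y j / 2) (y j).
have EF : E = \bigcup_j F j.
  apply/seteqP; split => [x Ex|x [j _ [[]]]//].
  have /andP[gx0 gxH] := gH x Ex.
  (* Powers of 2 eventually exceed [H / g x]; the least such j singles out the shell containing
     x. *)
  have ex : exists j, y j.+1 <= g x.
    exists (Num.bound (H / g x)); rewrite /y exprVn ler_pdivrMr ?exprn_gt0//.
    have := @upper_nthrootP R (H / g x) (Num.bound (H / g x)).+1 (leqnSn _).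
    by rewrite ltr_pdivrMr// mulrC => /ltW.
  exists (ex_minn ex) => //; case: ex_minnP => j hj jmin.
  rewrite /F yS; split=> //=; case: j hj jmin => [|j] hj jmin.
    by rewrite /y expr0 mulr1.
  by rewrite ltNge; apply/negP => /jmin; rewrite ltnn.
rewrite [in leLHS]EF.
apply: (@le_trans _ _ ((((1 + 2 `^ (- t)) * C * H `^ (k + t)) /
    (1 - 2 `^ (- (k + t))))%:E)); last first.
  by rewrite lee_fin /dyadic_const; apply: eq_ler; ring.
apply: ge0_integral_bigcup_geometric.
- by move=> j; exact: mshell.
- apply/trivIsetP => i j _ _ ij;
    rewrite -subset0 => x [[[_ /= i1] /= i2] [[_ /= j1] /= j2]].
  move: i1 j1; rewrite !yS => i1 j1; exfalso; move: ij;
    rewrite neq_ltn => /orP[ij|ij].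
    by have := lt_le_trans j2 (yle _ _ ij); rewrite ltNge i1.
  by have := lt_le_trans i2 (yle _ _ ij); rewrite ltNge j1.
- by rewrite -EF.
- by rewrite -EF => x; exact: phig0.
- by rewrite !mulr_ge0 ?addr_ge0 ?powR_ge0.
- exact: two_lt1.
move=> j; apply: le_trans (shell_le (y0 j) (hC _ (y0 j) _)) _.
  by have := yle 0%N j isT; rewrite /y expr0 mulr1.
rewrite lee_fin; apply: eq_ler.
have -> : 2 `^ (- (k + t)) = 2^-1 `^ (k + t) :> R.
  by rewrite -[in RHS](@powR_inv1 _ 2)// -powRrM mulN1r.
rewrite -powRX// -[RHS]mulrA -powRM ?exprn_ge0 ?ltW//.
rewrite -/(y j) (powRD) ?(gt_eqF (y0 j)) ?implybT//; ring.
Qed.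

(** The shells now go up from eta, and the opposite sign of k + t makes the series converge. The
    factor 2^(k + t) arises because each shell is estimated at its upper end, 2 eta for the first
    one. *)
Lemma ge0_integral_powR_ge (eta : R) : 0 < eta -> k + t < 0 ->
  (forall x, E x -> eta <= g x) ->
  (forall h, eta <= h ->
    (\int[mu]_(x in E `&` [set x | (g x < h)%R]) phi x <= (C * h `^ k)%:E)%E) ->
  (\int[mu]_(x in E) (phi x * (g x `^ t)%:E)
    <= (dyadic_const (- (k + t)) * 2 `^ (k + t) * C * eta `^ (k + t))%:E)%E.
Proof.
move=> H0 kt gH hC.
have kt' : 0 < - (k + t) by lra.
pose y j : R := eta * 2 ^+ j.+1.
have y0 j : 0 < y j by rewrite mulr_gt0// exprn_gt0.
have y2 j : y j / 2 = eta * 2 ^+ j.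
  by rewrite /y exprSr mulrA mulfK// pnatr_eq0.
have yle i j : (i <= j)%N -> eta * 2 ^+ i <= eta * 2 ^+ j.
  by move=> ij; apply: ler_wpM2l; [exact: ltW|rewrite ler_eXn2l// ltr1n].
pose F j := shell (y j / 2) (y j).
have EF : E = \bigcup_j F j.
  apply/seteqP; split => [x Ex|x [j _ [[]]]//].
  have gx0 := gH x Ex.
  have ex : exists j, g x < y j.
    exists (Num.bound (g x / eta)); rewrite /y.
    have := @upper_nthrootP R (g x / eta) (Num.bound (g x / eta)).+1 (leqnSn _).
    by rewrite ltr_pdivrMr// mulrC.
  exists (ex_minn ex) => //; case: ex_minnP => j hj jmin.
  rewrite /F y2; split=> //=; split => //=; case: j hj jmin => [|j] hj jmin.
    by rewrite expr0 mulr1.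
  by rewrite leNgt; apply/negP => /jmin; rewrite ltnn.
rewrite [in leLHS]EF.
apply: (@le_trans _ _ ((((1 + 2 `^ (- t)) * C * (eta * 2) `^ (k + t)) /
    (1 - 2 `^ (- - (k + t))))%:E)); last first.
  rewrite lee_fin /dyadic_const powRM//; last exact: ltW.
  by apply: eq_ler; ring.
apply: ge0_integral_bigcup_geometric.
- by move=> j; exact: mshell.
- apply/trivIsetP => i j _ _ ij;
    rewrite -subset0 => x [[[_ /= i1] /= i2] [[_ /= j1] /= j2]].
  move: i1 j1; rewrite !y2 => i1 j1; exfalso; move: ij;
    rewrite neq_ltn => /orP[ij|ij].
    by have := lt_le_trans i2 (yle _ _ ij); rewrite ltNge j1.
  by have := lt_le_trans j2 (yle _ _ ij); rewrite ltNge i1.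
- by rewrite -EF.
- by rewrite -EF => x; exact: phig0.
- by rewrite !mulr_ge0 ?addr_ge0 ?powR_ge0.
- exact: two_lt1.
move=> j; apply: le_trans (shell_le (y0 j) (hC _ _)) _.
  by have := yle 0%N j.+1 isT; rewrite expr0 mulr1.
rewrite lee_fin; apply: eq_ler.
rewrite opprK -powRX// -[RHS]mulrA -powRM ?exprn_ge0 ?mulr_ge0 ?ltW//.
rewrite (_ : eta * 2 * 2 ^+ j = y j); last by rewrite /y exprS mulrA.
rewrite (powRD) ?(gt_eqF (y0 j)) ?implybT//; ring.
Qed.

End dyadic.

(** * Hoelder's inequality and the Schur test *)

Lemma measurable_funPR d (T : measurableType d) (R : realType) (D : set T)
    (f : T -> R) (t : R) :
  measurable_fun D f -> measurable_fun D (fun x => f x `^ t).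
Proof. by move=> mf; exact: (measurableT_comp (measurable_powR t)). Qed.

Lemma measurable_fun_section d1 d2 d3 (T1 : measurableType d1)
    (T2 : measurableType d2) (T3 : measurableType d3) (D1 : set T1)
    (D2 : set T2) (f : T1 * T2 -> T3) :
  measurable D1 -> measurable D2 -> measurable_fun (D1 `*` D2) f ->
  forall x, D1 x -> measurable_fun D2 (fun y => f (x, y)).
Proof.
move=> mD1 mD2 mf x D1x.
apply: (measurable_comp (F := D1 `*` D2)) mf _; first exact: measurableX.
- by move=> _ [y D2y <-].
- exact: measurable_funS (pair1_measurable x).
Qed.

Lemma measurable_fun_swap_in d1 d2 d3 (T1 : measurableType d1)
    (T2 : measurableType d2) (T3 : measurableType d3) (D1 : set T1)
    (D2 : set T2) (f : T1 * T2 -> T3) :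
  measurable D1 -> measurable D2 -> measurable_fun (D1 `*` D2) f ->
  measurable_fun (D2 `*` D1) (fun x => f (x.2, x.1)).
Proof.
move=> mD1 mD2 mf.
have ms : measurable_fun (D2 `*` D1) (fun x : T2 * T1 => (x.2, x.1)).
  exact: measurable_funS (@measurable_swap _ _ T2 T1).
apply: (measurable_comp (F := D1 `*` D2) _ _ mf ms); first exact: measurableX.
by move=> _ [[x y] [/= ? ?] <-].
Qed.

(** * Tonelli's theorem on a product of measurable subsets *)

Section product_integrals.
Context d1 d2 (T1 : measurableType d1) (T2 : measurableType d2) (R : realType).
Variables (D1 : set T1) (D2 : set T2) (f : T1 * T2 -> \bar R).
Hypotheses (mD1 : measurable D1) (mD2 : measurable D2)
  (mf : measurable_fun (D1 `*` D2) f)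
  (f0 : forall x y, D1 x -> D2 y -> (0 <= f (x, y))%E).
Local Open Scope ereal_scope.

(** The extension by 0 is nonnegative and measurable everywhere, so the theorems on the full product
    apply to it. *)
Let fD := f \_ (D1 `*` D2).

Let mfD : measurable_fun setT fD.
Proof. by apply/(measurable_restrictT f) => //; exact: measurableX. Qed.

Let fD0 x : 0 <= fD x.
Proof. by apply: erestrict_ge0 => -[y z] [/= ? ?]; exact: f0. Qed.

Let fD1 x : D1 x -> (fun y => fD (x, y)) = (fun y => f (x, y)) \_ D2.
Proof.
move=> D1x; apply/funext => y; rewrite /fD /patch.
have -> : ((x, y) \in D1 `*` D2) = (y \in D2).
  by apply/idP/idP; rewrite !inE; [case|move=> ?; split].
by [].
Qed.

Let fD2 y : D2 y -> (fun x => fD (x, y)) = (fun x => f (x, y)) \_ D1.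
Proof.
move=> D1x; apply/funext => x; rewrite /fD /patch.
have -> : ((x, y) \in D1 `*` D2) = (x \in D1).
  by apply/idP/idP; rewrite !inE; [case|move=> ?; split].
by [].
Qed.

Let fD1N x : ~ D1 x -> (fun y => fD (x, y)) = cst 0.
Proof.
move=> D1x; apply/funext => y; rewrite /fD patchN//.
by apply/negP; rewrite inE => -[].
Qed.

Let fD2N y : ~ D2 y -> (fun x => fD (x, y)) = cst 0.
Proof.
move=> D1x; apply/funext => x; rewrite /fD patchN//.
by apply/negP; rewrite inE => -[].
Qed.

Lemma measurable_fun_partial_integral
    (m2 : {sigma_finite_measure set T2 -> \bar R}) :
  measurable_fun D1 (fun x => \int[m2]_(y in D2) f (x, y)).
Proof.
have /(measurable_funS measurableT (@subsetT _ D1)) :=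
  measurable_fun_fubini_tonelli_F (m2 := m2) fD mfD fD0.
apply: eq_measurable_fun => x; rewrite inE => D1x.
by rewrite /fubini_F fD1// -integral_mkcond.
Qed.

Lemma fubini_tonelli_in (m1 : {sigma_finite_measure set T1 -> \bar R})
    (m2 : {sigma_finite_measure set T2 -> \bar R}) :
  \int[m1]_(x in D1) \int[m2]_(y in D2) f (x, y) =
  \int[m2]_(y in D2) \int[m1]_(x in D1) f (x, y).
Proof.
have e := fubini_tonelli (m1 := m1) (m2 := m2) fD mfD fD0.
rewrite integral_mkcond [RHS]integral_mkcond.
transitivity (\int[m1]_x \int[m2]_y fD (x, y)).
  apply: eq_integral => x _; rewrite /patch; case: ifPn; rewrite ?inE => Dx.
    by rewrite fD1// -integral_mkcond.
  by rewrite fD1N ?integral0// => D1x; move: Dx; rewrite notin_setE.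
rewrite e; apply: eq_integral => y _; rewrite /patch; case: ifPn;
  rewrite ?inE => Dx.
  by rewrite fD2// -integral_mkcond.
by rewrite fD2N ?integral0// => D1x; move: Dx; rewrite notin_setE.
Qed.

End product_integrals.

Section weighted_means.
Variable R : realType.
Implicit Types a b c t : R.

(** Concavity of ln: the tangent bound ln x <= ln S + (x / S - 1) at the weighted mean S is averaged
    with the weights t1, t2, t3, and the corrections x / S - 1 average to 0. *)
Let powR_amgm3_gt0 t1 t2 t3 a b c : 0 <= t1 -> 0 <= t2 -> 0 <= t3 ->
  t1 + t2 + t3 = 1 -> 0 < a -> 0 < b -> 0 < c ->
  a `^ t1 * b `^ t2 * c `^ t3 <= t1 * a + t2 * b + t3 * c.
Proof.
move=> t10 t20 t30 t1E a0 b0 c0.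
set S := t1 * a + t2 * b + t3 * c.
have S0 : 0 < S.
  have h1 : 0 <= t1 * a by rewrite mulr_ge0// ltW.
  have h2 : 0 <= t2 * b by rewrite mulr_ge0// ltW.
  have h3 : 0 <= t3 * c by rewrite mulr_ge0// ltW.
  have [t1p|t1n] := ltP 0 t1; first by have := mulr_gt0 t1p a0; rewrite /S; lra.
  have [t2p|t2n] := ltP 0 t2; first by have := mulr_gt0 t2p b0; rewrite /S; lra.
  have t3p : 0 < t3 by lra.
  by have := mulr_gt0 t3p c0; rewrite /S; lra.
have lnle x : 0 < x -> ln x <= ln S + (x / S - 1).
  move=> x0; rewrite -lerBlDl -ln_div ?posrE//.
  have := @le_ln1Dx R (x / S - 1); rewrite addrCA subrr addr0; apply.
  by have := divr_gt0 x0 S0; lra.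
rewrite /powR !gt_eqF// -!expRD -[leRHS](@lnK _ S) ?posrE// ler_expR.
have h1 := ler_wpM2l t10 (lnle _ a0).
have h2 := ler_wpM2l t20 (lnle _ b0).
have h3 := ler_wpM2l t30 (lnle _ c0).
have e : t1 * (a / S) + t2 * (b / S) + t3 * (c / S) = 1.
  by rewrite !mulrA -!mulrDl divff// gt_eqF.
have -> : ln S = (t1 + t2 + t3) * ln S + (t1 * (a / S) + t2 * (b / S) +
  t3 * (c / S) - (t1 + t2 + t3)).
  by rewrite e t1E; ring.
lra.
Qed.

(** Reduces a = 0 to positive a: for t != 0 the power vanishes, and for t = 0 the convention 0^0 = 1
    lets 1 replace a. *)
Let powR_zero t a : 0 <= a ->
  a `^ t = 0 \/ exists a', [/\ 0 < a', a' `^ t = a `^ t & t * a' = t * a].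
Proof.
rewrite le_eqVlt => /predU1P[<-|a0]; last by right; exists a.
have [->|t0] := eqVneq t 0; last by left; rewrite powR0.
by right; exists 1; rewrite !powRr0 !mul0r.
Qed.

Lemma powR_amgm3 t1 t2 t3 a b c : 0 <= t1 -> 0 <= t2 -> 0 <= t3 ->
  t1 + t2 + t3 = 1 -> 0 <= a -> 0 <= b -> 0 <= c ->
  a `^ t1 * b `^ t2 * c `^ t3 <= t1 * a + t2 * b + t3 * c.
Proof.
move=> t10 t20 t30 tE a0 b0 c0.
have rhs0 : 0 <= t1 * a + t2 * b + t3 * c by rewrite !addr_ge0// mulr_ge0.
have [->|[a' [a'0 <- <-]]] := powR_zero t1 a0; first by rewrite !mul0r.
have [->|[b' [b'0 <- <-]]] := powR_zero t2 b0.
  by rewrite mulr0 mul0r !addr_ge0// mulr_ge0// ltW.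
have [->|[c' [c'0 <- <-]]] := powR_zero t3 c0.
  by rewrite mulr0 !addr_ge0// mulr_ge0// ltW.
exact: powR_amgm3_gt0.
Qed.

End weighted_means.

Section hoelder3.
Context d (T : measurableType d) (R : realType).
Variables (mu : {measure set T -> \bar R}) (D : set T).
Hypothesis mD : measurable D.
Local Open Scope ereal_scope.

(** The weighted mean inequality is applied pointwise to the quotients of the fi by Ai and
    integrated; the right-hand side is at most t1 + t2 + t3 = 1. Positive bounds Ai in place of the
    integrals keep the divisions meaningful when an integral vanishes. *)
Lemma ge0_integral_powR3_le (f1 f2 f3 : T -> R) (t1 t2 t3 A1 A2 A3 : R) :
  measurable_fun D f1 -> measurable_fun D f2 -> measurable_fun D f3 ->
  (forall x, D x -> (0 <= f1 x)%R) -> (forall x, D x -> (0 <= f2 x)%R) ->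
  (forall x, D x -> (0 <= f3 x)%R) ->
  (0 <= t1)%R -> (0 <= t2)%R -> (0 <= t3)%R -> (t1 + t2 + t3 = 1)%R ->
  (0 < A1)%R -> (0 < A2)%R -> (0 < A3)%R ->
  \int[mu]_(x in D) (f1 x)%:E <= A1%:E ->
  \int[mu]_(x in D) (f2 x)%:E <= A2%:E ->
  \int[mu]_(x in D) (f3 x)%:E <= A3%:E ->
  \int[mu]_(x in D) (f1 x `^ t1 * f2 x `^ t2 * f3 x `^ t3)%:E <=
    (A1 `^ t1 * A2 `^ t2 * A3 `^ t3)%:E.
Proof.
move=> mf1 mf2 mf3 f10 f20 f30 t10 t20 t30 tE A10 A20 A30 i1 i2 i3.
set A := (A1 `^ t1 * A2 `^ t2 * A3 `^ t3)%R.
have A0 : (0 <= A)%R by rewrite !mulr_ge0// powR_ge0.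
have [c1 c2 c3] : [/\ 0 <= A * t1 / A1, 0 <= A * t2 / A2 & 0 <= A * t3 / A3]%R.
  by split; apply: divr_ge0; [exact: mulr_ge0|exact: ltW|exact: mulr_ge0|
    exact: ltW|exact: mulr_ge0|exact: ltW].
apply: (@le_trans _ _ (\int[mu]_(x in D) ((A * t1 / A1)%:E * (f1 x)%:E +
    ((A * t2 / A2)%:E * (f2 x)%:E + (A * t3 / A3)%:E * (f3 x)%:E)))).
  apply: ge0_le_integral => //.
  - by move=> x _; rewrite lee_fin !mulr_ge0// powR_ge0.
  - by apply/measurable_EFinP; repeat apply: measurable_funM;
      exact: measurable_funPR.
  - apply: emeasurable_funD; last apply: emeasurable_funD;
      by apply: emeasurable_funM => //; exact/measurable_EFinP.
  - move=> x Dx; rewrite -!EFinM -!EFinD lee_fin.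
    have := powR_amgm3 t10 t20 t30 tE (divr_ge0 (f10 _ Dx) (ltW A10))
      (divr_ge0 (f20 _ Dx) (ltW A20)) (divr_ge0 (f30 _ Dx) (ltW A30)).
    have e (u v t : R) : (0 <= u)%R -> (0 < v)%R ->
      ((u / v) `^ t = u `^ t / v `^ t)%R.
      move=> u0 v0; rewrite powRM// ?invr_ge0 ?ltW//.
      by rewrite -[in X in (_ * X)%R](powR_inv1 (ltW v0)) -powRrM mulN1r powRN.
    rewrite !e ?f10 ?f20 ?f30// => h.
    have h' := ler_wpM2l A0 h.
    apply: le_trans (le_trans h' _); apply: eq_ler.
      rewrite /A; field.
      by rewrite !gt_eqF ?powR_gt0.
    by field; rewrite !gt_eqF.
rewrite ge0_integralD//; last 4 first.
- by move=> x Dx; rewrite mule_ge0 ?lee_fin ?f10.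
- by apply: emeasurable_funM => //; exact/measurable_EFinP.
- by move=> x Dx; rewrite adde_ge0// mule_ge0 ?lee_fin ?f20 ?f30.
- by apply: emeasurable_funD; apply: emeasurable_funM => //;
    exact/measurable_EFinP.
rewrite ge0_integralD//; last 4 first.
- by move=> x Dx; rewrite mule_ge0 ?lee_fin ?f20.
- by apply: emeasurable_funM => //; exact/measurable_EFinP.
- by move=> x Dx; rewrite mule_ge0 ?lee_fin ?f30.
- by apply: emeasurable_funM => //; exact/measurable_EFinP.
rewrite !ge0_integralZl ?lee_fin//; try exact/measurable_EFinP.
apply: (@le_trans _ _ ((A * t1 / A1)%:E * A1%:E + ((A * t2 / A2)%:E * A2%:E +
  (A * t3 / A3)%:E * A3%:E))).
  by rewrite leeD// ?leeD// lee_wpmul2l// lee_fin.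
rewrite -!EFinM -!EFinD lee_fin !divfK ?gt_eqF//.
by apply: eq_ler; rewrite -[RHS]mulr1 -tE; ring.
Qed.

End hoelder3.

Section schur.
Context d (T : measurableType d) (R : realType).
Variables (mu : {sigma_finite_measure set T -> \bar R}) (D : set T).
Variables (a b : T * T -> R) (H G : T -> R) (p q C1 C2 : R).
Hypotheses (mD : measurable D) (ma : measurable_fun (D `*` D) a)
  (mb : measurable_fun (D `*` D) b) (mH : measurable_fun D H)
  (mG : measurable_fun D G).
Hypotheses (a0 : forall x, 0 <= a x) (b0 : forall x, 0 <= b x)
  (H0 : forall z, D z -> 0 < H z) (G0 : forall z, D z -> 0 < G z).
Hypotheses (p1 : 1 <= p) (pq : p <= q) (C10 : 0 < C1) (C20 : 0 < C2).
Hypothesis HG : forall z, D z -> H z `^ (1 - p^-1) = G z `^ q^-1.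
Local Open Scope ereal_scope.
Hypothesis int_a : forall z, D z ->
  \int[mu]_(w in D) (a (z, w) * H w)%:E <= (C1 * H z)%:E.
Hypothesis int_b : forall w, D w ->
  \int[mu]_(z in D) (b (z, w) * G z)%:E <= (C2 * G w)%:E.

(* With 1/p = 1/q + (1/p - 1/q), the integrand is the product of
   (a H)^(1 - 1/p), (b f^p / G)^(1/q) and (f^p)^(1/p - 1/q), to which Hoelder's
   inequality with three factors applies. *)
Lemma schur_test (f : T -> R) (F0 : R) :
  measurable_fun D f -> (forall w, D w -> (0 <= f w)%R) -> (0 < F0)%R ->
  \int[mu]_(w in D) (f w `^ p)%:E <= F0%:E ->
  \int[mu]_(z in D) (\int[mu]_(w in D)
    (a (z, w) `^ (1 - p^-1) * b (z, w) `^ q^-1 * f w)%:E) `^ q <=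
  (C1 `^ ((1 - p^-1) * q) * C2 * F0 `^ (q / p))%:E.
Proof.
move=> mf f0 F00 intf.
have p0 : (0 < p)%R by exact: lt_le_trans ltr01 p1.
have q0 : (0 < q)%R by exact: lt_le_trans p0 pq.
have qp : (q^-1 <= p^-1)%R by rewrite lef_pV2.
have q'0 : (0 < q^-1)%R by rewrite invr_gt0.
have p'1 : (p^-1 <= 1)%R by rewrite invf_le1.
have m2 : measurable_fun (D `*` D) (snd : T * T -> T).
  exact: measurable_funS measurable_snd.
have m1 : measurable_fun (D `*` D) (fst : T * T -> T).
  exact: measurable_funS measurable_fst.
have mc2 (g : T -> R) : measurable_fun D g ->
    measurable_fun (D `*` D) (fun x : T * T => g x.2).
  move=> mg; apply: (measurable_comp (F := D)) => //.
  by move=> _ [x [_ ? <-]].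
have mc1 (g : T -> R) : measurable_fun D g ->
    measurable_fun (D `*` D) (fun x : T * T => g x.1).
  move=> mg; apply: (measurable_comp (F := D)) => //.
  by move=> _ [x [? _ <-]].
have mGV : measurable_fun D (fun w => (G w)^-1)%R.
  apply: (@eq_measurable_fun _ _ _ _ _ (fun w => G w `^ (-1))%R).
    by move=> w; rewrite inE => Dw; rewrite powR_inv1// ltW// G0.
  exact: measurable_funPR.
pose c := (fun x : T * T => b x * (f x.2 `^ p * (G x.2)^-1))%R.
have mc : measurable_fun (D `*` D) c.
  apply: measurable_funM => //; apply: (mc2 (fun w => f w `^ p * (G w)^-1)%R).
  by apply: measurable_funM => //; exact: measurable_funPR.
have c0 z w : D w -> (0 <= c (z, w))%R.
  by move=> Dw; rewrite /c mulr_ge0//= mulr_ge0 ?powR_ge0// invr_ge0 ltW// G0.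
pose k := (fun x : T * T => (a x `^ (1 - p^-1) * b x `^ q^-1 * f x.2))%R.
have mk : measurable_fun (D `*` D) k.
  apply: measurable_funM; last exact: mc2.
  by apply: measurable_funM; exact: measurable_funPR.
have k0 z w : D w -> (0 <= k (z, w))%R.
  by move=> Dw; rewrite /k !mulr_ge0 ?powR_ge0//= f0.
pose K1 := (C1 `^ ((1 - p^-1) * q) * F0 `^ ((p^-1 - q^-1) * q))%R.
have K10 : (0 < K1)%R by rewrite mulr_gt0 ?powR_gt0.
(* Hoelder in w at fixed z. By [HG] the factor H(z)^((1 - 1/p) q) becomes G(z), the weight against
   which [int_b] integrates b in z. *)
have key z : D z -> (\int[mu]_(w in D) (k (z, w))%:E) `^ q <=
    K1%:E * ((G z)%:E * \int[mu]_(w in D) (c (z, w))%:E).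
  move=> Dz; have Hz := H0 Dz; have Gz := G0 Dz.
  set B := (X in _ <= _ * (_ * X)).
  have B0 : 0 <= B by apply: integral_ge0 => w Dw; rewrite lee_fin c0.
  have maz : measurable_fun D (fun w => a (z, w)).
    exact: (measurable_fun_section mD mD ma).
  have mcz : measurable_fun D (fun w => c (z, w)).
    exact: (measurable_fun_section mD mD mc).
  (* Hoelder takes a positive real bound: a finite B, possibly 0, is approached from above, and for
     B = +oo the right-hand side of [key] is +oo. *)
  have : forall A, (0 < A)%R -> B <= A%:E ->
      (\int[mu]_(w in D) (k (z, w))%:E) `^ q <= K1%:E * ((G z)%:E * A%:E).
    move=> A A0 BA.
    have := @ge0_integral_powR3_le _ _ _ mu D mD
      (fun w => a (z, w) * H w)%R (fun w => c (z, w)) (fun w => f w `^ p)%R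
      (1 - p^-1) q^-1 (p^-1 - q^-1) (C1 * H z) A F0.
    rewrite -/B.
    move=> /(_ (measurable_funM maz mH) mcz (measurable_funPR _ mf)).
    have c1z : (0 < C1 * H z)%R by rewrite mulr_gt0// H0.
    have h1 : (0 <= 1 - p^-1)%R by rewrite subr_ge0.
    have h2 : (0 <= p^-1 - q^-1)%R by rewrite subr_ge0.
    have h3 : (1 - p^-1 + q^-1 + (p^-1 - q^-1) = 1)%R by ring.
    move=> /(_ (fun w Dw => mulr_ge0 (a0 _) (ltW (H0 Dw))) (c0 z)
      (fun w _ => powR_ge0 _ _) h1 (ltW q'0) h2 h3 c1z A0 F00 (int_a Dz) BA
        intf).
    have -> : \int[mu]_(w in D) ((a (z, w) * H w) `^ (1 - p^-1) *
        c (z, w) `^ q^-1 * (f w `^ p) `^ (p^-1 - q^-1))%:E =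
        \int[mu]_(w in D) (k (z, w))%:E.
      apply: eq_integral => w; rewrite inE => Dw; congr EFin.
      have fw := f0 _ Dw; have Gw := G0 Dw; have Hw := H0 Dw.
      rewrite /c /k /= !powRM ?a0 ?b0 ?mulr_ge0 ?powR_ge0 ?invr_ge0//;
        try exact: ltW.
      have fE : (f w = (f w `^ p) `^ q^-1 * (f w `^ p) `^ (p^-1 - q^-1))%R.
        rewrite -powRD; last by rewrite addrCA subrr addr0 invr_eq0 gt_eqF.
        by rewrite addrCA subrr addr0 -powRrM mulfV ?gt_eqF// powRr1.
      have GE : ((G w)^-1 `^ q^-1 = (G w `^ q^-1)^-1)%R.
        by rewrite -(powR_inv1 (ltW Gw)) -powRrM mulN1r powRN.
      rewrite HG// GE [in RHS]fE; field.
      by rewrite gt_eqF// powR_gt0.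
    move=> h.
    have : (\int[mu]_(w in D) (k (z, w))%:E) `^ q <=
        ((C1 * H z) `^ (1 - p^-1) * A `^ q^-1 * F0 `^ (p^-1 - q^-1))%:E `^ q.
      apply: gt0_ler_poweR => //; first exact: ltW.
      - rewrite in_itv/= leey andbT; apply: integral_ge0 => w Dw.
        by rewrite lee_fin k0.
      - by rewrite in_itv/= leey andbT lee_fin !mulr_ge0// powR_ge0.
    move=> /le_trans; apply.
    rewrite poweR_EFin -!EFinM lee_fin; apply: eq_ler.
    rewrite !powRM ?mulr_ge0 ?powR_ge0//; try exact: ltW.
    rewrite HG// /K1 -!powRrM mulVf ?gt_eqF// !powRr1; try exact: ltW.
    ring.
  have K1G : (0 < K1 * G z)%R by rewrite mulr_gt0// G0.
  case: (B) B0 => [r|_ _|//].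
  + rewrite lee_fin => r0 h.
    apply/lee_addgt0Pr => e e0.
    apply: le_trans (h (r + e / (K1 * G z))%R _ _) _.
    * by rewrite ltr_wpDl// divr_gt0.
    * by rewrite lee_fin lerDl divr_ge0// ltW.
    rewrite -!EFinM -EFinD lee_fin; apply: eq_ler; field.
    by rewrite !gt_eqF// G0.
  + by rewrite gt0_muley ?lte_fin ?G0// gt0_muley ?lte_fin// leey.
have mGc : measurable_fun (D `*` D)
    (fun x : T * T => ((G x.1 * c x))%:E).
  by apply/measurable_EFinP; apply: measurable_funM => //; exact: mc1.
have Gc0 x y : D x -> D y -> 0 <= ((G x * c (x, y)))%:E.
  by move=> Dx Dy; rewrite lee_fin mulr_ge0 ?c0// ltW// G0.
have Gcint z : D z -> \int[mu]_(w in D) (G z * c (z, w))%:E =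
    (G z)%:E * \int[mu]_(w in D) (c (z, w))%:E.
  move=> Dz; under eq_integral do rewrite EFinM.
  rewrite ge0_integralZl ?lee_fin ?ltW ?G0//.
    apply/measurable_EFinP; exact: (measurable_fun_section mD mD mc).
  by move=> x Dx; rewrite lee_fin c0.
apply: (@le_trans _ _ (\int[mu]_(z in D) (K1%:E *
    \int[mu]_(w in D) (G z * c (z, w))%:E))).
  apply: ge0_le_integral => //.
  - by move=> x Dx; exact: poweR_ge0.
  - have mF : measurable_fun D (fun z => \int[mu]_(w in D) (k (z, w))%:E).
      apply: (measurable_fun_partial_integral (f := EFin \o k)) => //.
        exact/measurable_EFinP.
      by move=> x y Dx Dy; rewrite lee_fin k0.
    exact: (measurableT_comp (measurable_poweR q) mF).
  - apply: emeasurable_funM => //.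
    exact: (measurable_fun_partial_integral (f :=
      fun x : T * T => (G x.1 * c x)%:E)).
  - by move=> z Dz; rewrite Gcint//; exact: key.
rewrite ge0_integralZl//; last 3 first.
- exact: (measurable_fun_partial_integral (f :=
    fun x : T * T => (G x.1 * c x)%:E)).
- by move=> x Dx; apply: integral_ge0 => y Dy; exact: Gc0.
- by rewrite lee_fin ltW.
(* After the exchange the z-integral of b(z, w) G(z) is at most C2 G(w), which cancels the division
   by G(w) in [c]. *)
rewrite (fubini_tonelli_in mD mD mGc Gc0).
apply: (@le_trans _ _ (K1%:E * (C2%:E * F0%:E))); last first.
  rewrite -!EFinM lee_fin; apply: eq_ler; rewrite /K1.
  have -> : (q / p = (p^-1 - q^-1) * q + 1)%R by field; rewrite !gt_eqF.
  rewrite (@powRD _ F0) ?(gt_eqF F00) ?implybT// powRr1 ?ltW//; ring.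
apply: lee_wpmul2l; first by rewrite lee_fin ltW.
apply: (@le_trans _ _ (\int[mu]_(w in D) (C2%:E * (f w `^ p)%:E))).
  apply: ge0_le_integral => //.
  - by move=> y Dy; apply: integral_ge0 => x Dx; exact: Gc0.
  - have := @measurable_fun_partial_integral _ _ _ _ _ D D
      (fun x : T * T => (G x.2 * c (x.2, x.1))%:E) mD mD.
    apply.
      exact: (measurable_fun_swap_in mD mD mGc).
    by move=> x y Dx Dy; exact: Gc0.
  - apply: emeasurable_funM => //; apply/measurable_EFinP;
      exact: measurable_funPR.
  - move=> w Dw.
    have fG0 : (0 <= f w `^ p * (G w)^-1)%R.
      by rewrite mulr_ge0 ?powR_ge0// invr_ge0 ltW// G0.
    have -> : \int[mu]_(z in D) (G z * c (z, w))%:E =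
        (f w `^ p * (G w)^-1)%:E * \int[mu]_(z in D) (b (z, w) * G z)%:E.
      rewrite -ge0_integralZl//.
      - apply: eq_integral => z _; rewrite -EFinM; congr EFin; rewrite /c/=;
          ring.
      - apply/measurable_EFinP; apply: measurable_funM => //.
        apply: (measurable_fun_section mD mD (f :=
          fun x => b (x.2, x.1))) => //.
        exact: measurable_fun_swap_in.
      - by move=> z Dz; rewrite lee_fin mulr_ge0// ltW// G0.
    apply: le_trans (lee_wpmul2l _ (int_b Dw)) _; first by rewrite lee_fin.
    rewrite -!EFinM lee_fin; apply: eq_ler; field.
    by rewrite gt_eqF// G0.
rewrite ge0_integralZl//.
- by apply: lee_wpmul2l => //; rewrite lee_fin ltW.
- apply/measurable_EFinP; exact: measurable_funPR.
- by move=> x _; rewrite lee_fin powR_ge0.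
- by rewrite lee_fin ltW.
Qed.

End schur.

(** * Lebesgue measure on C^n *)

Section product_bounds.
Context d1 d2 (T1 : measurableType d1) (T2 : measurableType d2) (R : realType).
Variables (m1 : {sigma_finite_measure set T1 -> \bar R})
  (m2 : {sigma_finite_measure set T2 -> \bar R}).
Variables (A : set (T1 * T2)) (M : R).
Hypotheses (mA : measurable A) (M0 : 0 <= M).
Local Open Scope ereal_scope.

Lemma product_measure_le_xsection (D : set T1) : measurable D ->
  (forall x y, A (x, y) -> D x) -> (forall x, m2 (xsection A x) <= M%:E) ->
  (m1 \x m2) A <= M%:E * m1 D.
Proof.
move=> mD AD Am; rewrite /product_measure1/=.
rewrite -[leRHS]integral_cst// [leRHS]integral_mkcond.
apply: ge0_le_integral => //.
- exact: measurable_fun_xsection.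
- by apply/(measurable_restrictT _ mD); exact: measurable_cst.
move=> x _; rewrite /patch; case: ifPn => Dx; first exact: Am.
rewrite (_ : xsection A x = set0) ?measure0//.
rewrite -subset0 => y; rewrite /xsection/= inE => /AD Dx'.
by move/negP: Dx; rewrite inE.
Qed.

Lemma product_measure_le_ysection (D : set T2) : measurable D ->
  (forall x y, A (x, y) -> D y) -> (forall y, m1 (ysection A y) <= M%:E) ->
  (m1 \x m2) A <= M%:E * m2 D.
Proof.
move=> mD AD Am.
have -> : (m1 \x m2) A = (m1 \x^ m2) A.
  apply: product_measure_unique => // X Y mX mY.
  exact: product_measure2E.
rewrite /product_measure2/=.
rewrite -[leRHS]integral_cst// [leRHS]integral_mkcond.
apply: ge0_le_integral => //.
- exact: measurable_fun_ysection.
- by apply/(measurable_restrictT _ mD); exact: measurable_cst.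
move=> y _; rewrite /patch; case: ifPn => Dy; first exact: Am.
rewrite (_ : ysection A y = set0) ?measure0//.
rewrite -subset0 => x; rewrite /ysection/= inE => /AD Dy'.
by move/negP: Dy; rewrite inE.
Qed.

End product_bounds.

Section complex_plane.
Variable R : realType.
Notation lam1 := (@complex_lebesgue R).
Notation leb := (@lebesgue_measure R).
Local Open Scope ereal_scope.

Definition rectangle (I J : set R) : set R[i] :=
  [set z | I (complex.Re z) /\ J (complex.Im z)].

Lemma measurable_rectangle (I J : set R) :
  measurable I -> measurable J -> measurable (rectangle I J).
Proof.
move=> mI mJ.
rewrite (_ : rectangle I J = @complex_pair R @^-1` (I `*` J)); last first.
  by apply/seteqP; split => -[].
by rewrite -[X in measurable X]setTI; apply: measurable_complex_pair => //;
  exact: measurableX.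
Qed.

Lemma complex_lebesgue_rectangle (I J : set R) :
  measurable I -> measurable J -> lam1 (rectangle I J) = leb I * leb J.
Proof.
move=> mI mJ; rewrite /complex_lebesgue /pushforward.
by rewrite (_ : _ @^-1` _ = I `*` J) ?product_measure1E.
Qed.

Lemma complex_lebesgue_le_vertical (S : set R[i]) (I J : set R) (m : R) :
  measurable S -> measurable J -> (0 <= m)%R ->
  (forall t, exists2 X, measurable X /\ leb X <= m%:E &
     forall z, S z -> complex.Im z = t -> X (complex.Re z)) ->
  (forall z, S z -> J (complex.Im z)) ->
  lam1 S <= m%:E * leb J.
Proof.
move=> mS mJ m0 SX SJ; rewrite /complex_lebesgue /pushforward.
have mS' : measurable (@pair_complex R @^-1` S).
  by rewrite -[X in measurable X]setTI; exact: measurable_pair_complex.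
apply: product_measure_le_ysection => //; first by move=> x y /= /SJ.
move=> t; have [X [mX Xm] XS] := SX t.
apply: le_trans Xm; apply: le_measure; rewrite ?inE//.
  exact: measurable_ysection.
by move=> x; rewrite /ysection/= inE => /XS/=; exact.
Qed.

Lemma complex_lebesgue_le_horizontal (S : set R[i]) (I J : set R) (m : R) :
  measurable S -> measurable J -> (0 <= m)%R ->
  (forall t, exists2 X, measurable X /\ leb X <= m%:E &
     forall z, S z -> complex.Re z = t -> X (complex.Im z)) ->
  (forall z, S z -> J (complex.Re z)) ->
  lam1 S <= m%:E * leb J.
Proof.
move=> mS mJ m0 SX SJ; rewrite /complex_lebesgue /pushforward.
have mS' : measurable (@pair_complex R @^-1` S).
  by rewrite -[X in measurable X]setTI; exact: measurable_pair_complex.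
apply: product_measure_le_xsection => //; first by move=> x y /= /SJ.
move=> t; have [X [mX Xm] XS] := SX t.
apply: le_trans Xm; apply: le_measure; rewrite ?inE//.
  exact: measurable_xsection.
by move=> x; rewrite /xsection/= inE => /XS/=; exact.
Qed.

End complex_plane.

Section polydisc.
Variable R : realType.
Notation lam1 := (@complex_lebesgue R).
Local Open Scope ereal_scope.

Definition box n (D : 'I_n -> set R[i]) : set (Cn R n) :=
  [set w | forall k, D k (tnth w k)].

Lemma measurable_box n (D : 'I_n -> set R[i]) :
  (forall k, measurable (D k)) -> measurable (box D).
Proof.
move=> mD.
rewrite (_ : box D = \bigcap_(k in [set: 'I_n]) ((fun w : Cn R n => tnth w k)
  @^-1` D k)).
  apply: fin_bigcap_measurable => // k _.
  by rewrite -[X in measurable X]setTI; exact: measurable_tnth.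
by apply/seteqP; split => w /= h k; [move=> _|]; exact: h.
Qed.

Lemma lebesgue_Cn_box n (D : 'I_n -> set R[i]) (a : 'I_n -> R) :
  (forall k, measurable (D k)) -> (forall k, lam1 (D k) = (a k)%:E) ->
  lebesgue_Cn R n (box D) = (\prod_k a k)%:E.
Proof.
rewrite /lebesgue_Cn; elim: n D a => [|n IH] D a mD Da.
  by rewrite big_ord0 /= diracE mem_set// => -[].
rewrite big_ord_recl EFinM -Da -(IH (fun k => D (lift ord0 k)))//=.
rewrite /cons_measure /pushforward -product_measure1E//;
  last exact: measurable_box.
congr (_ _); apply/seteqP; split => -[x y] /=.
  move=> h; split=> /=; first by have := h ord0; rewrite tnth0.
  by move=> k; have := h (lift ord0 k); rewrite tnthS.
move=> [/= h0 hS] k; case: (unliftP ord0 k) => [k'|] ->.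
  by rewrite tnthS.
by rewrite tnth0.
Qed.

(** Tonelli with coordinate j innermost: its fibres have area at most m, and the other coordinates
    lie in sets of area A. The last hypothesis takes a full tuple v whose j-th entry is ignored, so
    that it restricts to tails in the induction on n. *)
Lemma lebesgue_Cn_slice n (j : 'I_n) (D : 'I_n -> set R[i]) (S : set (Cn R n))
    (A m : R) : measurable S -> (0 <= m)%R -> (0 <= A)%R ->
  (forall k, measurable (D k)) -> (forall k, lam1 (D k) = A%:E) ->
  (forall w, S w -> forall k, k != j -> D k (tnth w k)) ->
  (forall v : Cn R n, exists2 X, measurable X /\ lam1 X <= m%:E &
    forall w, S w -> (forall k, k != j -> tnth w k = tnth v k) ->
      X (tnth w j)) ->
  lebesgue_Cn R n S <= (A ^+ n.-1 * m)%:E.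
Proof.
rewrite /lebesgue_Cn => mS m0 A0;
  elim: n j D S mS => [[]//|n IH] j D S mS mD DA SD SX.
rewrite /= /cons_measure /pushforward.
have mS' : measurable (tuple_cons (n:=n) @^-1` S).
  by rewrite -[X in measurable X]setTI; exact: measurable_cons.
case: (unliftP ord0 j) => [j' jE|jE].
  rewrite (_ : A ^+ n * m = (A ^+ n.-1 * m) * A)%R; last first.
    by case: n j' {IH D S mS mD DA SD SX mS' j jE} => [[]//|n _];
      rewrite exprSr mulrAC.
  rewrite EFinM -(DA ord0); apply: product_measure_le_xsection => //.
  - move=> x y /= /SD; move/(_ ord0); rewrite tnth0; apply.
    by rewrite jE neq_lift.
  - move=> x; apply: (IH j' (fun k => D (lift ord0 k))) => //.
    + exact: measurable_xsection.
    + move=> w; rewrite /xsection/= inE => /SD Dw k kj.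
      have := Dw (lift ord0 k); rewrite tnthS; apply.
      by rewrite jE (inj_eq lift_inj).
    + move=> v; have [X mX XS] := SX (tuple_cons (x, v)).
      exists X => // w; rewrite /xsection/= inE => /XS h hw.
      have := h _; rewrite jE tnthS; apply => k kj.
      case: (unliftP ord0 k) kj => [k'|] ->; last by rewrite !tnth0.
      by rewrite (inj_eq lift_inj) !tnthS => /hw.
rewrite (_ : A ^+ n = \prod_(k < n) A)%R; last by rewrite prodr_const card_ord.
rewrite mulrC EFinM -(lebesgue_Cn_box (D := fun k => D (lift ord0 k)))//.
apply: product_measure_le_ysection => //.
- by apply: measurable_box => k.
- move=> x y /= /SD h k; have := h (lift ord0 k); rewrite tnthS; apply.
  by rewrite jE eq_sym neq_lift.
(* The entry 0 is a placeholder for coordinate j, here the first one, which [SX] ignores. *)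
- move=> y; have [X [mX Xm] XS] := SX [tuple of (0%R : R[i]) :: y].
  apply: le_trans Xm; apply: le_measure; rewrite ?inE//.
    exact: measurable_ysection.
  move=> x; rewrite /ysection/= inE => /XS h.
  have := h _; rewrite jE tnth0; apply => k.
  by case: (unliftP ord0 k) => [k'|] ->; rewrite ?eqxx// !tnthS.
Qed.

End polydisc.

(** * The kernel 1 - <z, w> *)

Section complex_numbers.
Variable R : realType.
Implicit Types z w : R[i].
Notation re := (@complex.Re R).
Notation im := (@complex.Im R).

Lemma sqr_normcE z : normc z ^+ 2 = re z ^+ 2 + im z ^+ 2.
Proof. by case: z => a b /=; rewrite sqr_sqrtr// addr_ge0// sqr_ge0. Qed.

Lemma normc_ge0 z : 0 <= normc z.
Proof. by case: z => a b; exact: sqrtr_ge0. Qed.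

Lemma normr_Re_le z : `|re z| <= normc z.
Proof.
rewrite -(ler_pXn2r (ltn0Sn 1)) ?nnegrE ?normc_ge0// sqr_normcE real_normK
  ?num_real//.
by rewrite lerDl sqr_ge0.
Qed.

Lemma normr_Im_le z : `|im z| <= normc z.
Proof.
rewrite -(ler_pXn2r (ltn0Sn 1)) ?nnegrE ?normc_ge0// sqr_normcE real_normK
  ?num_real//.
by rewrite lerDr sqr_ge0.
Qed.

Lemma normc_le z : normc z <= `|re z| + `|im z|.
Proof.
rewrite -(ler_pXn2r (ltn0Sn 1)) ?nnegrE ?normc_ge0 ?addr_ge0// sqr_normcE.
rewrite -[in leLHS](real_normK (num_real (re z))) -[in leLHS](real_normK
  (num_real (im z))).
by have := mulr_ge0 (normr_ge0 (re z)) (normr_ge0 (im z)); nra.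
Qed.

Lemma normc_conj z : normc (z^*)%C = normc z.
Proof. by case: z => a b /=; rewrite sqrrN. Qed.

Lemma cReD z w : re (z + w) = re z + re w. Proof. by case: z; case: w. Qed.
Lemma cImD z w : im (z + w) = im z + im w. Proof. by case: z; case: w. Qed.
Lemma cReN z : re (- z) = - re z. Proof. by case: z. Qed.
Lemma cImN z : im (- z) = - im z. Proof. by case: z. Qed.
Lemma cReM z w : re (z * w) = re z * re w - im z * im w.
Proof. by case: z; case: w. Qed.
Lemma cImM z w : im (z * w) = re z * im w + im z * re w.
Proof. by case: z => a b; case: w => c d /=; ring. Qed.

Lemma Re_sum I (r : seq I) (P : pred I) (f : I -> R[i]) :
  re (\sum_(i <- r | P i) f i) = \sum_(i <- r | P i) re (f i).
Proof. by apply: (big_morph re (id1 := 0)) => // z w; exact: cReD. Qed.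

Lemma Im_sum I (r : seq I) (P : pred I) (f : I -> R[i]) :
  im (\sum_(i <- r | P i) f i) = \sum_(i <- r | P i) im (f i).
Proof. by apply: (big_morph im (id1 := 0)) => // z w; exact: cImD. Qed.

Lemma normc_sum I (r : seq I) (P : pred I) (f : I -> R[i]) :
  normc (\sum_(i <- r | P i) f i) <= \sum_(i <- r | P i) normc (f i).
Proof.
elim/big_rec2: _ => [|i y x _ h]; first by rewrite normc0.
by apply: le_trans (le_normcD _ _) _; rewrite lerD2l.
Qed.

Lemma measurable_Re : measurable_fun [set: R[i]] re.
Proof. by have /measurable_fun_pairP[] := @measurable_complex_pair R. Qed.

Lemma measurable_Im : measurable_fun [set: R[i]] im.
Proof. by have /measurable_fun_pairP[] := @measurable_complex_pair R. Qed.

End complex_numbers.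

Lemma measurable_fun_complex d (T : measurableType d) (R : realType)
    (D : set T) (f : T -> R[i]) : measurable D ->
  measurable_fun D (fun x => complex.Re (f x)) ->
  measurable_fun D (fun x => complex.Im (f x)) -> measurable_fun D f.
Proof.
move=> mD mr mi.
have mp : measurable_fun setT ((fun x => complex_pair (f x)) \_ D).
  apply/measurable_fun_pairP; split.
    rewrite (_ : _ \o _ = ((fun x => complex.Re (f x)) : T ->
      measurableTypeR R) \_ D).
      exact/(measurable_restrictT _ mD).
    by apply/funext => x /=; rewrite /patch; case: ifP.
  rewrite (_ : _ \o _ = ((fun x => complex.Im (f x)) : T ->
    measurableTypeR R) \_ D).
    exact/(measurable_restrictT _ mD).
  by apply/funext => x /=; rewrite /patch; case: ifP.
have := (measurable_restrictT _ mD).2 mp => mp'.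
have := measurableT_comp (@measurable_pair_complex R) mp'.
by apply: eq_measurable_fun => x _ /=; case: (f x).
Qed.

Lemma measurable_bigsetU_le d (T : measurableType d) (R : realType)
    (mu : {measure set T -> \bar R}) (I : finType) (A : I -> set T)
    (S : set T) (M : R) :
  measurable S -> (forall i, measurable (A i)) ->
  (forall x, S x -> exists i, A i x) -> (forall i, mu (A i) <= M%:E)%E ->
  (mu S <= (#|I|%:R * M)%:E)%E.
Proof.
move=> mS mA SA AM.
have mU (r : seq I) : measurable (\big[setU/set0]_(i <- r) A i).
  by elim/big_rec: _ => // i X _ mX; exact: measurableU.
apply: (@le_trans _ _ (mu (\big[setU/set0]_(i <- enum I) A i))).
  apply: le_measure; rewrite ?inE//.
  move=> x /SA[i Ai]; rewrite -bigcup_seq; exists i => //=.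
  by rewrite mem_enum.
rewrite cardE.
elim: (enum I) => [|i r IH]; first by rewrite big_nil measure0 mul0r.
rewrite big_cons /= -natr1 mulrDl mul1r addrC EFinD.
apply: le_trans (measureU2 _ (mA i) (mU r)) _.
by apply: leeD; [exact: AM|exact: IH].
Qed.

Lemma measurable_normc d (T : measurableType d) (R : realType) (D : set T)
    (f : T -> R[i]) :
  measurable_fun D f -> measurable_fun D (fun x => normc (f x)).
Proof.
move=> mf.
apply: (eq_measurable_fun
    (fun x => (complex.Re (f x) ^+ 2 + complex.Im (f x) ^+ 2) `^ 2^-1)).
  by move=> w _; rewrite -sqr_normcE powR12_sqrt ?sqr_ge0// sqrtr_sqr ger0_norm
    ?normc_ge0.
apply: measurable_funPR; apply: measurable_funD; apply: measurable_funX.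
  exact: measurableT_comp (@measurable_Re R) mf.
exact: measurableT_comp (@measurable_Im R) mf.
Qed.

Section hdot.
Variables (R : realType) (n : nat).
Implicit Types z w : Cn R n.
Notation re := (@complex.Re R).
Notation im := (@complex.Im R).

Lemma Re_hdot z w : re (hdot z w) =
  \sum_(j < n) (re (tnth z j) * re (tnth w j) + im (tnth z j) * im (tnth w j)).
Proof.
rewrite /hdot Re_sum; apply: eq_bigr => j _.
by case: (tnth z j); case: (tnth w j) => a b c e /=; rewrite mulrN opprK.
Qed.

Lemma Im_hdot z w : im (hdot z w) =
  \sum_(j < n) (im (tnth z j) * re (tnth w j) - re (tnth z j) * im (tnth w j)).
Proof.
rewrite /hdot Im_sum; apply: eq_bigr => j _.
by case: (tnth z j); case: (tnth w j) => a b c e /=; rewrite mulrN addrC.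
Qed.

Lemma Re_hdotC z w : re (hdot z w) = re (hdot w z).
Proof.
by rewrite !Re_hdot; apply: eq_bigr => j _; rewrite mulrC (mulrC (im _)).
Qed.

Lemma Im_hdotC z w : im (hdot z w) = - im (hdot w z).
Proof.
by rewrite !Im_hdot -sumrN; apply: eq_bigr => j _; ring.
Qed.

Lemma normc_hdotC z w : normc (1 - hdot z w) = normc (1 - hdot w z).
Proof.
apply: (@pexpIrn _ 2%N) => //; rewrite ?nnegrE ?normc_ge0//.
apply: (etrans (sqr_normcE _)); apply: (etrans _ (esym (sqr_normcE _))).
rewrite !cReD !cReN !cImD !cImN Re_hdotC Im_hdotC /=.
ring.
Qed.

Lemma sqnorm_ge0 z : 0 <= sqnorm z.
Proof. by apply: sumr_ge0 => j _; exact: sqr_ge0. Qed.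

(** Adding 2 - |z|^2 - |w|^2 to both sides gives 2 Re (1 - <z, w>) on the right: the lower bounds on
    Re (1 - <z, w>) and the coordinate bound [normc_coord_le] follow. *)
Lemma sqnorm_diff z w :
  \sum_(j < n) normc (tnth z j - tnth w j) ^+ 2 =
  sqnorm z + sqnorm w - 2 * re (hdot z w).
Proof.
rewrite /sqnorm Re_hdot mulr_sumr -big_split /= -sumrB.
apply: eq_bigr => j _; rewrite !sqr_normcE !cReD !cImD !cReN !cImN; ring.
Qed.

Lemma Re_hdot_ge z w :
  ((1 - sqnorm z) + (1 - sqnorm w)) / 2 <= re (1 - hdot z w).
Proof.
have : 0 <= \sum_(j < n) normc (tnth z j - tnth w j) ^+ 2.
  by apply: sumr_ge0 => j _; exact: sqr_ge0.
by rewrite sqnorm_diff cReD cReN /=; lra.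
Qed.

Lemma Re_hdot_gt0 z w : Bn z -> Bn w -> 0 < re (1 - hdot z w).
Proof. by rewrite /Bn/= => hz hw; apply: lt_le_trans (Re_hdot_ge z w); lra. Qed.

Lemma Re_le_normc (u : R[i]) : re u <= normc u.
Proof. exact: le_trans (ler_norm _) (normr_Re_le _). Qed.

Lemma normc_hdot_ge z w : Bn z -> Bn w ->
  1 - sqnorm z <= 2 * normc (1 - hdot z w).
Proof.
rewrite /Bn/= => hz hw; have := Re_hdot_ge z w;
  have := Re_le_normc (1 - hdot z w).
lra.
Qed.

Lemma normc_hdot_ger z w : Bn z -> Bn w ->
  1 - sqnorm w <= 2 * normc (1 - hdot z w).
Proof.
rewrite /Bn/= => hz hw; have := Re_hdot_ge z w;
  have := Re_le_normc (1 - hdot z w).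
lra.
Qed.

Lemma normc_hdot_gt0 z w : Bn z -> Bn w -> 0 < normc (1 - hdot z w).
Proof. by move=> hz hw; exact: lt_le_trans (Re_hdot_gt0 hz hw) (Re_le_normc _).
  Qed.

Lemma normc_hdot_le2 z w : Bn z -> Bn w -> normc (1 - hdot z w) <= 2.
Proof.
rewrite /Bn/= => hz hw; apply: le_trans (le_normcD _ _) _.
rewrite normcN normc1.
suff : normc (hdot z w) <= (sqnorm z + sqnorm w) / 2 by lra.
apply: le_trans (normc_sum _ _ _) _.
rewrite /sqnorm -big_split /= mulr_suml; apply: ler_sum => j _.
rewrite normcM normc_conj.
have := sqr_ge0 (normc (tnth z j) - normc (tnth w j)); nra.
Qed.

Lemma normc_coord_le z w j : Bn z -> Bn w ->
  normc (tnth z j - tnth w j) ^+ 2 <= 2 * normc (1 - hdot z w).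
Proof.
rewrite /Bn/= => hz hw.
have : \sum_(j < n) normc (tnth z j - tnth w j) ^+ 2 <= 2 * re (1 - hdot z w).
  by rewrite sqnorm_diff cReD cReN /=; lra.
rewrite (bigD1 j)//= => h.
have h2 : 0 <= \sum_(i < n | i != j) normc (tnth z i - tnth w i) ^+ 2.
  by apply: sumr_ge0 => i _; exact: sqr_ge0.
by have := Re_le_normc (1 - hdot z w); lra.
Qed.

(** On a slice <z, w> is affine in the conjugate of w_j with slope z_j. Two points of the slice with
    |1 - <z, w>| < r are thus within 2 r / |z_j| of each other, which improves the sqrt r of
    [normc_coord_le] to r in one coordinate. *)
Lemma normc_coord_mul_le z w w' j :
  (forall k, k != j -> tnth w k = tnth w' k) ->
  normc (tnth z j) * normc (tnth w j - tnth w' j) <=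
  normc (1 - hdot z w) + normc (1 - hdot z w').
Proof.
move=> ww'.
have -> : normc (tnth z j) * normc (tnth w j - tnth w' j) =
    normc ((1 - hdot z w') - (1 - hdot z w)).
  have -> : 1 - hdot z w' - (1 - hdot z w) = hdot z w - hdot z w' by ring.
  rewrite /hdot -sumrB (bigD1 j)//= big1 ?addr0; last first.
    by move=> k kj; rewrite ww'// subrr.
  by rewrite -mulrBr -rmorphB normcM normc_conj.
by apply: le_trans (le_normcD _ _) _; rewrite normcN addrC.
Qed.

Lemma sqnorm_sliceE w w' j : (forall k, k != j -> tnth w k = tnth w' k) ->
  sqnorm w - normc (tnth w j) ^+ 2 = sqnorm w' - normc (tnth w' j) ^+ 2.
Proof.
move=> ww'; rewrite /sqnorm (bigD1 j)//= [X in _ = X - _](bigD1 j)//=.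
have -> : \sum_(i < n | i != j) normc (tnth w i) ^+ 2 =
    \sum_(i < n | i != j) normc (tnth w' i) ^+ 2.
  by apply: eq_bigr => k kj; rewrite ww'.
ring.
Qed.

Lemma Bn_coord_lt1 w j : Bn w -> normc (tnth w j) ^+ 2 < 1.
Proof.
rewrite /Bn/= => hw; apply: le_lt_trans hw; rewrite /sqnorm (bigD1 j)//= lerDl.
by apply: sumr_ge0 => i _; exact: sqr_ge0.
Qed.

Lemma measurable_Re_hdot : measurable_fun [set: Cn R n * Cn R n]
  (fun x => re (1 - hdot x.1 x.2)).
Proof.
rewrite (_ : (fun _ => _) = (fun x : Cn R n * Cn R n => 1 - \sum_(j < n)
  (re (tnth x.1 j) * re (tnth x.2 j) + im (tnth x.1 j) * im (tnth x.2 j))));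
    last first.
  by apply/funext => x; rewrite cReD cReN Re_hdot.
apply: measurable_funB => //; apply: measurable_sum => j.
have m1 : measurable_fun [set: Cn R n * Cn R n] (fun x => tnth x.1 j).
  exact: (measurableT_comp (measurable_tnth j) measurable_fst).
have m2 : measurable_fun [set: Cn R n * Cn R n] (fun x => tnth x.2 j).
  exact: (measurableT_comp (measurable_tnth j) measurable_snd).
apply: measurable_funD; apply: measurable_funM.
- exact: (measurableT_comp (@measurable_Re R) m1).
- exact: (measurableT_comp (@measurable_Re R) m2).
- exact: (measurableT_comp (@measurable_Im R) m1).
- exact: (measurableT_comp (@measurable_Im R) m2).
Qed.

Lemma measurable_Im_hdot : measurable_fun [set: Cn R n * Cn R n]
  (fun x => im (1 - hdot x.1 x.2)).
Proof.
rewrite (_ : (fun _ => _) = (fun x : Cn R n * Cn R n => - \sum_(j < n)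
  (im (tnth x.1 j) * re (tnth x.2 j) - re (tnth x.1 j) * im (tnth x.2 j))));
    last first.
  by apply/funext => x; rewrite cImD cImN Im_hdot /= add0r.
apply: measurable_funN; apply: measurable_sum => j.
have m1 : measurable_fun [set: Cn R n * Cn R n] (fun x => tnth x.1 j).
  exact: (measurableT_comp (measurable_tnth j) measurable_fst).
have m2 : measurable_fun [set: Cn R n * Cn R n] (fun x => tnth x.2 j).
  exact: (measurableT_comp (measurable_tnth j) measurable_snd).
apply: measurable_funB; apply: measurable_funM.
- exact: (measurableT_comp (@measurable_Im R) m1).
- exact: (measurableT_comp (@measurable_Re R) m2).
- exact: (measurableT_comp (@measurable_Re R) m1).
- exact: (measurableT_comp (@measurable_Im R) m2).
Qed.

Lemma measurable_normc_hdot : measurable_fun [set: Cn R n * Cn R n]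
  (fun x => normc (1 - hdot x.1 x.2)).
Proof.
rewrite (_ : (fun _ => _) = (fun x : Cn R n * Cn R n =>
    ((re (1 - hdot x.1 x.2) ^+ 2 + im (1 - hdot x.1 x.2) ^+ 2) `^ 2^-1))).
  apply: measurable_funPR; apply: measurable_funD; apply: measurable_funX.
    exact: measurable_Re_hdot.
  exact: measurable_Im_hdot.
apply/funext => x; rewrite powR12_sqrt ?addr_ge0 ?sqr_ge0//.
by case: (1 - _).
Qed.

End hdot.

(** * Carleson boxes *)

Section shells.
Variable R : realType.
Notation lam1 := (@complex_lebesgue R).
Notation leb := (@lebesgue_measure R).
Notation re := (@complex.Re R).
Notation im := (@complex.Im R).

(** With s0^2 = max (b - h, eta^2), every such s satisfies s0 <= |s| and (|s| - s0) eta <= s^2 -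
    s0^2 <= h, so two intervals of length h / eta suffice. Staying away from 0 is what makes this
    linear in h. *)
Lemma shell_cover (b h eta : R) : 0 <= h -> 0 < eta ->
  exists2 X : set R, measurable X /\ (leb X <= (2 * h / eta)%:E)%E &
    forall s, eta <= `|s| -> b - h <= s ^+ 2 -> s ^+ 2 <= b -> X s.
Proof.
move=> h0 eta0.
pose m := Num.max (b - h) (eta ^+ 2); pose s0 := Num.sqrt m.
have m0 : 0 <= m by rewrite le_max sqr_ge0 orbT.
have s02 : s0 ^+ 2 = m by rewrite sqr_sqrtr.
have s0eta : eta <= s0.
  have eta_ge0 := ltW eta0.
  by rewrite -(ler_pXn2r (ltn0Sn 1)) ?nnegrE ?sqrtr_ge0// s02 le_max lexx orbT.
exists (`[s0, s0 + h / eta]%classic `|` `[- s0 - h / eta, - s0]%classic).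
  have he0 : 0 <= h / eta by rewrite divr_ge0// ltW.
  split; first exact: measurableU.
  set I1 := `[s0, _]%classic; set I2 := `[_, - s0]%classic.
  apply: (@le_trans _ _ (leb I1 + leb I2)%E).
    by apply: measureU2; exact: measurable_itv.
  rewrite /I1 /I2.
  rewrite !lebesgue_measure_itv/= !lte_fin.
  case: ifP => _; case: ifP => _; rewrite ?adde0 ?add0e -?EFinD ?lee_fin; lra.
move=> s es bs sb.
have s2 : `|s| ^+ 2 = s ^+ 2 by rewrite real_normK ?num_real.
have sm : s0 <= `|s|.
  rewrite -(ler_pXn2r (ltn0Sn 1)) ?nnegrE ?sqrtr_ge0//.
  have eta_ge0 := ltW eta0.
  by rewrite s02 s2 /m ge_max bs -s2 /= ler_pXn2r ?nnegrE.
have hs : `|s| <= s0 + h / eta.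
  rewrite -lerBlDl ler_pdivlMr//.
  have mb : b - h <= m by rewrite le_max lexx.
  by nra.
have [s_ge0|s_lt0] := leP 0 s; [left|right].
  by move: sm hs; rewrite ger0_norm//= in_itv/= => -> ->.
by move: sm hs; rewrite ltr0_norm//= in_itv/= => h1 h2; apply/andP; split; lra.
Qed.

Section slabs.
Variables P Q : R[i] -> R.
Hypotheses (mP : measurable_fun setT P) (mQ : measurable_fun setT Q)
  (normPQ : forall z, normc z ^+ 2 = P z ^+ 2 + Q z ^+ 2).
Hypothesis slice_bound : forall (S : set R[i]) (J : set R) (m : R),
  measurable S -> measurable J -> 0 <= m ->
  (forall t, exists2 X, measurable X /\ (leb X <= m%:E)%E &
     forall z, S z -> Q z = t -> X (P z)) ->
  (forall z, S z -> J (Q z)) ->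
  (lam1 S <= m%:E * leb J)%E.

(** [P] and [Q] are the real and imaginary parts in either order. For a fixed value of Q the
    condition on |z|^2 is a shell condition on P alone, handled by [shell_cover]; Q itself ranges
    over an interval of length 2 rho. *)
Let plane_shell (b h eta rho c : R) : 0 <= h -> 0 < eta -> 0 <= rho ->
  exists2 X : set R[i],
    measurable X /\ (lam1 X <= ((2 * h / eta) * (2 * rho))%:E)%E &
    forall z, eta <= `|P z| -> b - h <= normc z ^+ 2 -> normc z ^+ 2 <= b ->
      `|Q z - c| <= rho -> X z.
Proof.
move=> h0 eta0 rho0.
pose X := [set z | [/\ eta <= `|P z|, b - h <= normc z ^+ 2,
  normc z ^+ 2 <= b & `|Q z - c| <= rho]].
have mnorm : measurable_fun setT (fun z : R[i] => normc z ^+ 2 : R).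
  apply: (eq_measurable_fun (fun z : R[i] => P z ^+ 2 + Q z ^+ 2)).
    by move=> z _; rewrite normPQ.
  by apply: measurable_funD; exact: measurable_funX.
have mX : measurable X.
  rewrite (_ : X = ((fun z => `|P z|) @^-1` `[eta, +oo[%classic) `&`
    ((fun z => normc z ^+ 2) @^-1` `[b - h, b]%classic) `&`
    ((fun z => `|Q z - c|) @^-1` `]-oo, rho]%classic)); last first.
    apply/seteqP; split => z; rewrite /X /= !in_itv/= !andbT.
      by move=> [-> -> -> ->].
    by move=> [[-> /andP[-> ->]] ->].
  apply: measurableI; first apply: measurableI;
      rewrite -[X in measurable X]setTI.
  - have : measurable_fun setT (fun z => `|P z|) by exact: measurableT_comp.
    exact.
  - exact: mnorm.
  - have : measurable_fun setT (fun z => `|Q z - c|).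
      by apply: measurableT_comp => //; exact: measurable_funB.
    exact.
exists X; last by move=> z *; split.
split=> //.
apply: le_trans (slice_bound (J := `[c - rho, c + rho]%classic)
  (m := 2 * h / eta) mX _ _ _ _) _ => //.
- by rewrite divr_ge0 ?mulr_ge0// ltW.
- move=> t; have [Y mY hY] := shell_cover (b - t ^+ 2) h0 eta0.
  exists Y => // z [h1 h2 h3 _] Qt; apply: hY => //.
    by move: h2; rewrite normPQ Qt; lra.
  by move: h3; rewrite normPQ Qt; lra.
- move=> z [_ _ _]; rewrite /= in_itv/= ler_norml; lra.
- rewrite lebesgue_measure_itv/= lte_fin [leRHS]EFinM; apply: lee_wpmul2l.
    by rewrite lee_fin divr_ge0 ?mulr_ge0// ltW.
  case: ifP => _; rewrite -?EFinD lee_fin; lra.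
Qed.

(** On a slice the other coordinates contribute a constant to |w|^2, so the shell of the ball
    becomes a plane shell in coordinate j. A point w' of S on the slice provides that constant and
    the centre of the interval for Q; a slice missing S is covered by the empty set. *)
Lemma lebesgue_Cn_slab n (j : 'I_n) (D : 'I_n -> set R[i]) (S : set (Cn R n))
    (A h eta rho : R) :
  0 <= h -> 0 < eta -> 0 <= rho -> 0 <= A -> measurable S ->
  (forall k, measurable (D k)) -> (forall k, lam1 (D k) = A%:E) ->
  (forall w, S w -> forall k, D k (tnth w k)) ->
  (forall w, S w -> [/\ eta <= `|P (tnth w j)|,
    1 - h <= sqnorm w & sqnorm w <= 1]) ->
  (forall w w', S w -> S w' -> (forall k, k != j -> tnth w k = tnth w' k) ->
    `|Q (tnth w j) - Q (tnth w' j)| <= rho) ->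
  (lebesgue_Cn R n S <= (A ^+ n.-1 * ((2 * h / eta) * (2 * rho)))%:E)%E.
Proof.
move=> h0 eta0 rho0 A0 mS mD DA SD Sh SQ.
apply: (lebesgue_Cn_slice (j := j) (D := D)) => //.
- by rewrite mulr_ge0 ?divr_ge0 ?mulr_ge0// ltW.
- by move=> w Sw k _; exact: SD.
move=> v.
have [[w' [Sw' w'v]]|nw] := pselect (exists w, S w /\ forall k,
  k != j -> tnth w k = tnth v k).
  have [X mX hX] := plane_shell (1 - (sqnorm w' - normc (tnth w' j) ^+ 2))
    (Q (tnth w' j)) h0 eta0 rho0.
  exists X => // w Sw wv.
  have ww' k : k != j -> tnth w k = tnth w' k by move=> kj; rewrite wv// w'v.
  have [h1 h2 h3] := Sh _ Sw; have e := sqnorm_sliceE ww'.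
  apply: hX => //; [lra|lra|exact: SQ].
exists set0; first by split => //;
  rewrite measure0 lee_fin mulr_ge0 ?divr_ge0 ?mulr_ge0// ltW.
by move=> w Sw wv; exfalso; apply: nw; exists w.
Qed.

End slabs.

End shells.

Section ball_pieces.
Variables (R : realType) (n : nat).
Hypothesis n0 : (0 < n)%N.
Notation lam := (@lebesgue_Cn R n).
Notation re := (@complex.Re R).
Notation im := (@complex.Im R).
Notation leb := (@lebesgue_measure R).
Implicit Types z w : Cn R n.

Definition square (c : R[i]) (s : R) : set R[i] :=
  rectangle `[re c - s, re c + s]%classic `[im c - s, im c + s]%classic.

Lemma measurable_square c s : measurable (square c s).
Proof. exact: measurable_rectangle. Qed.

Lemma complex_lebesgue_square c s : 0 <= s ->
  complex_lebesgue (square c s) = ((2 * s) ^+ 2)%:E.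
Proof.
move=> s0; rewrite complex_lebesgue_rectangle// !lebesgue_measure_itv/=
  !lte_fin.
have e (x : R) : (if (x - s < x + s)%R then ((x +
  s)%R%:E - (x - s)%R%:E)%E else 0%E) = (2 * s)%:E.
  case: ifP => [_|/negbT]; first by rewrite -EFinB; congr EFin; ring.
  by rewrite -leNgt => ?; congr EFin; lra.
by rewrite !e -EFinM -expr2.
Qed.

Lemma square_normc c s x : normc (c - x) <= s -> square c s x.
Proof.
move=> h; have := normr_Re_le (c - x); have := normr_Im_le (c - x).
rewrite !cReD !cImD !cReN !cImN => h1 h2.
have := le_trans h1 h; have := le_trans h2 h.
by rewrite /square /rectangle/= !in_itv/= !ler_norml => *; split; lra.
Qed.

Definition carleson (z : Cn R n) (r h : R) : set (Cn R n) :=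
  [set w | [/\ Bn w, normc (1 - hdot z w) < r & 1 - sqnorm w < h]].

Lemma measurable_carleson z r h : measurable (carleson z r h).
Proof.
rewrite (_ : carleson z r h = Bn `&` ((fun w => normc (1 - hdot z w)) @^-1`
  `]-oo, r[%classic)
   `&` (@sqnorm R n @^-1` `]1 - h, +oo[%classic)); last first.
  apply/seteqP; split => w /=; rewrite !in_itv/= andbT.
    by move=> [h1 h2 h3]; split; [split|lra].
  by move=> [[h1 h2] h3]; split => //; lra.
apply: measurableI; first apply: measurableI.
- exact: measurable_Bn.
- rewrite -[X in measurable X]setTI.
  have := measurableT_comp (@measurable_normc_hdot R n) (pair1_measurable z).
  exact.
- by rewrite -[X in measurable X]setTI; apply: measurable_sqnorm.
Qed.

(** If all 2 n real coordinates were below eta in absolute value, |w|^2 would be less than 2 n eta^2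
    = 1 / (2 n) <= 1/2. *)
Let eta : R := (2 * n%:R)^-1.

Let n0R : 0 < n%:R :> R. Proof. by rewrite ltr0n. Qed.

Let eta0 : 0 < eta. Proof. by rewrite invr_gt0 mulr_gt0. Qed.

Let big_coord w : 2^-1 <= sqnorm w ->
  exists j, eta <= `|re (tnth w j)| \/ eta <= `|im (tnth w j)|.
Proof.
move=> hw; apply: contrapT => hN.
have : sqnorm w < \sum_(j < n) (2 * eta ^+ 2).
  apply: (@lt_le_trans _ _ (\sum_(j < n) (2 * eta ^+ 2))) => //.
  rewrite /sqnorm; apply: ltr_sum => [|j _].
    by apply/hasP; exists (Ordinal n0) => //; rewrite mem_index_enum.
  have [h1 h2] : `|re (tnth w j)| < eta /\ `|im (tnth w j)| < eta.
    by split; rewrite ltNge; apply/negP => h; apply: hN; exists j; [left|right].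
  rewrite sqr_normcE -(real_normK (num_real (re _))) -(real_normK (num_real (im
    _))).
  have := normr_ge0 (re (tnth w j)); have := normr_ge0 (im (tnth w j)).
  nra.
rewrite sumr_const card_ord -[ltRHS]mulr_natr /eta.
have -> : 2 * (2 * n%:R)^-1 ^+ 2 * n%:R = 2^-1 * n%:R^-1 :> R by field;
  rewrite gt_eqF.
have : n%:R^-1 <= 1 :> R by rewrite invf_le1// ler1n.
lra.
Qed.

(** One summand for each case of [lebesgue_carleson]: h >= 1/2, then h < 1/2 with r >= eta^2 / 8,
    then smaller r. In the first two cases r is bounded below and (8 / eta^2)^n compensates for
    r^n. *)
Definition carleson_const : R :=
  4 ^+ n * 2 * (8 / eta ^+ 2) ^+ n +
  (n%:R * 2) * (4 ^+ n.-1 * (8 / eta)) * (8 / eta ^+ 2) ^+ n +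
  (n%:R * 2) * (8 ^+ n.-1 * (16 / eta ^+ 2)).

Lemma carleson_const_ge0 : 0 <= carleson_const.
Proof.
have e0 : 0 <= eta^-1 by rewrite invr_ge0 ltW.
have e2 : 0 <= (eta ^+ 2)^-1 by rewrite -exprVn exprn_ge0.
by rewrite /carleson_const !(addr_ge0, mulr_ge0, exprn_ge0).
Qed.

Let slab_Re := @lebesgue_Cn_slab R _ _ (@measurable_Re R) (@measurable_Im R)
  (@sqr_normcE R) (fun S J m => @complex_lebesgue_le_vertical R S setT J m) n.

Let sqr_normcE' (z : R[i]) : normc z ^+ 2 = im z ^+ 2 + re z ^+ 2.
Proof. by rewrite sqr_normcE addrC. Qed.

Let slab_Im := @lebesgue_Cn_slab R _ _ (@measurable_Im R) (@measurable_Re R)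
  sqr_normcE' (fun S J m => @complex_lebesgue_le_horizontal R S setT J m) n.

Let measurable_coord (P : R[i] -> R) j : measurable_fun setT P ->
  measurable [set w : Cn R n | eta <= `|P (tnth w j)|].
Proof.
move=> mP.
have mf : measurable_fun setT (fun w : Cn R n => `|P (tnth w j)|).
  by apply: measurableT_comp => //;
    exact: (measurableT_comp mP (measurable_tnth j)).
rewrite (_ : [set w | _] = (fun w : Cn R n => `|P (tnth w j)|) @^-1` `[eta,
  +oo[%classic).
  by rewrite -[X in measurable X]setTI; exact: mf.
by apply/seteqP; split => w /=; rewrite in_itv/= andbT.
Qed.

(* A point of the shell has a coordinate bounded away from 0; slicing along that
   coordinate gives a factor h. The other real coordinate of the same complex
   coordinate then ranges over an interval of length O(r), and the remaining
   coordinates over discs of radius O(sqrt r). *)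
Let carleson_slabs z r h (D : 'I_n -> set R[i]) (A rho : R) :
  0 < h -> h <= 2^-1 -> 0 <= rho -> 0 <= A ->
  (forall k, measurable (D k)) -> (forall k, complex_lebesgue (D k) = A%:E) ->
  (forall w, carleson z r h w -> forall k, D k (tnth w k)) ->
  (forall j w w', carleson z r h w -> carleson z r h w' ->
    eta <= normc (tnth w j) ->
    (forall k, k != j -> tnth w k = tnth w' k) ->
    normc (tnth w j - tnth w' j) <= rho) ->
  (lam (carleson z r h) <=
    ((n%:R * 2) * (A ^+ n.-1 * ((2 * h / eta) * (2 * rho))))%:E)%E.
Proof.
move=> h0 h12 rho0 A0 mD DA SD SQ.
have -> : n%:R * 2 = #|{: 'I_n * bool}|%:R :> R.
  by rewrite card_prod card_ord card_bool natrM.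
pose S (i : 'I_n * bool) : set (Cn R n) := if i.2 then
  carleson z r h `&` [set w | eta <= `|re (tnth w i.1)|] else
  carleson z r h `&` [set w | eta <= `|im (tnth w i.1)|].
apply: (measurable_bigsetU_le (A := S)).
- exact: measurable_carleson.
- move=> [j []]; apply: measurableI; try exact: measurable_carleson.
    exact: (measurable_coord _ (@measurable_Re R)).
  exact: (measurable_coord _ (@measurable_Im R)).
- move=> w cw; have [Bw _ hw] := cw.
  have [|j [hj|hj]] := @big_coord w; first by lra.
    by exists (j, true).
  by exists (j, false).
have hS w : carleson z r h w -> 1 - h <= sqnorm w /\ sqnorm w <= 1.
  by move=> [Bw _ hw]; split; [lra|exact: ltW].
move=> [j []].
- apply: (slab_Re (j := j) (D := D)) => //; first exact: ltW.
  + apply: measurableI; first exact: measurable_carleson.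
    exact: (measurable_coord _ (@measurable_Re R)).
  + by move=> w [cw _]; exact: SD.
  + by move=> w [/hS[h1 h2] h3]; split.
  + move=> w w' [cw /= ew] [cw' _] ww'.
    rewrite -cImN -cImD; apply: le_trans (normr_Im_le _) _.
    by apply: SQ ww' => //; exact: le_trans (normr_Re_le _).
- apply: (slab_Im (j := j) (D := D)) => //; first exact: ltW.
  + apply: measurableI; first exact: measurable_carleson.
    exact: (measurable_coord _ (@measurable_Im R)).
  + by move=> w [cw _]; exact: SD.
  + by move=> w [/hS[h1 h2] h3]; split.
  + move=> w w' [cw /= ew] [cw' _] ww'.
    rewrite -cReN -cReD; apply: le_trans (normr_Re_le _) _.
    by apply: SQ ww' => //; exact: le_trans (normr_Im_le _).
Qed.

Let normc_coord_le1 w j : Bn w -> normc (0 - tnth w j) <= 1.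
Proof.
move=> Bw; rewrite sub0r normcN -(ler_pXn2r (ltn0Sn 1)) ?nnegrE ?normc_ge0//
  expr1n.
exact/ltW/Bn_coord_lt1.
Qed.

Lemma lebesgue_Bn_le : (lam Bn <= (4 ^+ n)%:E)%E.
Proof.
have -> : 4 ^+ n = \prod_(k < n) (2 * 1) ^+ 2 :> R.
  by rewrite prodr_const card_ord; congr (_ ^+ _); ring.
rewrite -(lebesgue_Cn_box (D := fun k => square 0 1)).
- apply: le_measure; rewrite ?inE; [exact: measurable_Bn| |].
    by apply: measurable_box => k; exact: measurable_square.
  by move=> w Bw k; apply: square_normc; exact: normc_coord_le1.
- by move=> k; exact: measurable_square.
- by move=> k; rewrite complex_lebesgue_square.
Qed.

Lemma lebesgue_carleson z r h : Bn z -> 0 < h -> h <= 2 * r ->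
  (lam (carleson z r h) <= (carleson_const * h * r ^+ n)%:E)%E.
Proof.
move=> Bz h0 hr.
have r0 : 0 < r by lra.
have eta1 : eta <= 2^-1.
  rewrite /eta invfM ler_piMr ?invr_ge0//.
  by rewrite invf_le1// ler1n.
have e1 : 8 / eta ^+ 2 * (eta ^+ 2 / 8) = 1 by field; rewrite gt_eqF.
pose K1 := 4 ^+ n * 2 * (8 / eta ^+ 2) ^+ n.
pose K2 := (n%:R * 2) * (4 ^+ n.-1 * (8 / eta)) * (8 / eta ^+ 2) ^+ n.
pose K3 := (n%:R * 2) * (8 ^+ n.-1 * (16 / eta ^+ 2)).
have e0 := ltW eta0.
have eV0 : 0 <= eta^-1 by rewrite invr_ge0.
have e2 : 0 <= (eta ^+ 2)^-1 by rewrite -exprVn exprn_ge0.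
have K10 : 0 <= K1 by rewrite !(mulr_ge0, exprn_ge0).
have K20 : 0 <= K2 by rewrite !(mulr_ge0, exprn_ge0).
have K30 : 0 <= K3 by rewrite !(mulr_ge0, exprn_ge0).
have -> : carleson_const = K1 + K2 + K3 by [].
have hrn : 0 <= h * r ^+ n by rewrite mulr_ge0 ?exprn_ge0 ?ltW.
suff [H|H|H] : [\/ lam (carleson z r h) <= (K1 * (h * r ^+ n))%:E,
    lam (carleson z r h) <= (K2 * (h * r ^+ n))%:E |
    lam (carleson z r h) <= (K3 * (h * r ^+ n))%:E]%E.
- by apply: le_trans H _; rewrite lee_fin; nra.
- by apply: le_trans H _; rewrite lee_fin; nra.
- by apply: le_trans H _; rewrite lee_fin; nra.
have big_r : eta ^+ 2 / 8 <= r -> 1 <= (8 / eta ^+ 2) ^+ n * r ^+ n.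
  move=> hr0; rewrite -exprMn exprn_ege1// -[leLHS]e1.
  by apply: ler_wpM2l => //; rewrite divr_ge0 ?exprn_ge0.
have r0le : eta ^+ 2 / 8 <= 4^-1 by nra.
have [h12|h12] := leP 2^-1 h.
  apply: Or31.
  apply: (@le_trans _ _ (lam Bn)).
    apply: le_measure; rewrite ?inE;
      [exact: measurable_carleson|exact: measurable_Bn|].
    by move=> w [].
  apply: le_trans lebesgue_Bn_le _; rewrite lee_fin /K1.
  have := big_r _; move=> /(_ ltac:(lra)) br.
  rewrite -[leLHS]mulr1 -!mulrA; apply: ler_wpM2l; first exact: exprn_ge0.
  by nra.
have [hr0|hr0] := leP (eta ^+ 2 / 8) r.
  apply: Or32.
  apply: le_trans (carleson_slabs (D := fun k => square 0 1) (A := 4) (rho :=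
    2) _ _ _ _ _ _ _ _) _ => //.
  - exact: ltW.
  - by move=> k; exact: measurable_square.
  - by move=> k; rewrite complex_lebesgue_square//; congr EFin; ring.
  - by move=> w [Bw _ _] k; apply: square_normc; exact: normc_coord_le1.
  - move=> j w w' [Bw _ _] [Bw' _ _] _ _.
    have := normc_coord_le1 j Bw; have := normc_coord_le1 j Bw'.
    rewrite !sub0r !normcN => h1 h2.
    by apply: le_trans (le_normcD _ _) _; rewrite normcN; lra.
  rewrite lee_fin.
  have -> : n%:R * 2 * (4 ^+ n.-1 * (2 * h / eta * (2 * 2))) =
    (n%:R * 2 * (4 ^+ n.-1 * (8 / eta)) * h) * 1 by ring.
  have -> : K2 * (h * r ^+ n) = (n%:R * 2 * (4 ^+ n.-1 * (8 / eta)) * h) *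
    ((8 / eta ^+ 2) ^+ n * r ^+ n) by rewrite /K2; ring.
  apply: ler_wpM2l; last exact: big_r.
  by rewrite !mulr_ge0// ?exprn_ge0 ?divr_ge0// ltW.
(* Every coordinate of w is within sqrt (2 r) <= eta / 2 of that of z, so |w_j| >= eta forces |z_j|
   >= eta / 2, and two points of a slice are at distance at most 4 r / eta. The squares of half side
   sqrt (2 r) have area 8 r. *)
apply: Or33.
pose s := Num.sqrt (2 * r).
have s0 : 0 <= s by exact: sqrtr_ge0.
have s2 : s ^+ 2 = 2 * r by rewrite sqr_sqrtr// mulr_ge0// ltW.
have close w k : carleson z r h w -> normc (tnth z k - tnth w k) <= s.
  move=> [Bw xr _]; rewrite -(ler_pXn2r (ltn0Sn 1)) ?nnegrE ?normc_ge0// s2.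
  by have := normc_coord_le k Bz Bw; lra.
have seta : s <= eta / 2.
  rewrite -(ler_pXn2r (ltn0Sn 1)) ?nnegrE ?divr_ge0// s2; lra.
apply: le_trans (carleson_slabs (D := fun k => square (tnth z k) s)
    (A := 8 * r) (rho := 4 * r / eta) _ _ _ _ _ _ _ _) _ => //.
- exact: ltW.
- by rewrite divr_ge0// mulr_ge0// ltW.
- by rewrite mulr_ge0// ltW.
- by move=> k; exact: measurable_square.
- by move=> k; rewrite complex_lebesgue_square// exprMn s2; congr EFin; ring.
- by move=> w cw k; apply: square_normc; exact: close.
- move=> j w w' cw cw' ew ww'.
  have [_ xw _] := cw; have [_ xw' _] := cw'.
  have hz : eta / 2 <= normc (tnth z j).
    have := close w j cw.
    have : normc (tnth w j) <= normc (tnth z j) + normc (tnth z j - tnth w j).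
      have e : tnth w j = tnth z j + - (tnth z j - tnth w j) by ring.
      by rewrite [in leLHS]e; apply: le_trans (le_normcD _ _) _; rewrite normcN.
    lra.
  have hm := normc_coord_mul_le z ww'.
  rewrite ler_pdivlMr//.
  have := ler_wpM2r (normc_ge0 (tnth w j - tnth w' j)) hz.
  lra.
rewrite lee_fin; apply: eq_ler; rewrite /K3 exprMn.
have -> : r ^+ n = r * r ^+ n.-1 by rewrite -exprS prednK.
field.
by rewrite gt_eqF.
Qed.

End ball_pieces.

(** * The weighted volume *)

Section gamma_function.
Variable R : realType.
Notation leb := (@lebesgue_measure R).
Local Open Scope ereal_scope.

Let integrand (x t : R) : R := (t `^ (x - 1) * expR (- t))%R.

Let integrand_ge0 x t : (0 <= integrand x t)%R.
Proof. by rewrite mulr_ge0 ?powR_ge0 ?expR_ge0. Qed.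

Let measurable_integrand x (D : set (measurableTypeR R)) :
  measurable_fun D (fun t => (integrand x t)%:E).
Proof.
apply/measurable_EFinP; apply: measurable_funM.
  by apply: measurable_funPR; exact: measurable_id.
by apply: measurableT_comp => //; exact: measurable_funN.
Qed.

Let measurable_ltr (r : R) : measurable [set t : measurableTypeR R | (t < r)%R].
Proof.
rewrite (_ : [set t | _] = `]-oo, r[%classic); first exact: measurable_itv.
by apply/seteqP; split => t /=; rewrite in_itv.
Qed.

Let gamma_near0 x : (0 < x)%R ->
  \int[leb]_(t in `]0%R, 1%R[) (integrand x t)%:E < +oo.
Proof.
move=> x0.
apply: (@le_lt_trans _ _ (\int[leb]_(t in `]0%R, 1%R[)
  (cst 1 t * (id t `^ (x - 1))%:E))).
- apply: ge0_le_integral => //.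
  + by move=> t _; rewrite lee_fin.
  + apply: emeasurable_funM => //; apply/measurable_EFinP.
    by apply: measurable_funPR; exact: measurable_id.
  + move=> t; rewrite /= in_itv/= => /andP[t0 t1].
    rewrite mul1e lee_fin ler_piMr ?powR_ge0// expR_le1; lra.
apply: le_lt_trans (ltry _).
apply: (ge0_integral_powR_le (k := 1) (C := 1) _ _ _ _ _ (H := 1)) => //.
- by lra.
- move=> r r0 r1; rewrite integral_cst//=; last first.
    by apply: measurableI => //; exact: measurable_ltr.
  rewrite mul1e mul1r powRr1; last exact: ltW.
  apply: (@le_trans _ _ (leb `[0%R, r]%classic)).
    apply: le_measure; rewrite ?inE//.
      by apply: measurableI => //; exact: measurable_ltr.
    by move=> t [] /=; rewrite !in_itv/= => /andP[/ltW -> _] /ltW ->.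
  by rewrite lebesgue_measure_itv/= lte_fin r0 sube0.
Qed.

(** A single term of the exponential series gives t^(x + 1) e^(- t) <= (m + 1)!, so the integrand is
    O(t^(- 2)), summed over dyadic shells going up from 1. *)
Let gamma_nearoo x : (0 < x)%R ->
  \int[leb]_(t in `[1%R, +oo[) (integrand x t)%:E < +oo.
Proof.
move=> x0.
pose m := (Num.bound (x + 1)).
have xm : (x + 1 <= m.+1%:R)%R.
  have /ltW := @truncnS_gt R (x + 1); rewrite /m.
  by have := @archi_boundP R (x + 1) _ ; rewrite -natr1; lra.
apply: (@le_lt_trans _ _ (\int[leb]_(t in `[1%R, +oo[)
  (cst m.+1`!%:R%:E t * (id t `^ (- 2))%:E))).
- apply: ge0_le_integral => //.
  + by move=> t _; rewrite lee_fin.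
  + apply: emeasurable_funM => //; apply/measurable_EFinP.
    by apply: measurable_funPR; exact: measurable_id.
  + move=> t; rewrite /= in_itv/= andbT => t1.
    have t0 : (0 < t)%R by lra.
    rewrite -EFinM lee_fin /integrand expRN ler_pdivrMr ?expR_gt0//.
    have -> : (t `^ (x - 1) = t `^ (x + 1) * t `^ (- 2))%R.
      by rewrite -powRD ?(gt_eqF t0) ?implybT//; congr powR; ring.
    rewrite mulrAC; apply: ler_wpM2r; first exact: powR_ge0.
    apply: (@le_trans _ _ (t ^+ m.+1)%R).
      by rewrite -powR_mulrn; [exact: ler_powR|exact: ltW].
    have := @expR_ge1Dxn R t m (ltW t0).
    rewrite -ler_pdivrMl// mulrC; lra.
apply: le_lt_trans (ltry _).
apply: (ge0_integral_powR_ge (k := 1) (C := m.+1`!%:R) _ _ _ _ _ (eta :=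
  1)) => //.
- by move=> t _; rewrite lee_fin.
- by move=> t; rewrite /= in_itv/= andbT.
- move=> r r1; rewrite integral_cst//=; last first.
    by apply: measurableI => //; exact: measurable_ltr.
  rewrite EFinM; apply: lee_wpmul2l => //.
  rewrite powRr1; last lra.
  apply: (@le_trans _ _ (leb `[0%R, r]%classic)).
    apply: le_measure; rewrite ?inE//.
      by apply: measurableI => //; exact: measurable_ltr.
    move=> t [] /=; rewrite !in_itv/= andbT => t1 tr; apply/andP; split; lra.
  rewrite lebesgue_measure_itv/= lte_fin; case: ifP => _; rewrite ?sube0//.
  rewrite lee_fin; lra.
Qed.

(** [Gamma] is the [fine] part of an integral and would be 0 if the integral diverged, so
    convergence at 0 and at +oo is part of the claim. *)
Lemma Gamma_gt0 (x : R) : (0 < x)%R -> (0 < Gamma x)%R.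
Proof.
move=> x0.
have U : `]0%R, +oo[%classic = `]0%R, 1%R[%classic `|` `[1%R,
  +oo[%classic :> set R.
  apply/seteqP; split => t /=; rewrite !in_itv/= ?andbT.
    by move=> t0; have [t1|t1] := ltP t 1%R; [left; rewrite t0|right].
  by move=> [/andP[]//|]; lra.
have fin : \int[leb]_(t in `]0%R, +oo[) (integrand x t)%:E < +oo.
  rewrite U ge0_integral_setU//.
  - by rewrite lte_add_pinfty// ?gamma_near0// gamma_nearoo.
  - by move=> t _; rewrite lee_fin.
  - apply/disj_setPRL => t /=; rewrite !in_itv/= andbT => h1 /andP[_ h2].
    by move: h1; rewrite leNgt h2.
rewrite /Gamma /Rintegral -/(integrand x) fine_gt0//.
apply/andP; split; last exact: fin.
(* A lower bound for the integrand on [1, 2] that is valid for both signs of x - 1. *)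
pose m : R := (2 `^ (x - 1) / (1 + 2 `^ (x - 1)) * expR (- 2))%R.

have m0 : (0 < m)%R.
  by rewrite mulr_gt0 ?expR_gt0// divr_gt0//; lra.
apply: (@lt_le_trans _ _ (\int[leb]_(t in `[1%R, 2%R]) m%:E)).
  rewrite integral_cst//= lebesgue_measure_itv/= lte_fin ltr1n -EFinB -EFinM
    lte_fin.
  by rewrite mulr_gt0//; lra.
apply: (@le_trans _ _ (\int[leb]_(t in `[1%R, 2%R]) (integrand x t)%:E)).
  apply: ge0_le_integral => //.
  - by move=> t _; rewrite lee_fin ltW.
  - move=> t; rewrite /= in_itv/= => /andP[t1 t2]; rewrite lee_fin /integrand.
    apply: ler_pM; rewrite ?expR_ge0//.
    + by apply: powR_ge_of_comparable => //; lra.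
    + by rewrite ler_expR; lra.
apply: ge0_subset_integral => //.
- by move=> t _; rewrite lee_fin.
- by move=> t /=; rewrite !in_itv/= andbT; lra.
Qed.

Lemma c__gt0 (n : nat) (alpha : R) : (-1 < alpha)%R -> (0 < c_ n alpha)%R.
Proof.
move=> a1; have n0 : (0 <= n%:R :> R)%R by [].
rewrite /c_ divr_gt0// ?mulr_gt0 ?Gamma_gt0 ?ltr0n ?fact_gt0//; lra.
Qed.

End gamma_function.

(** * Comparison of v_alpha with Lebesgue measure *)

Section weighted_volume.
Variables (R : realType) (n : nat).
Notation lam := (@lebesgue_Cn R n).
Implicit Types A : set (Cn R n).

Lemma lebesgue_Bn_gt0 : (0 < lam Bn)%E.
Proof.
pose s : R := (2 * n.+1%:R)^-1.
have s0 : 0 < s by rewrite invr_gt0 mulr_gt0.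
apply: (@lt_le_trans _ _ (lam (box (fun _ : 'I_n => square 0 s)))).
  rewrite (lebesgue_Cn_box (a := fun=> (2 * s) ^+ 2)).
  - by rewrite lte_fin; apply: prodr_gt0 => k _; rewrite exprn_gt0// mulr_gt0.
  - by move=> k; exact: measurable_square.
  - by move=> k; rewrite complex_lebesgue_square// ltW.
apply: le_measure; rewrite ?inE.
- by apply: measurable_box => k; exact: measurable_square.
- exact: measurable_Bn.
move=> w Dw; rewrite /Bn/= /sqnorm.
apply: (@le_lt_trans _ _ (\sum_(j < n) 2 * s ^+ 2)).
  apply: ler_sum => j _; rewrite sqr_normcE.
  have [/=] := Dw j; rewrite !in_itv/= !sub0r !add0r => h1 h2.
  have e (x : R) : - s <= x <= s -> x ^+ 2 <= s ^+ 2.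
    rewrite -ler_norml => h; rewrite -(real_normK (num_real x)).
    by rewrite ler_pXn2r// nnegrE ltW.
  by have := e _ h1; have := e _ h2; lra.
rewrite sumr_const card_ord -[ltLHS]mulr_natr.
have N0 : 0 <= n%:R :> R by [].
have sN : s * (2 * (n%:R + 1)) = 1 by rewrite /s -natr1; field; lra.
nra.
Qed.

Lemma measurable_weight1 (alpha : R) :
  measurable_fun setT (fun w : Cn R n => (1 - sqnorm w) `^ alpha).
Proof.
apply: measurable_funPR; apply: measurable_funB => //.
exact: measurable_sqnorm.
Qed.

Definition vol_const (alpha : R) : R := (fine (lam Bn))^-1 * c_ n alpha.

Lemma lebesgue_Bn_lty : (lam Bn < +oo)%E.
Proof. exact: le_lt_trans (lebesgue_Bn_le R n) (ltry _). Qed.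

Lemma vol_const_gt0 (alpha : R) : -1 < alpha -> 0 < vol_const alpha.
Proof.
move=> a1; rewrite mulr_gt0 ?c__gt0// invr_gt0 fine_gt0//.
by rewrite lebesgue_Bn_gt0 lebesgue_Bn_lty.
Qed.

Lemma c__ge0 (alpha : R) : 0 <= c_ n alpha.
Proof.
have G0 (x : R) : 0 <= Gamma x.
  by apply: Rintegral_ge0 => t _; rewrite mulr_ge0 ?powR_ge0 ?expR_ge0.
by rewrite divr_ge0// mulr_ge0.
Qed.

Lemma vol_E (alpha : R) A : measurable A -> A `<=` Bn ->
  vol_ alpha A = ((vol_const alpha)%:E *
    \int[lam]_(w in A) ((1 - sqnorm w) `^ alpha)%:E)%E.
Proof.
move=> mA AB; rewrite /vol_ /vol.
have mw : measurable_fun A (fun w : Cn R n => ((1 - sqnorm w) `^ alpha)%:E).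
  apply/measurable_EFinP; apply: measurable_funS (measurable_weight1 alpha) =>
    //.
have mW : measurable_fun A (fun w : Cn R n => (weight alpha w)%:E).
  rewrite /weight; under eq_fun do rewrite EFinM.
  exact: emeasurable_funM.
rewrite ge0_integral_mscale//=; last first.
  by move=> w _; rewrite lee_fin /weight mulr_ge0 ?powR_ge0 ?c__ge0.
rewrite (eq_measure_integral lam); last first.
  by move=> B mB BA; rewrite /= /mrestr setIidl//; exact: subset_trans AB.
rewrite /weight; under eq_integral do rewrite EFinM.
rewrite ge0_integralZl ?lee_fin ?c__ge0//.
  by rewrite muleA -EFinM.
by move=> w _; rewrite lee_fin powR_ge0.
Qed.

Lemma vol_setC_Bn (alpha : R) : vol_ alpha (~` (@Bn R n)) = 0%E.
Proof.
rewrite /vol_ (eq_measure_integral mzero) ?integral_measure_zero//.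
move=> B mB BA; rewrite /vol /= /mscale /= /mrestr.
rewrite (_ : B `&` Bn = set0) ?measure0 ?mule0//.
by rewrite -subset0 => w [/BA].
Qed.

Section alpha.
Hypothesis n0 : (0 < n)%N.
Variable alpha : R.
Hypothesis alpha1 : -1 < alpha.

Definition vol_carleson_const : R :=
  vol_const alpha * (dyadic_const alpha (1 + alpha) * carleson_const R n).

Lemma vol_carleson_const_ge0 : 0 <= vol_carleson_const.
Proof.
apply: mulr_ge0; first exact/ltW/vol_const_gt0.
apply: mulr_ge0; first by apply: dyadic_const_ge0; have := alpha1; lra.
exact: carleson_const_ge0.
Qed.

(** Dyadic decomposition in the depth 1 - |w|^2: the part of depth below t has Lebesgue measure O(t
    r^n) for all t <= h, and integrating the weight of exponent alpha gives h^(1 + alpha) because 1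
    + alpha > 0. *)
Lemma vol_carleson (z : Cn R n) (r h : R) : Bn z -> 0 < h -> h <= 2 * r ->
  (vol_ alpha (carleson z r h) <=
     (vol_carleson_const * r ^+ n * h `^ (1 + alpha))%:E)%E.
Proof.
move=> Bz h0 hr.
have r0 : 0 < r by lra.
rewrite vol_E; [|exact: measurable_carleson|by move=> w []].
apply: (@le_trans _ _ ((vol_const alpha)%:E * (dyadic_const alpha (1 + alpha) *
    (carleson_const R n * r ^+ n) * h `^ (1 + alpha))%:E)%E); last first.
  by rewrite -EFinM lee_fin; apply: eq_ler; rewrite /vol_carleson_const; ring.
apply: lee_wpmul2l; first by rewrite lee_fin ltW// vol_const_gt0.
have mc := measurable_carleson z.
have mu : measurable_fun (carleson z r h) (fun w : Cn R n => 1 - sqnorm w).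
  apply: measurable_funB => //; apply: measurable_funS (@measurable_sqnorm R n)
    => //.
rewrite (_ : (\int[_]_(w in _) _ = \int[lam]_(w in carleson z r h)
    (cst 1 w * ((1 - sqnorm w) `^ alpha)%:E))%E); last first.
  by apply: eq_integral => w _; rewrite mul1e.
apply: (ge0_integral_powR_le (phi := cst 1%E)) => //.
- by rewrite mulr_ge0 ?carleson_const_ge0// exprn_ge0// ltW.
- by have := alpha1; lra.
- by move=> w [Bw _ hw]; rewrite hw andbT subr_gt0; exact: Bw.
move=> t t0 th.
rewrite (_ : _ `&` _ = carleson z r t); last first.
  apply/seteqP; split => w /=; first by move=> [[? ? ?] ?]; split.
  by move=> [? ? h1]; split; [split|]; rewrite //; lra.
rewrite integral_cst//= mul1e powRr1; last exact: ltW.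
apply: le_trans (lebesgue_carleson n0 Bz t0 _) _; first lra.
by rewrite lee_fin; apply: eq_ler; ring.
Qed.

Lemma Bn_carleson (z : Cn R n) : Bn z -> Bn `<=` carleson z 3 2.
Proof.
move=> Bz w Bw; split => //; first by have := normc_hdot_le2 Bz Bw; lra.
by have := sqnorm_ge0 w; lra.
Qed.

Lemma zero_Bn : Bn ([tuple 0 | _ < n] : Cn R n).
Proof.
by rewrite /Bn/= /sqnorm big1// => j _; rewrite tnth_mktuple normc0 expr0n.
Qed.

Lemma vol_lty A : measurable A -> (vol_ alpha A < +oo)%E.
Proof.
move=> mA.
apply: (@le_lt_trans _ _ (vol_ alpha (@Bn R n `|` ~` Bn))).
  by apply: le_measure; rewrite ?inE ?setUv.
apply: (@le_lt_trans _ _ (vol_ alpha (@Bn R n) + vol_ alpha (~` (@Bn R n)))%E).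
  apply: measureU2; first exact: measurable_Bn.
  by apply: measurableC; exact: measurable_Bn.
rewrite vol_setC_Bn adde0.
have le32 : (2:R) <= 2 * 3 by lra.
apply: le_lt_trans _ (le_lt_trans (vol_carleson zero_Bn (ltr0Sn _ 1) le32) (ltry
  _)).
apply: le_measure; rewrite ?inE;
  [exact: measurable_Bn|exact: measurable_carleson|].
exact/Bn_carleson/zero_Bn.
Qed.

Lemma vol_le_of_comparable A (L y : R) : measurable A -> 0 < L -> 0 < y ->
  (forall w, A w -> y / L <= 1 - sqnorm w <= y) ->
  (vol_ alpha A <= (vol_const alpha * ((1 +
    L `^ (- alpha)) * y `^ alpha))%:E * lam A)%E.
Proof.
move=> mA L0 y0 hA.
have AB : A `<=` Bn.
  move=> w /hA /andP[h _]; rewrite /Bn/= -subr_gt0; apply: lt_le_trans h.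
  exact: divr_gt0.
rewrite vol_E// (EFinM (vol_const alpha)) -muleA; apply: lee_wpmul2l.
  by rewrite lee_fin ltW// vol_const_gt0.
rewrite -integral_cst//; apply: ge0_le_integral => //.
- by move=> w _; rewrite lee_fin powR_ge0.
- apply/measurable_EFinP; apply: measurable_funS (measurable_weight1 alpha) =>
    //.
- move=> w /hA /andP[h1 h2]; rewrite lee_fin; exact: powR_le_of_comparable.
Qed.

Lemma vol_ge_of_comparable A (L y : R) : measurable A -> 0 < L -> 0 < y ->
  (forall w, A w -> y / L <= 1 - sqnorm w <= y) ->
  ((vol_const alpha * (y `^ alpha / (1 + L `^ alpha)))%:E * lam A <=
    vol_ alpha A)%E.
Proof.
move=> mA L0 y0 hA.
have AB : A `<=` Bn.
  move=> w /hA /andP[h _]; rewrite /Bn/= -subr_gt0; apply: lt_le_trans h.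
  exact: divr_gt0.
rewrite vol_E// (EFinM (vol_const alpha)) -muleA; apply: lee_wpmul2l.
  by rewrite lee_fin ltW// vol_const_gt0.
rewrite -integral_cst//; apply: ge0_le_integral => //.
- by move=> w _; rewrite lee_fin divr_ge0 ?addr_ge0 ?powR_ge0.
- apply/measurable_EFinP; apply: measurable_funS (measurable_weight1 alpha) =>
    //.
- move=> w /hA /andP[h1 h2]; rewrite lee_fin; exact: powR_ge_of_comparable.
Qed.

Let vol_fin_num : fin_num_fun (@vol_ R n alpha).
Proof. by move=> A mA; rewrite ge0_fin_numE ?measure_ge0//; exact: vol_lty. Qed.

(** Finiteness depends on [n0] and [alpha1], so it is packed with the measure; Tonelli and
    [schur_test], which ask for a sigma-finite measure, are applied to this copy. *)
Definition finite_vol : {finite_measure set (Cn R n) -> \bar R} :=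
  HB.pack (@vol_ R n alpha)
    (Measure_isFinite.Build _ _ _ (@vol_ R n alpha) vol_fin_num).

Lemma integral_finite_vol A (f : Cn R n -> \bar R) :
  (\int[finite_vol]_(w in A) f w = \int[@vol_ R n alpha]_(w in A) f w)%E.
Proof. exact: eq_measure_integral. Qed.

End alpha.
End weighted_volume.

(** * Forelli-Rudin estimates *)

Section forelli_rudin.
Variables (R : realType) (n : nat) (alpha : R).
Hypotheses (n0 : (0 < n)%N) (alpha1 : -1 < alpha).
Notation v := (@vol_ R n alpha).
Notation N := (n%:R + 1 + alpha).
Notation ker z w := (normc (1 - hdot z w)%R).
Local Open Scope ereal_scope.

Let carleson_full (z : Cn R n) r : Bn z ->
  carleson z r (2 * r) = Bn `&` [set w | (ker z w < r)%R].
Proof.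
move=> Bz; apply/seteqP; split => w; first by move=> [? ? _]; split.
move=> [Bw /= h]; split => //.
have := normc_hdot_ger Bz Bw; lra.
Qed.

Let measurable_u D : measurable_fun D (fun w : Cn R n => 1 - sqnorm w)%R.
Proof.
by apply: measurable_funB => //;
  apply: measurable_funS (@measurable_sqnorm R n).
Qed.

Let measurable_x z D : measurable_fun D (fun w : Cn R n => ker z w).
Proof.
have h := measurableT_comp (@measurable_normc_hdot R n) (pair1_measurable z).
exact: measurable_funS h.
Qed.

(** By [vol_carleson] with h = 2 r, the set |1 - <z, w>| < r has measure O(r^N) uniformly in z; the
    decomposition in r converges because N - a > 0. *)
Lemma integral_kernel_le (a : R) : (a < N)%R ->
  exists2 K : R, (0 < K)%R & forall z, Bn z ->
    \int[v]_(w in Bn) (ker z w `^ (- a))%:E <= K%:E.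
Proof.
move=> aN; have C0 := vol_carleson_const_ge0 n0 alpha1.
pose C := (vol_carleson_const n alpha * 2 `^ (1 + alpha))%R.
have C'0 : (0 <= C)%R by rewrite mulr_ge0// powR_ge0.
have d0 : (0 <= dyadic_const (- a) (N - a))%R by apply: dyadic_const_ge0; lra.
(* 3 is a strict upper bound for |1 - <z, w>|, which is at most 2; the added 1 makes the constant
   positive. *)
exists (dyadic_const (- a) (N - a) * C * 3 `^ (N - a) + 1)%R.
  by apply: ltr_wpDl => //; apply: mulr_ge0; [exact: mulr_ge0|exact: powR_ge0].
move=> z Bz.
apply: (@le_trans _ _ ((dyadic_const (- a) (N - a) * C * 3 `^ (N - a))%:E));
  last first.
  by rewrite lee_fin lerDl.
have -> : \int[v]_(w in Bn) (ker z w `^ (- a))%:E =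
    \int[v]_(w in Bn) (cst 1 w * (ker z w `^ (- a))%:E).
  by apply: eq_integral => w _; rewrite mul1e.
apply: ge0_integral_powR_le => //.
- exact: measurable_Bn.
- lra.
- move=> w Bw; rewrite normc_hdot_gt0//=.
  by have := normc_hdot_le2 Bz Bw; lra.
move=> h h0 h3; rewrite -carleson_full// integral_cst ?mul1e; last first.
  exact: measurable_carleson.
have h2 : (0 < 2 * h)%R by lra.
apply: le_trans (vol_carleson n0 alpha1 Bz h2 (lexx _)) _.
rewrite lee_fin; apply: eq_ler; rewrite /C powRM//; last exact: ltW.
have -> : (h `^ N = h ^+ n * h `^ (1 + alpha))%R.
  rewrite -powR_mulrn; last exact: ltW.
  by rewrite -powRD ?(gt_eqF h0) ?implybT//; congr powR; ring.
ring.
Qed.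

(** Two decompositions. In the depth, s < 1 + alpha makes the weight integrable, with mass O(r^(N -
    s)) where |1 - <z, w>| < r. Then in r, starting from the minimal value (1 - |z|^2) / 2, the
    kernel leaves the exponent - s, and s > 0 gives convergence at large r. *)
Lemma integral_kernel_weight_le (s : R) : (0 < s < 1 + alpha)%R ->
  exists2 K : R, (0 < K)%R & forall z, Bn z ->
    \int[v]_(w in Bn) (ker z w `^ (- N) *
       (1 - sqnorm w) `^ (- s))%:E <= (K * (1 - sqnorm z) `^ (- s))%:E.
Proof.
move=> /andP[s0 s1]; have C0 := vol_carleson_const_ge0 n0 alpha1.
pose C := (dyadic_const (- s) (1 + alpha - s) * vol_carleson_const n alpha *
  2 `^ (1 + alpha - s))%R.
have d0 : (0 <= dyadic_const (- s) (1 + alpha - s))%R.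
  by apply: dyadic_const_ge0; lra.
have C'0 : (0 <= C)%R by apply: mulr_ge0; [exact: mulr_ge0|exact: powR_ge0].
have inner z r : Bn z -> (0 < r)%R ->
    \int[v]_(w in carleson z r (2 * r)) ((1 - sqnorm w) `^ (- s))%:E <=
    (C * r `^ (N - s))%:E.
  move=> Bz r0.
  have -> : \int[v]_(w in carleson z r (2 * r)) ((1 - sqnorm w) `^ (- s))%:E =
      \int[v]_(w in carleson z r (2 * r)) (cst 1 w * ((1 - sqnorm w) `^ (-
        s))%:E).
    by apply: eq_integral => w _; rewrite mul1e.
  have -> : (C * r `^ (N - s) = dyadic_const (- s) (1 + alpha - s) *
      (vol_carleson_const n alpha * r ^+ n) * (2 * r) `^ (1 + alpha - s))%R.
    rewrite powRM//; last exact: ltW.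
    have -> : (r `^ (N - s) = r ^+ n * r `^ (1 + alpha - s))%R.
      rewrite -powR_mulrn; last exact: ltW.
      by rewrite -powRD ?(gt_eqF r0) ?implybT//; congr powR; ring.
    by rewrite /C; ring.
  apply: ge0_integral_powR_le => //.
  - exact: measurable_carleson.
  - by rewrite mulr_ge0// exprn_ge0// ltW.
  - by rewrite mulr_gt0.
  - by lra.
  - by move=> w [Bw _ hw]; rewrite hw andbT subr_gt0; exact: Bw.
  move=> h h0 hr.
  rewrite (_ : _ `&` _ = carleson z r h); last first.
    apply/seteqP; split => w /=; first by move=> [[? ? ?] ?]; split.
    by move=> [? ? h1]; split; [split|]; rewrite //; lra.
  rewrite integral_cst ?mul1e; last exact: measurable_carleson.
  exact: vol_carleson.

exists (dyadic_const (- N) (- (N - s - N)) * 2 `^ (N - s - N) * C * 2 `^ s +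
  1)%R.
  apply: ltr_wpDl => //; apply: mulr_ge0; last exact: powR_ge0.
  apply: mulr_ge0 => //; apply: mulr_ge0; last exact: powR_ge0.
  by apply: dyadic_const_ge0; lra.
move=> z Bz.
have uz : (0 < 1 - sqnorm z)%R by rewrite subr_gt0; exact: Bz.
apply: (@le_trans _ _ ((dyadic_const (- N) (- (N - s - N)) * 2 `^ (N - s - N) *
    C * ((1 - sqnorm z) / 2) `^ (N - s - N))%:E)); last first.
  rewrite lee_fin.
  have e : (N - s - N = - s)%R by ring.
  rewrite [X in (((1 - sqnorm z) / 2) `^ X)%R]e powRM ?invr_ge0//;
    last exact: ltW.
  have -> : ((2^-1 : R) `^ (- s) = 2 `^ s)%R.
    by rewrite -(@powR_inv1 _ 2)// -powRrM mulN1r opprK.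
  rewrite mulrDl mul1r; have := powR_ge0 (1 - sqnorm z) (- s).
  set P := (_ `^ (- s))%R; set A := (_ * C)%R => P0.
  have -> : (A * (P * 2 `^ s) = A * 2 `^ s * P)%R by ring.
  by rewrite lerDl.
rewrite (_ : \int[_]_(w in _) _ = \int[v]_(w in Bn)
    (((1 - sqnorm w) `^ (- s))%:E * (ker z w `^ (- N))%:E)); last first.
  by apply: eq_integral => w _; rewrite EFinM muleC.
apply: ge0_integral_powR_ge => //.
- exact: measurable_Bn.
- apply/measurable_EFinP; exact: measurable_funPR.
- by move=> w _; rewrite lee_fin powR_ge0.
- by rewrite divr_gt0.
- by lra.
- by move=> w Bw; have := normc_hdot_ge Bz Bw; lra.
move=> h hh.
have h0 : (0 < h)%R by apply: lt_le_trans hh; rewrite divr_gt0.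
by rewrite -carleson_full//; exact: inner.
Qed.

End forelli_rudin.

(** * The operator K_c^alpha *)

Section complex_power.
Variable R : realType.
Notation re := (@complex.Re R).
Notation im := (@complex.Im R).
Implicit Types u f : R[i].

(** On the right half-plane the sign distinction in [Carg] disappears. The arctangent form serves
    both for measurability of the kernel and for controlling its argument near the real axis. *)
Lemma Carg_atan u : 0 < re u -> Carg u = atan (im u / re u).
Proof.
case: u => a b /= a0; rewrite /Carg /=.
have e : a / Num.sqrt (a ^+ 2 + b ^+ 2) = cos (atan (b / a)).
  rewrite cos_atan exprMn exprVn.
  have -> : 1 + b ^+ 2 / a ^+ 2 = (a ^+ 2 + b ^+ 2) / a ^+ 2.
    by field; rewrite gt_eqF.
  have h : 0 < Num.sqrt (a ^+ 2 + b ^+ 2).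
    by rewrite sqrtr_gt0 ltr_pwDl ?sqr_ge0// exprn_gt0.
  rewrite sqrtrM ?addr_ge0 ?sqr_ge0// sqrtrV ?sqr_ge0// sqrtr_sqr gtr0_norm//.
  by field; rewrite !gt_eqF.
rewrite e; have := atan_gtNpi2 (b / a); have := atan_ltpi2 (b / a) => h1 h2.
case: ifPn => [b0|].
  rewrite cosK// in_itv/= ; apply/andP; split; last by have := pi_gt0 R; lra.
  by rewrite -[leLHS]atan0; apply: le_atan; rewrite divr_ge0// ltW.
rewrite -ltNge => b0.
have h3 : atan (b / a) < 0 by rewrite -[ltRHS]atan0; apply: lt_atan;
  rewrite pmulr_llt0// invr_gt0.
rewrite -cosN cosK ?opprK// in_itv/=; apply/andP; split; have := pi_gt0 R; lra.
Qed.

Lemma normc_neq0 u : 0 < re u -> 0 < normc u.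
Proof. by move=> h; apply: lt_le_trans h _;
  exact: le_trans (ler_norm _) (normr_Re_le _). Qed.

Lemma cpowRV u (c : R) : 0 < re u -> (cpowR u c)^-1 =
  (normc u `^ (- c) * cos (c * Carg u) -i* (normc u `^ (- c) * sin (c * Carg
    u)))%C.
Proof.
move=> u0; have p0 := powR_gt0 c (normc_neq0 u0).
rewrite /cpowR; set t := c * Carg u.
have cs := cos2Dsin2 t.
apply/eqP; rewrite eq_complex /=.
have -> : (normc u `^ c * cos t - 0 * sin t) ^+ 2 +
    (normc u `^ c * sin t + 0 * cos t) ^+ 2 = (normc u `^ c) ^+ 2.
  transitivity ((normc u `^ c) ^+ 2 * (cos t ^+ 2 + sin t ^+ 2)); first by ring.
  by rewrite cs mulr1.
rewrite powRN; apply/andP; split; apply/eqP; field; exact: lt0r_neq0.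
Qed.

Lemma Re_div_cpowR f u (c : R) : 0 < re u -> re (f / cpowR u c) =
  normc u `^ (- c) * (re f * cos (c * Carg u) + im f * sin (c * Carg u)).
Proof. by move=> u0; rewrite cpowRV// cReM /=; ring. Qed.

Lemma Im_div_cpowR f u (c : R) : 0 < re u -> im (f / cpowR u c) =
  normc u `^ (- c) * (im f * cos (c * Carg u) - re f * sin (c * Carg u)).
Proof. by move=> u0; rewrite cpowRV// cImM /=; ring. Qed.

Lemma normc_div_cpowR f u (c : R) : 0 < re u ->
  normc (f / cpowR u c) = normc u `^ (- c) * normc f.
Proof.
move=> u0; apply: (@pexpIrn _ 2%N) => //; rewrite ?nnegrE ?normc_ge0//.
  by rewrite mulr_ge0 ?powR_ge0 ?normc_ge0.
apply: (etrans (sqr_normcE _)); rewrite Re_div_cpowR// Im_div_cpowR//.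
have cs := cos2Dsin2 (c * Carg u).
set P := normc u `^ (- c); set C := cos _ in cs *; set S := sin _ in cs *.
have e : (P * normc f) ^+ 2 = P ^+ 2 * (re f ^+ 2 + im f ^+ 2).
  by rewrite exprMn sqr_normcE.
apply: etrans (esym e).
transitivity (P ^+ 2 * ((re f ^+ 2 + im f ^+ 2) * (C ^+ 2 + S ^+ 2)));
  first by ring.
by rewrite cs mulr1.
Qed.

End complex_power.

Section operator_bounds.
Variables (R : realType) (n : nat) (alpha c : R).
Hypotheses (n0 : (0 < n)%N) (alpha1 : -1 < alpha).
Notation v := (@vol_ R n alpha).
Notation re := (@complex.Re R).
Notation im := (@complex.Im R).
Variable f : Cn R n -> R[i].
Hypothesis mf : measurable_fun Bn f.

Let BB : set (Cn R n * Cn R n) := Bn `*` Bn.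
Let mBn := @measurable_Bn R n.
Let mBB : measurable BB. Proof. exact: measurableX. Qed.

(** The inverse is written as a power of exponent -1, so measurability follows from that of powers;
    the two agree where the real part is positive. *)
Let arg (x : Cn R n * Cn R n) : R :=
  atan (im (1 - hdot x.1 x.2) * re (1 - hdot x.1 x.2) `^ (-1)).

Let arg_E z w : Bn z -> Bn w -> arg (z, w) = Carg (1 - hdot z w).
Proof.
move=> Bz Bw; have h := Re_hdot_gt0 Bz Bw.
by rewrite /arg Carg_atan//= powR_inv1// ltW.
Qed.

Let measurable_arg : measurable_fun BB arg.
Proof.
apply: (@measurable_funS _ _ _ _ setT) => //.
apply: measurableT_comp.
  by apply: continuous_measurable_fun; exact: continuous_atan.
apply: measurable_funM; first exact: measurable_Im_hdot.
by apply: measurable_funPR; exact: measurable_Re_hdot.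
Qed.

Let measurable_cos : measurable_fun [set: R] (@cos R).
Proof. by apply: continuous_measurable_fun; exact: continuous_cos. Qed.

Let measurable_sin : measurable_fun [set: R] (@sin R).
Proof. by apply: continuous_measurable_fun; exact: continuous_sin. Qed.

Let measurable_coord2 (P : R[i] -> R) : measurable_fun setT P ->
  measurable_fun BB (fun x => P (f x.2)).
Proof.
move=> mP; apply: (measurable_comp (F := Bn) (f := P \o f)) => //.
- by move=> _ [x [_ ?] <-].
- exact: measurableT_comp.
- exact: measurable_funS measurable_snd.
Qed.

Let measurable_normc_powR : measurable_fun BB
  (fun x => normc (1 - hdot x.1 x.2) `^ (- c)).
Proof.
apply: measurable_funPR; apply: measurable_funS (@measurable_normc_hdot R n) =>
  //.
Qed.

Lemma measurable_Re_kernel : measurable_fun BB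
  (fun x => re (f x.2 / cpowR (1 - hdot x.1 x.2) c)).
Proof.
apply: (eq_measurable_fun (fun x => normc (1 - hdot x.1 x.2) `^ (- c) *
    (re (f x.2) * cos (c * arg x) + im (f x.2) * sin (c * arg x)))).
  move=> [z w]; rewrite inE => -[/= Bz Bw].
  by rewrite Re_div_cpowR ?arg_E//; exact: Re_hdot_gt0.
apply: measurable_funM => //; apply: measurable_funD; apply: measurable_funM.
- by apply: measurable_coord2; exact: measurable_Re.
- by apply: measurableT_comp => //; exact: measurable_funM.
- by apply: measurable_coord2; exact: measurable_Im.
- by apply: measurableT_comp => //; exact: measurable_funM.
Qed.

Lemma measurable_Im_kernel : measurable_fun BB
  (fun x => im (f x.2 / cpowR (1 - hdot x.1 x.2) c)).
Proof.
apply: (eq_measurable_fun (fun x => normc (1 - hdot x.1 x.2) `^ (- c) *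
    (im (f x.2) * cos (c * arg x) - re (f x.2) * sin (c * arg x)))).
  move=> [z w]; rewrite inE => -[/= Bz Bw].
  by rewrite Im_div_cpowR ?arg_E//; exact: Re_hdot_gt0.
apply: measurable_funM => //; apply: measurable_funB; apply: measurable_funM.
- by apply: measurable_coord2; exact: measurable_Im.
- by apply: measurableT_comp => //; exact: measurable_funM.
- by apply: measurable_coord2; exact: measurable_Re.
- by apply: measurableT_comp => //; exact: measurable_funM.
Qed.

(** Tonelli is applied to the positive and negative parts separately; the difference is then
    composed with the measurable function [fine]. *)
Let measurable_partial_Rintegral (g : Cn R n * Cn R n -> R) :
  measurable_fun BB g ->
  measurable_fun Bn (fun z => \int[v]_(w in Bn) g (z, w)).
Proof.
move=> mg; pose V := finite_vol n0 alpha1.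
have mp : measurable_fun BB (fun x => ((EFin \o g) ^\+ x)%E).
  by apply: measurable_funepos; exact/measurable_EFinP.
have mn : measurable_fun BB (fun x => ((EFin \o g) ^\- x)%E).
  by apply: measurable_funeneg; exact/measurable_EFinP.
have m1 := measurable_fun_partial_integral mBn mBn mp (fun _ _ _ _ =>
  funepos_ge0 _ _) V.
have m2 := measurable_fun_partial_integral mBn mBn mn (fun _ _ _ _ =>
  funeneg_ge0 _ _) V.
have := measurableT_comp (fine_measurable measurableT) (emeasurable_funB m1 m2).
apply: eq_measurable_fun => z _; rewrite /Rintegral; congr fine.
rewrite [RHS]integralE -!(integral_finite_vol n0 alpha1).
by congr (_ - _)%E; apply: eq_integral => w _; rewrite /= ?funeposE ?funenegE.
Qed.

Lemma measurable_Kop : measurable_fun Bn (@Kop R n c alpha f).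
Proof.
apply: measurable_fun_complex => //.
  exact: measurable_partial_Rintegral measurable_Re_kernel.
exact: measurable_partial_Rintegral measurable_Im_kernel.
Qed.

(** The factor 2 comes from estimating the real and imaginary parts separately. Since [fine] sends
    infinite values to 0, its modulus never exceeds that of the extended integral. *)
Lemma normc_Kop_le z : Bn z -> ((normc (@Kop R n c alpha f z))%:E <=
  2%:E * \int[v]_(w in Bn) (normc (1 - hdot z w)%R `^ (- c) * normc (f
    w))%:E)%E.
Proof.
move=> Bz.
have mabs : measurable_fun Bn (fun w => (normc (1 - hdot z w) `^ (- c) * normc
  (f w))%:E).
  apply/measurable_EFinP; apply: measurable_funM.
    exact: (measurable_fun_section mBn mBn measurable_normc_powR).
  exact: measurable_normc.
have part (P : R[i] -> R) : (forall x, `|P x| <= normc x) ->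
    measurable_fun Bn (fun w => P (f w / cpowR (1 - hdot z w) c)) ->
    (`|\int[v]_(w in Bn) P (f w / cpowR (1 - hdot z w) c)|%:E <=
     \int[v]_(w in Bn) (normc (1 - hdot z w)%R `^ (- c) * normc (f w))%:E)%E.
  move=> hP mP; rewrite /Rintegral.
  have h0 (x : \bar R) : ((`|fine x|)%:E <= `|x|)%E by case: x => [r| |];
    rewrite /= ?normr0 ?leey.
  apply: le_trans (h0 _) _.
  apply: le_trans (le_abse_integral _ _ _) _ => //;
    first exact/measurable_EFinP.
  apply: ge0_le_integral => //.
  - by apply: measurableT_comp => //; exact/measurable_EFinP.
  - move=> w Bw; rewrite /= lee_fin; apply: le_trans (hP _) _.
    by rewrite normc_div_cpowR//; exact: Re_hdot_gt0.
have hr := part _ (@normr_Re_le R)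
  (measurable_fun_section mBn mBn measurable_Re_kernel Bz).
have hi := part _ (@normr_Im_le R)
  (measurable_fun_section mBn mBn measurable_Im_kernel Bz).
apply: (@le_trans _ _ (`|re (@Kop R n c alpha f z)| +
  `|im (@Kop R n c alpha f z)|)%:E).
  by rewrite lee_fin normc_le.
rewrite EFinD (_ : 2%:E = 1 + 1)%E; last by rewrite -EFinD.
by rewrite ge0_muleDl// mul1e; exact: leeD.
Qed.

End operator_bounds.

(** * Test boxes *)

Section test_boxes.
Variables (R : realType) (n : nat).
Hypothesis n0 : (0 < n)%N.
Notation re := (@complex.Re R).
Notation im := (@complex.Im R).
Notation lam := (@lebesgue_Cn R n).
Implicit Types (e t d : R) (z w : Cn R n).

(* A non-isotropic box around (1 - t) e_1, of size comparable to t in the first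
   coordinate and to sqrt t in the others. *)
Definition qbox e t : set (Cn R n) := box (fun k : 'I_n =>
  if val k == 0%N then square (1 - t)%:C%C (e * t)
  else square 0 (e * Num.sqrt t)).

Lemma measurable_qbox e t : measurable (qbox e t).
Proof. by apply: measurable_box => k; case: ifP => _;
  exact: measurable_square. Qed.

Lemma lebesgue_qbox e t : 0 <= e -> 0 <= t ->
  lam (qbox e t) = ((4 * e ^+ 2) ^+ n * t ^+ n.+1)%:E.
Proof.
move=> e0 t0; rewrite /qbox.
rewrite (lebesgue_Cn_box
  (a := fun k => (4 * e ^+ 2 * t) * (if val k == 0%N then t else 1))).
- rewrite big_split /= prodr_const card_ord exprMn.
  set P := \prod_(_ < _) _; suff -> : P = t by rewrite -mulrA -exprSr.
  rewrite /P (bigD1 (Ordinal n0))//= big1 ?mulr1// => k kn.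
  case: ifPn => // k0; exfalso; move: kn => /eqP; apply; apply/val_inj.
  exact/eqP.
- by move=> k; case: ifP => _; exact: measurable_square.
- move=> k; case: ifP => _; rewrite complex_lebesgue_square ?mulr_ge0
    ?sqrtr_ge0//; congr EFin.
    by ring.
  by rewrite !exprMn sqr_sqrtr//; ring.
Qed.

Let o0 : 'I_n := Ordinal n0.

Let qbox_first e t z : qbox e t z ->
  `|re (tnth z o0) - (1 - t)| <= e * t /\ `|im (tnth z o0)| <= e * t.
Proof.
move=> /(_ o0) /=; rewrite /square /rectangle/= !in_itv/=.
by move=> [h1 h2]; split; rewrite ler_norml; lra.
Qed.

Let qbox_other e t z k : qbox e t z -> k != o0 ->
  `|re (tnth z k)| <= e * Num.sqrt t /\ `|im (tnth z k)| <= e * Num.sqrt t.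
Proof.
move=> /(_ k) /= h k0; move: h; case: ifPn => [k0'|_].
  by exfalso; move: k0 => /eqP; apply; apply/val_inj; exact/eqP.
rewrite /square /rectangle/= !in_itv/=.
by move=> [h1 h2]; split; rewrite ler_norml; lra.
Qed.

Section estimates.
Variable e : R.
Hypotheses (e0 : 0 < e) (en : e * (8 * n%:R) <= 1).

Let n1 : 1 <= n%:R :> R. Proof. by rewrite ler1n. Qed.

Let e8 : e <= 1 / 8.
Proof. by have h1 := en; have h2 := n1; have h3 := e0; nra. Qed.

(** This is what [en] is for: n terms of size 2 e^2 t add up to (8 n e) (e t / 4) <= e t / 4. *)
Let sum_others (F : 'I_n -> R) t : 0 <= t ->
  (forall k, k != o0 -> `|F k| <= 2 * e ^+ 2 * t) ->
  `|\sum_(k < n | k != o0) F k| <= e * t / 4.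
Proof.
move=> t0 h.
apply: le_trans (ler_norm_sum _ _ _) _.
apply: (@le_trans _ _ (\sum_(k < n | k != o0) 2 * e ^+ 2 * t)).
  exact: ler_sum.
apply: (@le_trans _ _ (\sum_(k < n) 2 * e ^+ 2 * t)).
  rewrite [leRHS](bigD1 o0)//= lerDr; apply: mulr_ge0 => //.
  by apply: mulr_ge0 => //; exact: sqr_ge0.
rewrite sumr_const card_ord -[leLHS]mulr_natr.
have h1 := en; have h3 := e0.
have : 0 <= e * t by rewrite mulr_ge0// ltW.
nra.
Qed.

(** At the centre 1 - |z|^2 is 2 t - t^2, between 7 t / 4 and 2 t; narrowness of the box keeps the
    deviation to a fraction of t. *)
Lemma sqnorm_qbox t z : 0 < t -> t <= 1 / 4 -> qbox e t z ->
  t <= 1 - sqnorm z <= 4 * t.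
Proof.
move=> t0 t4 Qz; have [h1 h2] := qbox_first Qz.
have := e8; have := e0 => e0' e8'.
rewrite /sqnorm (bigD1 o0)//=.
set S := \sum_(_ | _) _.
have : `|S| <= e * t / 4.
  apply: sum_others; first exact: ltW.
  move=> k k0; have [h3 h4] := qbox_other Qz k0.
  rewrite ger0_norm ?sqr_ge0// sqr_normcE.
  rewrite -(real_normK (num_real (re _))) -(real_normK (num_real (im _))).
  have hb x : 0 <= x -> x <= e * Num.sqrt t -> x ^+ 2 <= e ^+ 2 * t.
    move=> x0 hx; rewrite -[t](sqr_sqrtr (ltW t0)) -exprMn.
    by rewrite ler_pXn2r// nnegrE// (le_trans x0).
  by have := hb _ (normr_ge0 _) h3; have := hb _ (normr_ge0 _) h4; lra.
have S0 : 0 <= S by apply: sumr_ge0 => k _; exact: sqr_ge0.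
rewrite ger0_norm// => hS; rewrite sqr_normcE.
move: h1 h2; rewrite !ler_norml.
set x := re _; set y := im _ => /andP[x1 x2] /andP[y1 y2].
have et : e * t <= t / 8 by nra.



apply/andP; split; nra.
Qed.

(** For the centres, 1 - <z, w> is the real number 1 - (1 - t) (1 - d). Deviations in the first
    coordinates cost O(e t) since d <= t, and the transverse products cost O(e^2 sqrt t sqrt d),
    again at most O(e^2 t). *)
Lemma hdot_qbox t d z w : 0 < t -> t <= 1 / 4 -> 0 < d -> d <= t ->
  qbox e t z -> qbox e d w ->
  `|re (1 - hdot z w) - (1 - (1 - t) * (1 - d))| <= 4 * (e * t) /\
  `|im (1 - hdot z w)| <= 4 * (e * t).
Proof.
move=> t0 t4 d0 dt Qz Qw.
have e80 := e8; have e00 := e0.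
have [z1 z2] := qbox_first Qz; have [w1 w2] := qbox_first Qw.
have sdt : Num.sqrt t * Num.sqrt d <= t.
  rewrite -[leRHS](sqr_sqrtr (ltW t0)) expr2; apply: ler_wpM2l;
    first exact: sqrtr_ge0.
  by rewrite ler_wsqrtr.
have oth a b c' d' : `|a| <= e * Num.sqrt t -> `|b| <= e * Num.sqrt d ->
    `|c'| <= e * Num.sqrt t -> `|d'| <= e * Num.sqrt d ->
    `|a * b| + `|c' * d'| <= 2 * e ^+ 2 * t.
  move=> ha hb hc hd; rewrite !normrM.
  have h (x y : R) : `|x| <= e * Num.sqrt t -> `|y| <= e * Num.sqrt d ->
      `|x| * `|y| <= e ^+ 2 * t.
    move=> hx hy.
    apply: (@le_trans _ _ ((e * Num.sqrt t) * (e * Num.sqrt d))).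
      exact: ler_pM.
    rewrite mulrACA -expr2; apply: ler_wpM2l => //; exact: sqr_ge0.
  by have := h _ _ ha hb; have := h _ _ hc hd; lra.
rewrite cReD cImD cReN cImN /= Re_hdot Im_hdot add0r.
rewrite (bigD1 o0)//= [X in _ /\ `|- X| <= _](bigD1 o0)//=.
set S1 := \sum_(_ < _ | _) _; set S2 := \sum_(_ < _ | _) _.
have hS1 : `|S1| <= e * t / 4.
  apply: sum_others; first exact: ltW.
  move=> k k0; have [a1 a2] := qbox_other Qz k0;
    have [b1 b2] := qbox_other Qw k0.
  by apply: le_trans (ler_normD _ _) _; exact: oth.
have hS2 : `|S2| <= e * t / 4.
  apply: sum_others; first exact: ltW.
  move=> k k0; have [a1 a2] := qbox_other Qz k0;
    have [b1 b2] := qbox_other Qw k0.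
  by apply: le_trans (ler_normB _ _) _; exact: oth.
move: hS1 hS2 z1 z2 w1 w2; rewrite !ler_norml.
set x := re (tnth z o0); set y := im (tnth z o0).
set x' := re (tnth w o0); set y' := im (tnth w o0).
move=> /andP[S1a S1b] /andP[S2a S2b].
have [a ->] : exists a, x = (1 - t) + a by exists (x - (1 - t)); ring.
have [a' ->] : exists a', x' = (1 - d) + a' by exists (x' - (1 - d)); ring.
move=> /andP[xa xb] /andP[ya yb] /andP[xa' xb'] /andP[ya' yb'].
pose E := e * t.

have E8 : E <= 1 / 8 by rewrite /E; nra.
have Ed : e * d <= E by rewrite /E ler_wpM2l// ltW.
rewrite -/E in xa xb ya yb S1a S1b S2a S2b *.
have {}xa : - E <= a by lra.
have {}xb : a <= E by lra.
have {}xa' : - E <= a' by lra.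
have {}xb' : a' <= E by lra.
have {}ya' : - E <= y' by lra.
have {}yb' : y' <= E by lra.
have prod_le (p q : R) : - E <= p -> p <= E -> - E <= q -> q <= E ->
   - (E / 8) <= p * q /\ p * q <= E / 8.
  by move=> *; split; nra.
have [p1 p2] := prod_le a a' xa xb xa' xb'.
have [q1 q2] := prod_le y y' ya yb ya' yb'.
have [r1 r2] := prod_le y a' ya yb xa' xb'.
have [s1 s2] := prod_le a y' xa xb ya' yb'.
have d1 : d <= 1 / 4 by lra.
have lin (u p : R) : 0 < u -> u <= 1 / 4 -> - E <= p -> p <= E ->
    - E <= (1 - u) * p /\ (1 - u) * p <= E.
  by move=> *; split; nra.
have [l1 l2] := lin t a' t0 t4 xa' xb'.
have [l3 l4] := lin d a d0 d1 xa xb.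
have [l5 l6] := lin d y d0 d1 ya yb.
have [l7 l8] := lin t y' t0 t4 ya' yb'.
have e1 : (1 - t + a) * (1 - d + a') = (1 - t) * (1 - d) + (1 - t) * a' +
  (1 - d) * a + a * a'.
  by ring.
have e2 : y * (1 - d + a') = (1 - d) * y + y * a' by ring.
have e3 : (1 - t + a) * y' = (1 - t) * y' + a * y' by ring.
clear - S1a S1b S2a S2b p1 p2 q1 q2 r1 r2 s1 s2 l1 l2 l3 l4 l5 l6 l7 l8 e1 e2
  e3.
by split; apply/andP; split; lra.
Qed.

End estimates.

Lemma cos_atan_ge (c : R) : exists2 eta : R, 0 < eta &
  forall y, `|y| <= eta -> 2^-1 <= cos (c * atan y).
Proof.
have cc : {for (0 : R), continuous (fun y : R => cos (c * atan y) : R)}.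
  apply: continuous_comp; last exact: continuous_cos.
  apply: continuousM; first exact: cst_continuous.
  exact: continuous_atan.
have h2 : 0 < 2^-1 :> R by [].
move/(@cvgrPdist_lt _ R^o) : cc => /(_ 2^-1 h2) [eta /= eta0 h].
exists (eta / 2); first by rewrite divr_gt0.
move=> y hy.
have := h y; rewrite /= sub0r normrN atan0 mulr0 cos0 => hc.
have : `|1 - cos (c * atan y)| < 2^-1 by apply: hc; lra.
rewrite ltr_norml; lra.
Qed.

(** The real part of (1 - <z, w>)^(- c) carries the factor cos (c atan (im / re)); making e small in
    terms of c keeps this factor at least 1/2 on all pairs of boxes. *)
Lemma kernel_qbox_ge (c : R) : 0 < c -> exists2 e : R,
  0 < e /\ e * (8 * n%:R) <= 1 &
  forall t d z w, 0 < t -> t <= 1 / 4 -> 0 < d -> d <= 1 / 4 ->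
    qbox e t z -> qbox e d w ->
    2^-1 * (4 * Num.max t d) `^ (- c) <= re (1 / cpowR (1 - hdot z w) c).
Proof.
move=> c0; have [eta eta0 heta] := cos_atan_ge c.
have n1 : 1 <= n%:R :> R by rewrite ler1n.
(* In [key] below, re u >= t / 2 and |im u| <= 4 e t, so |im u / re u| <= 8 e <= eta; the second
   bound is the narrowness condition of the box estimates. *)
pose e := Num.min (eta / 8) (8 * n%:R)^-1.
have e0 : 0 < e by rewrite lt_min divr_gt0//= invr_gt0; lra.
have en : e * (8 * n%:R) <= 1.
  by rewrite -ler_pdivlMr ?mul1r ?ge_min ?lexx ?orbT//; lra.

have eeta : e <= eta / 8 by rewrite ge_min lexx.
exists e => //.
have key (u : R[i]) t tau : 0 < t -> t <= tau -> tau <= 2 * t ->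
    `|re u - tau| <= 4 * (e * t) -> `|im u| <= 4 * (e * t) ->
    2^-1 * (4 * t) `^ (- c) <= re (1 / cpowR u c).
  move=> t0 ttau tau2; rewrite !ler_norml => /andP[r1 r2] /andP[i1 i2].
  have et : e * t <= t / 8 by nra.
  have re0 : 0 < re u by lra.
  rewrite Re_div_cpowR//= mul1r mul0r addr0 mulrC Carg_atan//.
  apply: ler_pM => //; first exact: powR_ge0.
    rewrite !powRN lef_pV2 ?posrE ?powR_gt0 ?normc_neq0//; last by lra.
    apply: ge0_ler_powR; rewrite ?nnegrE ?normc_ge0//; try lra.
    apply: le_trans (normc_le _) _; rewrite ger0_norm; last exact: ltW.
    have : `|im u| <= 4 * (e * t) by rewrite ler_norml i1.
    lra.
  apply: heta; rewrite normrM normfV [X in _ / X]gtr0_norm// ler_pdivrMr//.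
  have : `|im u| <= 4 * (e * t) by rewrite ler_norml i1.
  move=> h; apply: le_trans h _.
  by nra.
have tau_le t d : 0 < t -> t <= 1 / 4 -> 0 < d -> d <= t ->
    t <= 1 - (1 - t) * (1 - d) /\ 1 - (1 - t) * (1 - d) <= 2 * t.
  by move=> t0 t4 d0 dt; split; nra.
move=> t d z w t0 t4 d0 d4 Qz Qw.
have [td|dt] := ltP t d.
  have [h1 h2] := hdot_qbox e0 en d0 d4 t0 (ltW td) Qw Qz.
  have [h3 h4] := tau_le _ _ d0 d4 t0 (ltW td).
  apply: key d0 h3 h4 _ _.
    by move: h1; rewrite !cReD !cReN Re_hdotC.
  by move: h2; rewrite !cImD !cImN Im_hdotC /= opprK add0r add0r normrN.
have [h1 h2] := hdot_qbox e0 en t0 t4 d0 dt Qz Qw.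
have [h3 h4] := tau_le _ _ t0 t4 d0 dt.
exact: key t0 h3 h4 h1 h2.
Qed.

Lemma qbox_disjoint e t d : e <= 1 / 8 -> 0 < d -> d <= t / 2 ->
  qbox e t `&` qbox e d = set0.
Proof.
move=> e8 d0 dt; rewrite -subset0 => z [Qt Qd].
have [h1 _] := qbox_first Qt; have [h2 _] := qbox_first Qd.
move: h1 h2; rewrite !ler_norml => /andP[_ h1] /andP[h2 _].
nra.
Qed.

Section volume.
Variables (alpha e : R).
Hypotheses (alpha1 : -1 < alpha) (e0 : 0 < e) (en : e * (8 * n%:R) <= 1).
Notation N := (n%:R + 1 + alpha).

Let lamE t : 0 < t ->
  (4 * t) `^ alpha * ((4 * e ^+ 2) ^+ n * t ^+ n.+1) =
  4 `^ alpha * (4 * e ^+ 2) ^+ n * t `^ N.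
Proof.
move=> t0; rewrite powRM//; last exact: ltW.
have -> : t `^ N = t `^ alpha * t ^+ n.+1.
  rewrite -powR_mulrn; last exact: ltW.
  by rewrite -powRD ?(gt_eqF t0) ?implybT//; congr powR; rewrite -natr1; ring.
ring.
Qed.

(** The weight is comparable to t^alpha on the box and the Lebesgue measure is a multiple of t^(n +
    1), whence the exponent N. *)
Lemma vol_qbox : exists2 C : R, 0 < C & forall t, 0 < t -> t <= 1 / 4 ->
  ((C^-1 * t `^ N)%:E <= vol_ alpha (qbox e t))%E /\
  (vol_ alpha (qbox e t) <= (C * t `^ N)%:E)%E.
Proof.
have V0 : 0 < vol_const n alpha by exact: vol_const_gt0.
pose K := 4 `^ alpha * (4 * e ^+ 2) ^+ n.
have K0 : 0 < K by rewrite mulr_gt0 ?powR_gt0// exprn_gt0// mulr_gt0//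
  exprn_gt0.
pose C1 := vol_const n alpha * (1 + 4 `^ (- alpha)) * K.
pose C2 := vol_const n alpha / (1 + 4 `^ alpha) * K.

have C10 : 0 < C1 by rewrite /C1 mulr_gt0// mulr_gt0//; lra.
have C20 : 0 < C2 by rewrite /C2 mulr_gt0// divr_gt0//; lra.
exists (C1 + C2^-1); first by rewrite addr_gt0// invr_gt0.
move=> t t0 t4.
have hQ w : qbox e t w -> 4 * t / 4 <= 1 - sqnorm w <= 4 * t.
  move=> Qw; have -> : 4 * t / 4 = t by field.
  exact: (sqnorm_qbox e0 en).
have t40 : 0 < 4 * t by lra.
have tN : 0 <= t `^ N by exact: powR_ge0.
split.
  apply: le_trans (vol_ge_of_comparable alpha1 (measurable_qbox e t) (ltr0Sn R
    3) t40 hQ).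
  rewrite lebesgue_qbox; [|exact: ltW|exact: ltW].
  rewrite -EFinM lee_fin.
  have -> : vol_const n alpha * ((4 * t) `^ alpha / (1 + 4 `^ alpha)) *
     ((4 * e ^+ 2) ^+ n * t ^+ n.+1) = vol_const n alpha / (1 + 4 `^ alpha) *
     ((4 * t) `^ alpha * ((4 * e ^+ 2) ^+ n * t ^+ n.+1)) by ring.
  rewrite lamE// mulrA; apply: ler_wpM2r => //.
  rewrite -/K -/C2 -[leRHS]invrK lef_pV2 ?posrE ?invr_gt0//;
    last by rewrite addr_gt0 ?invr_gt0.
  by rewrite lerDr ltW.
apply: le_trans (vol_le_of_comparable alpha1 (measurable_qbox e t) (ltr0Sn R 3)
  t40 hQ) _.
rewrite lebesgue_qbox; [|exact: ltW|exact: ltW].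
rewrite -EFinM lee_fin.
have -> : vol_const n alpha * ((1 + 4 `^ (- alpha)) * (4 * t) `^ alpha) *
     ((4 * e ^+ 2) ^+ n * t ^+ n.+1) = vol_const n alpha * (1 +
       4 `^ (- alpha)) *
     ((4 * t) `^ alpha * ((4 * e ^+ 2) ^+ n * t ^+ n.+1)) by ring.
rewrite lamE// mulrA; apply: ler_wpM2r => //.
by rewrite -/K -/C1 lerDl invr_ge0 ltW.
Qed.

Lemma qbox_Bn t : 0 < t -> t <= 1 / 4 -> qbox e t `<=` Bn.
Proof.
move=> t0 t4 w /(sqnorm_qbox e0 en t0 t4) /andP[h _].
by rewrite /Bn/= -subr_gt0; exact: lt_le_trans h.
Qed.

End volume.

End test_boxes.

(** * The L^p norms *)

(** Norm inequalities may thus be proved under a bound M > 0 on the norm: a vanishing norm is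
    reached in the limit, and an infinite one is trivial. *)
Lemma lee_mul_of_forall_gt (R : realType) (x y : \bar R) (C : R) :
  0 < C -> (0 <= y)%E ->
  (forall M : R, 0 < M -> (y <= M%:E)%E -> (x <= (C * M)%:E)%E) ->
  (x <= C%:E * y)%E.
Proof.
move=> C0; case: y => [r|_ _|//]; last by rewrite gt0_muley ?leey ?lte_fin.
rewrite lee_fin => r0 h; apply/lee_addgt0Pr => e e0.
apply: le_trans (h (r + e / C) _ _) _.
- by apply: ltr_wpDl => //; exact: divr_gt0.
- by rewrite lee_fin lerDl divr_ge0// ltW.
rewrite -EFinM -EFinD lee_fin mulrDr [X in _ + X]mulrC divfK//.
by rewrite gt_eqF.
Qed.

Section norms.
Variables (R : realType) (n : nat) (alpha : R).
Hypotheses (n0 : (0 < n)%N) (alpha1 : -1 < alpha).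
Notation v := (@vol_ R n alpha).
Implicit Types (f : Cn R n -> R[i]) (p q : \bar R).
Local Open Scope ereal_scope.

Let mBn := @measurable_Bn R n.

Lemma vol_Bn_gt0 : 0 < v Bn.
Proof.
have n1 : (0 < 8 * n%:R :> R)%R by rewrite mulr_gt0// ltr0n.
have e0 : (0 < (8 * n%:R)^-1 :> R)%R by rewrite invr_gt0.
have en : ((8 * n%:R)^-1 * (8 * n%:R) <= 1 :> R)%R by rewrite mulVf// gt_eqF.
have [C C0 /(_ (1 / 4)%R)] := vol_qbox n0 alpha1 e0 en.
have t0 : (0 < 1 / 4 :> R)%R by rewrite divr_gt0.
move=> /(_ t0 (lexx _)) [h _].
apply: lt_le_trans (le_trans h _);
  first by rewrite lte_fin mulr_gt0 ?powR_gt0// invr_gt0.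
apply: le_measure; rewrite ?inE; [exact: measurable_qbox|exact: mBn|].
exact: (qbox_Bn n0 e0 en t0 (lexx _)).
Qed.

(** For the exponent +oo the norm unfolds to an essential supremum only when the total mass is
    positive. *)
Lemma vol_setT_gt0 : 0 < v setT.
Proof.
apply: lt_le_trans vol_Bn_gt0 _; apply: le_measure; rewrite ?inE//.
Qed.

Lemma normLp_finE f (p : R) : (0 < p)%R -> normLp alpha p%:E f =
  (\int[v]_(z in Bn) (normc (f z) `^ p)%:E) `^ p^-1.
Proof.
move=> p0; rewrite /normLp unlock; congr poweR.
rewrite [RHS]integral_mkcond; apply: eq_integral => z _.
rewrite /patch; case: ifP => _; last by rewrite abse0 poweR_EFin powR0// gt_eqF.
by rewrite /= ger0_norm// normc_ge0.
Qed.

Lemma normLp_fin_leP f (p M : R) : (0 < p)%R -> (0 <= M)%R ->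
  (normLp alpha p%:E f <= M%:E)%E <->
  \int[v]_(z in Bn) (normc (f z) `^ p)%:E <= (M `^ p)%:E.
Proof.
move=> p0 M0; rewrite normLp_finE//.
set I := \int[v]_(z in Bn) _.
have I0 : 0 <= I by apply: integral_ge0 => z _; rewrite lee_fin powR_ge0.
split => h.
  rewrite -[leLHS]poweRe1// -(mulVf (lt0r_neq0 p0)) poweRrM -poweR_EFin.
  apply: gt0_ler_poweR => //; first exact: ltW.
  - by rewrite in_itv/= leey poweR_ge0.
  - by rewrite in_itv/= leey lee_fin M0.
rewrite -[leRHS]poweRe1 ?lee_fin// -(mulfV (lt0r_neq0 p0)) poweRrM poweR_EFin.
apply: gt0_ler_poweR => //; first by rewrite invr_ge0 ltW.
- by rewrite in_itv/= leey I0.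
- by rewrite in_itv/= leey lee_fin powR_ge0.
Qed.

Let normLp_ooE f : normLp alpha +oo f =
  ess_sup v (abse \o ((fun z => (normc (f z))%:E) \_ Bn)).
Proof. by rewrite /normLp unlock vol_setT_gt0. Qed.

Lemma normLp_oo_le f (M : R) : (0 <= M)%R ->
  (forall z, Bn z -> (normc (f z) <= M)%R) -> normLp alpha +oo f <= M%:E.
Proof.
move=> M0 h; rewrite normLp_ooE; apply/ess_supP; apply/nearW => z /=.
rewrite /patch; case: ifPn => [|_]; last by rewrite abse0 lee_fin.
by rewrite inE => Bz /=; rewrite lee_fin ger0_norm ?normc_ge0// h.
Qed.

Lemma normLp_oo_ae f (M : R) : normLp alpha +oo f <= M%:E ->
  {ae v, forall z, Bn z -> (normc (f z) <= M)%R}.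
Proof.
rewrite normLp_ooE => /ess_supP; apply: filterS => z /= h Bz.
by move: h; rewrite patchT ?inE//= lee_fin ger0_norm// normc_ge0.
Qed.

Lemma normLp_oo_ge f (A : set (Cn R n)) (m : R) : measurable A -> A `<=` Bn ->
  0 < v A -> (forall z, A z -> (m <= normc (f z))%R) ->
  m%:E <= normLp alpha +oo f.
Proof.
move=> mA AB vA h; rewrite leNgt; apply/negP => hlt.
have [M Mm hM] : exists2 M, (M < m)%R & normLp alpha +oo f <= M%:E.
  have : 0 <= normLp alpha +oo f by exact: Lnorm_ge0.
  by move: hlt; case: (normLp _ _ _) => // r; rewrite lte_fin => ? _; exists r.
have [B [mB B0 hB]] := normLp_oo_ae hM.
have : v A <= v B.
  apply: le_measure; rewrite ?inE// => z Az; apply: hB => /= hz.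
  by have := hz (AB _ Az); rewrite leNgt (lt_le_trans Mm (h _ Az)).
by rewrite B0 leNgt vA.
Qed.

Lemma normLp_ge0 f p : 0 <= normLp alpha p f.
Proof. exact: Lnorm_ge0. Qed.

Let V : R := (fine (v Bn) + 1)%R.

Let vV : v Bn <= V%:E.
Proof.
have : v Bn \is a fin_num.
  by rewrite ge0_fin_numE ?measure_ge0//; exact: (vol_lty n0 alpha1 mBn).
by rewrite /V => /fineK {1}<-; rewrite lee_fin lerDl.
Qed.

Let V0 : (0 < V)%R.
Proof. by rewrite /V ltr_wpDl// fine_ge0. Qed.


Lemma normLp_mono p q : 1 <= p -> p <= q -> exists2 C : R, (0 < C)%R &
  forall f, measurable_fun Bn f -> normLp alpha p f <= C%:E * normLp alpha q f.
Proof.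
case: p => [p| |//]; last first.
  move=> _; rewrite leye_eq => /eqP ->.
  by exists 1%R => // f _; rewrite mul1e.
rewrite lee_fin => p1; have p0 : (0 < p)%R by lra.
case: q => [q| |//].
  rewrite lee_fin => pq; have q0 : (0 < q)%R by lra.
  exists (V `^ ((1 - p / q) / p))%R; first exact: powR_gt0.
  move=> f mf; apply: lee_mul_of_forall_gt;
    [exact: powR_gt0|exact: normLp_ge0|].
  move=> M M0 /(normLp_fin_leP f q0 (ltW M0)) h.
  apply/normLp_fin_leP => //; first by rewrite mulr_ge0 ?powR_ge0// ltW.
  have mn := measurable_normc mf.
  have pq1 : (p / q <= 1)%R by rewrite ler_pdivrMr// mul1r.
  have mc1 : measurable_fun Bn (cst 1 : Cn R n -> R)%R by exact: measurable_cst.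
  have mc0 : measurable_fun Bn (cst 0 : Cn R n -> R)%R by exact: measurable_cst.
  (* The third function is 0 with exponent 0, a factor 0^0 = 1, so this is Hoelder with two factors,
     one of them the constant 1. *)
  have := @ge0_integral_powR3_le _ _ _ v Bn mBn (cst 1%R)
    (fun z => normc (f z) `^ q)%R (cst 0%R) (1 - p / q) (p / q) 0 V (M `^ q) 1
    mc1 (measurable_funPR _ mn) mc0.
  have t10 : (0 <= 1 - p / q)%R by rewrite subr_ge0.
  have t20 : (0 <= p / q)%R by rewrite divr_ge0 ?ltW.
  have t1 : (1 - p / q + p / q + 0 = 1)%R by ring.
  move=> /(_ (fun _ _ => ler01) (fun _ _ => powR_ge0 _ _) (fun _ _ => lexx _)
    t10 t20 (lexx _) t1 V0 (powR_gt0 _ M0) ltr01).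
  have i1 : \int[v]_(z in Bn) (cst 1%R z)%:E <= V%:E.
    by rewrite (integral_cst v mBn 1) mul1e.
  have i3 : \int[v]_(z in Bn) (cst 0%R z)%:E <= 1%:E.
    by rewrite (integral_cst v mBn 0) mul0e lee_fin.
  move=> /(_ i1 h i3) H.
  apply: le_trans (le_trans _ H) _.
    rewrite le_eqVlt; apply/orP; left; apply/eqP; apply: eq_integral => z _.
    rewrite powR1 mul1r powRr0 mulr1 -powRrM mulrCA mulfV ?gt_eqF// mulr1//.
  rewrite lee_fin; apply: eq_ler; rewrite powRr0 mulr1 powRM ?powR_ge0//;
    last exact: ltW.
  rewrite -!powRrM divfK ?gt_eqF//; congr (_ * _ `^ _)%R.
  by rewrite mulrCA mulfV ?gt_eqF// mulr1.
move=> _; exists (V `^ p^-1)%R; first exact: powR_gt0.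
move=> f mf; apply: lee_mul_of_forall_gt; [exact: powR_gt0|exact: normLp_ge0|].
move=> M M0 /normLp_oo_ae h.
apply/normLp_fin_leP => //; first by rewrite mulr_ge0 ?powR_ge0// ltW.
have mn := measurable_normc mf.
apply: (@le_trans _ _ (\int[v]_(z in Bn) (M `^ p)%:E)).
  apply: ae_ge0_le_integral => //.
  - by move=> z _; rewrite lee_fin powR_ge0.
  - by apply/measurable_EFinP; exact: measurable_funPR.
  - by move=> z _; rewrite lee_fin powR_ge0.
  - apply: filterS h => z hz Bz; rewrite lee_fin; apply: ge0_ler_powR.
    + exact: ltW.
    + by rewrite nnegrE normc_ge0.
    + by rewrite nnegrE ltW.
    + exact: hz.
rewrite integral_cst//.
apply: le_trans (lee_wpmul2l _ vV) _; first by rewrite lee_fin powR_ge0.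
rewrite -EFinM lee_fin; apply: eq_ler; rewrite powRM ?powR_ge0//;
  last exact: ltW.
by rewrite -powRrM mulVf ?gt_eqF// powRr1 ?ltW// mulrC.
Qed.

Lemma bounded_Lp_mono (T : (Cn R n -> R[i]) -> Cn R n ->
  R[i]) (p q p' q' : \bar R) :
  1 <= p -> p <= p' -> 1 <= q' -> q' <= q ->
  bounded_Lp alpha p q T -> bounded_Lp alpha p' q' T.
Proof.
move=> p1 pp' q1 q'q [M hM].
have [C1 C10 h1] := normLp_mono p1 pp'.
have [C2 C20 h2] := normLp_mono q1 q'q.
(* The constant in [bounded_Lp] may be negative, hence the absolute value. *)
exists (C2 * (`|M| * C1))%R => f [mf f_lty].
have fp : Lp alpha p f.
  split=> //; apply: le_lt_trans (h1 _ mf) _.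
  by apply: lte_mul_pinfty => //; rewrite lee_fin ltW.
have [[mTf Tf_lty] hTf] := hM _ fp.
have H : normLp alpha q' (T f) <=
  C2%:E * (`|M|%:E * (C1%:E * normLp alpha p' f)).
  apply: le_trans (h2 _ mTf) _; apply: lee_wpmul2l;
    first by rewrite lee_fin ltW.
  apply: le_trans hTf _.
  apply: (@le_trans _ _ (`|M|%:E * normLp alpha p f)).
    by apply: lee_wpmul2r; [exact: normLp_ge0|rewrite lee_fin ler_norm].
  by apply: lee_wpmul2l => //; exact: h1.
split; last by rewrite !EFinM -!muleA.
split=> //; apply: le_lt_trans H _.
apply: lte_mul_pinfty; [by rewrite lee_fin ltW|by []|].
apply: lte_mul_pinfty; [by rewrite lee_fin|by []|].
by apply: lte_mul_pinfty => //; rewrite lee_fin ltW.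
Qed.

End norms.

(** * Sufficiency *)

Section sufficiency.
Variables (R : realType) (n : nat) (alpha c : R).
Hypotheses (n0 : (0 < n)%N) (alpha1 : -1 < alpha).
Notation v := (@vol_ R n alpha).
Notation N := (n%:R + 1 + alpha).
Notation T := (@Kop R n c alpha).
Notation ker z w := (normc (1 - hdot z w)%R).
Local Open Scope ereal_scope.

Let mBn := @measurable_Bn R n.
Let mBB : measurable ((@Bn R n) `*` (@Bn R n)). Proof. exact: measurableX. Qed.

Lemma bounded_Lp_Kop (p q : \bar R) (C : R) : (0 < C)%R ->
  (forall (f : Cn R n -> R[i]) (M : R), measurable_fun Bn f -> (0 < M)%R ->
    normLp alpha p f <= M%:E -> normLp alpha q (T f) <= (C * M)%:E) ->
  bounded_Lp alpha p q T.
Proof.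
move=> C0 h; exists C => f [mf f_lty].
have H : normLp alpha q (T f) <= C%:E * normLp alpha p f.
  apply: lee_mul_of_forall_gt => //; first exact: normLp_ge0.
  by move=> M M0; exact: h.
split=> //; split; first exact: measurable_Kop.
apply: le_lt_trans H _; apply: lte_mul_pinfty => //.
by rewrite lee_fin ltW.
Qed.

Let measurable_kernel_powR (t : R) :
  measurable_fun ((@Bn R n) `*` (@Bn R n)) (fun x => ker x.1 x.2 `^ t)%R.
Proof.
by apply: measurable_funPR; apply: measurable_funS (@measurable_normc_hdot R n).
Qed.

Let measurable_u (t : R) :
  measurable_fun Bn (fun z : Cn R n => (1 - sqnorm z) `^ t)%R.
Proof. by apply: measurable_funS (measurable_weight1 t). Qed.

Let measurable_abs_kernel f : measurable_fun Bn f ->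
  measurable_fun Bn (fun z => \int[v]_(w in Bn) (ker z w `^ (- c) * normc (f
    w))%:E).
Proof.
move=> mf.
have mk : measurable_fun ((@Bn R n) `*` (@Bn R n))
    (fun x => (ker x.1 x.2 `^ (- c) * normc (f x.2))%:E).
  apply/measurable_EFinP; apply: measurable_funM => //.
  apply: (measurable_comp (F := Bn) (f := fun w => normc (f w))) => //.
  - by move=> _ [x [_ ?] <-].
  - exact: measurable_normc.
  - exact: measurable_funS measurable_snd.
have := measurable_fun_partial_integral mBn mBn mk _ (finite_vol n0 alpha1).
move=> /(_ (fun x y _ _ => _)) h.
have {}h := h _; apply: (eq_measurable_fun _ _ (h _)).
  by move=> z _; exact: (integral_finite_vol n0 alpha1).
by move=> x y; rewrite lee_fin mulr_ge0 ?powR_ge0 ?normc_ge0.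
Qed.

Section schur_application.
Variables (p q : R) (a b : Cn R n * Cn R n -> R) (H G : Cn R n ->
  R) (C1 C2 : R).
Hypotheses (p1 : (1 <= p)%R) (pq : (p <= q)%R).
Hypotheses (ma : measurable_fun (Bn `*` Bn) a) (mb : measurable_fun (Bn `*` Bn)
  b)
  (mH : measurable_fun Bn H) (mG : measurable_fun Bn G).
Hypotheses (a0 : forall x, (0 <= a x)%R) (b0 : forall x, (0 <= b x)%R)
  (H0 : forall z, Bn z -> (0 < H z)%R) (G0 : forall z, Bn z -> (0 < G z)%R).
Hypotheses (C10 : (0 < C1)%R) (C20 : (0 < C2)%R).
Hypothesis HG : forall z, Bn z -> (H z `^ (1 - p^-1) = G z `^ q^-1)%R.
Hypothesis kE : forall z w, Bn z -> Bn w ->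
  (ker z w `^ (- c) = a (z, w) `^ (1 - p^-1) * b (z, w) `^ q^-1)%R.
Hypothesis int_a : forall z, Bn z ->
  \int[v]_(w in Bn) (a (z, w) * H w)%:E <= (C1 * H z)%:E.
Hypothesis int_b : forall w, Bn w ->
  \int[v]_(z in Bn) (b (z, w) * G z)%:E <= (C2 * G w)%:E.

Lemma bounded_Lp_schur : bounded_Lp alpha p%:E q%:E T.
Proof.
have p0 : (0 < p)%R by apply: lt_le_trans p1.
have q0 : (0 < q)%R by apply: lt_le_trans pq.
pose K := (C1 `^ (1 - p^-1) * C2 `^ q^-1)%R.
have K0 : (0 < K)%R by rewrite mulr_gt0 ?powR_gt0.
apply: (@bounded_Lp_Kop _ _ (2 * K)%R); first by rewrite mulr_gt0.
move=> f M mf M0 hf.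
have KM0 : (0 <= 2 * K * M)%R by apply/ltW; apply: mulr_gt0 => //;
  exact: mulr_gt0.
apply/normLp_fin_leP => //.
move/normLp_fin_leP : hf => /(_ p0 (ltW M0)) hf.
have mn := measurable_normc mf.
have := @schur_test _ _ R (finite_vol n0 alpha1) Bn a b H G p q C1 C2
  mBn ma mb mH mG a0 b0 H0 G0 p1 pq C10 C20 HG _ _ (fun w => normc (f w)) (M `^
    p).
have ia z : Bn z -> \int[finite_vol n0 alpha1]_(w in Bn) (a (z,
  w) * H w)%:E <= (C1 * H z)%:E.
  by move=> Bz; rewrite (integral_finite_vol n0 alpha1) int_a.
have ib w : Bn w -> \int[finite_vol n0 alpha1]_(z in Bn) (b (z,
  w) * G z)%:E <= (C2 * G w)%:E.
  by move=> Bz; rewrite (integral_finite_vol n0 alpha1) int_b.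
have hf' : \int[finite_vol n0 alpha1]_(w in Bn) (normc (f w) `^ p)%:E <=
  (M `^ p)%:E.
  by rewrite (integral_finite_vol n0 alpha1).
move=> /(_ ia ib mn (fun _ _ => normc_ge0 _) (powR_gt0 _ M0) hf').
rewrite (integral_finite_vol n0 alpha1) => hS.
have mF := measurable_abs_kernel mf.
have mFq := measurableT_comp (measurable_poweR q) mF.
apply: (@le_trans _ _ (\int[v]_(z in Bn) ((2 `^ q)%:E *
   (\int[v]_(w in Bn) (ker z w `^ (- c) * normc (f w))%:E) `^ q))).
  apply: ge0_le_integral => //.
  - by move=> z _; rewrite lee_fin powR_ge0.
  - by apply/measurable_EFinP; apply: measurable_funPR; apply: measurable_normc;
      exact: measurable_Kop.
  - exact: emeasurable_funM.
  - move=> z Bz; rewrite -!poweR_EFin.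
    set X := \int[v]_(w in Bn) _.
    have X0 : 0 <= X.
      by apply: integral_ge0 => w _;
        rewrite lee_fin mulr_ge0 ?powR_ge0 ?normc_ge0.
    rewrite -poweRM//; apply: gt0_ler_poweR; first exact: ltW.
    + by change (0 <= (normc (T f z))%:E <= +oo);
        rewrite leey lee_fin normc_ge0.
    + by rewrite in_itv/= leey mule_ge0.
    + exact: normc_Kop_le.
rewrite ge0_integralZl//; last by move=> z _; exact: poweR_ge0.
apply: (@le_trans _ _ ((2 `^ q)%:E * (C1 `^ ((1 - p^-1) * q) * C2 * (M `^ p) `^
  (q / p))%:E)).
  apply: lee_wpmul2l; first by rewrite lee_fin powR_ge0.
  apply: le_trans hS; rewrite le_eqVlt; apply/orP; left; apply/eqP.
  apply: eq_integral => z; rewrite inE => Bz; congr poweR.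
  rewrite (integral_finite_vol n0 alpha1).
  by apply: eq_integral => w; rewrite inE => Bw; rewrite kE.
rewrite -EFinM lee_fin; apply: eq_ler.
rewrite /K !powRM ?mulr_ge0 ?powR_ge0//; try exact: ltW.
rewrite -!powRrM mulVf ?gt_eqF// powRr1; last exact: ltW.
have -> : (p * (q / p) = q)%R by field; rewrite gt_eqF.
ring.
Qed.

End schur_application.

Let ker_gt0 (z w : Cn R n) : Bn z -> Bn w -> (0 < ker z w)%R.
Proof. exact: normc_hdot_gt0. Qed.

(** The Schur test at p = 1, where [a] has exponent 0: all weights are 1, the condition on [a] is
    finiteness of v_alpha, and the condition on b, the q-th power of the kernel, is the unweighted
    estimate, valid since c q < N. *)
Lemma bounded_Lp_1 (q : R) : (1 <= q)%R -> (c * q < N)%R ->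
  bounded_Lp alpha 1 q%:E T.
Proof.
move=> q1 cq.
have [C2 C20 h2] := integral_kernel_le n0 alpha1 cq.
have [C1 C10 h1] : exists2 C1 : R, (0 < C1)%R & v Bn <= C1%:E.
  exists (fine (v Bn) + 1)%R; first by rewrite ltr_wpDl// fine_ge0.
  have : v Bn \is a fin_num.
    by rewrite ge0_fin_numE ?measure_ge0//; exact: (vol_lty n0 alpha1 mBn).
  by move=> /fineK {1}<-; rewrite lee_fin lerDl.
apply: (@bounded_Lp_schur 1 q (cst 1%R) (fun x => ker x.1 x.2 `^ (- (c * q)))%R
  (cst 1%R) (cst 1%R) C1 C2) => //.
- by move=> x; rewrite powR_ge0.
- by move=> z _; rewrite !powR1.
- move=> z w Bz Bw /=; rewrite powR1 mul1r -powRrM mulNr -mulrA mulfV ?mulr1//.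
  by rewrite gt_eqF// (lt_le_trans ltr01).
- move=> z _ /=; rewrite !mulr1.
  have -> : \int[v]_(w in Bn) 1%:E = v Bn by rewrite (integral_cst v mBn 1)
    mul1e.
  exact: h1.
- move=> w Bw /=; rewrite mulr1.
  apply: le_trans (h2 _ Bw); rewrite le_eqVlt; apply/orP; left; apply/eqP.
  by apply: eq_integral => z _; rewrite mulr1 normc_hdotC.
Qed.

(** The relation between the exponents says N (1 - 1/p) + N/q = c, so a = b = |1 - <z, w>|^(- N)
    reproduce the kernel. The weights are chosen such that H^(1 - 1/p) and G^(1/q) are both (1 -
    |z|^2)^(- s). *)
Lemma bounded_Lp_critical (p q : R) : (1 < p)%R -> (p <= q)%R ->
  (q^-1 = p^-1 + c / N - 1)%R -> bounded_Lp alpha p%:E q%:E T.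
Proof.
move=> p1 pq qE.
have p0 : (0 < p)%R by lra.
have q0 : (0 < q)%R by lra.
have nR : (0 < n%:R :> R)%R by rewrite ltr0n.
have a1 := alpha1.
have N0 : (0 < N)%R by lra.
have p'1 : (0 < 1 - p^-1)%R by rewrite subr_gt0 invf_lt1.
pose p' := ((1 - p^-1)^-1)%R.
have p'0 : (0 < p')%R by rewrite invr_gt0.
(* With s (p' + q) = (1 + alpha) / 2, both s p' and s q lie strictly between 0 and 1 + alpha, the
   range of the weighted kernel estimate. *)
pose s := ((1 + alpha) / (2 * (p' + q)))%R.
have s0 : (0 < s)%R by rewrite divr_gt0//; [lra|rewrite mulr_gt0// addr_gt0].
have sE : (s * (p' + q) = (1 + alpha) / 2)%R.
  by rewrite /s; field; rewrite gt_eqF// addr_gt0.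
have sp : (0 < s * p' < 1 + alpha)%R.
  by rewrite mulr_gt0//=; have := mulr_gt0 s0 q0; lra.
have sq : (0 < s * q < 1 + alpha)%R.
  by rewrite mulr_gt0//=; have := mulr_gt0 s0 p'0; lra.
have [C1 C10 h1] := integral_kernel_weight_le n0 alpha1 sp.
have [C2 C20 h2] := integral_kernel_weight_le n0 alpha1 sq.
apply: (@bounded_Lp_schur p q (fun x => ker x.1 x.2 `^ (- N))%R
  (fun x => ker x.1 x.2 `^ (- N))%R
  (fun z => (1 - sqnorm z) `^ (- (s * p')))%R
  (fun z => (1 - sqnorm z) `^ (- (s * q)))%R C1 C2).
- exact: ltW.
- exact: pq.
- exact: measurable_kernel_powR.
- exact: measurable_kernel_powR.
- exact: measurable_u.
- exact: measurable_u.
- by move=> x; exact: powR_ge0.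
- by move=> x; exact: powR_ge0.
- by move=> z Bz; rewrite powR_gt0// subr_gt0.
- by move=> z Bz; rewrite powR_gt0// subr_gt0.
- exact: C10.
- exact: C20.
- move=> z Bz; rewrite -!powRrM; congr powR.
  by rewrite !mulNr -!mulrA /p' mulVf ?gt_eqF// mulfV ?gt_eqF.
- move=> z w Bz Bw /=; rewrite -!powRrM -powRD; last first.
    by rewrite (gt_eqF (ker_gt0 Bz Bw)) implybT.
  congr powR; rewrite qE; field; rewrite ?gt_eqF//.
- exact: h1.
- move=> w Bw /=.
  apply: le_trans (h2 _ Bw); rewrite le_eqVlt; apply/orP; left; apply/eqP.
  by apply: eq_integral => z _; rewrite normc_hdotC.
Qed.

(** Hoelder at each z: multiplied by the conjugate exponent of p, c stays below N, so the kernel has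
    bounded norm in the dual space, uniformly in z. *)
Lemma bounded_Lp_oo (p : R) : (1 < p)%R -> (0 < c)%R -> (c / N < 1 - p^-1)%R ->
  bounded_Lp alpha p%:E +oo T.
Proof.
move=> p1 c0 cp.
have p0 : (0 < p)%R by lra.
have nR : (0 < n%:R :> R)%R by rewrite ltr0n.
have a1 := alpha1.
have N0 : (0 < N)%R by lra.
have p'1 : (0 < 1 - p^-1)%R by rewrite subr_gt0 invf_lt1.
have cp' : (c * (1 - p^-1)^-1 < N)%R.
  by move: cp; rewrite !ltr_pdivrMr// mulrC.
have [K K0 hK] := integral_kernel_le n0 alpha1 cp'.
apply: (@bounded_Lp_Kop _ _ (2 * K `^ (1 - p^-1))%R).
  by rewrite mulr_gt0 ?powR_gt0.
move=> f M mf M0 hf; move/normLp_fin_leP : hf => /(_ p0 (ltW M0)) hf.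
have C0 : (0 <= 2 * K `^ (1 - p^-1) * M)%R.
  by rewrite mulr_ge0 ?mulr_ge0 ?powR_ge0// ltW.
apply: normLp_oo_le => // z Bz.
suff : (normc (T f z))%:E <= (2 * K `^ (1 - p^-1) * M)%:E by rewrite lee_fin.
have hk : (normc (T f z))%:E <=
    2%:E * \int[v]_(w in Bn) (ker z w `^ (- c) * normc (f w))%:E.
  exact: normc_Kop_le.
apply: le_trans hk _.
rewrite -mulrA EFinM; apply: lee_wpmul2l => //.
have mn := measurable_normc mf.
have mk := measurable_fun_section mBn mBn (measurable_kernel_powR (- (c * (1 -
  p^-1)^-1))) Bz.
have mc0 : measurable_fun Bn (cst 0 : Cn R n -> R)%R by exact: measurable_cst.
have t1 : (1 - p^-1 + p^-1 + 0 = 1 :> R)%R by ring.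
have i3 : \int[v]_(z in Bn) (cst 0%R z)%:E <= 1%:E.
  by rewrite (integral_cst v mBn 0) mul0e lee_fin.
have pV0 : (0 <= p^-1)%R by rewrite invr_ge0 ltW.
have := ge0_integral_powR3_le mBn mk (measurable_funPR p mn) mc0
  (fun _ _ => powR_ge0 _ _) (fun _ _ => powR_ge0 _ _) (fun _ _ => lexx _)
  (ltW p'1) pV0 (lexx _) t1 K0 (powR_gt0 p M0) ltr01 (hK _ Bz) hf i3.
have -> : ((M `^ p) `^ p^-1 = M)%R.
  by rewrite -powRrM mulfV ?gt_eqF// powRr1// ltW.
rewrite powRr0 mulr1.
apply: le_trans; rewrite le_eqVlt; apply/orP; left; apply/eqP.
apply: eq_integral => w _; congr EFin; rewrite powRr0 mulr1 -!powRrM.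
rewrite mulfV ?gt_eqF// powRr1 ?normc_ge0//; congr (_ `^ _ * _)%R.
by rewrite mulNr -mulrA mulVf ?mulr1// gt_eqF.
Qed.

End sufficiency.

(** * Necessity *)

Section step_functions.
Variables (R : realType) (n : nat) (alpha c e C : R).
Hypotheses (n0 : (0 < n)%N) (alpha1 : -1 < alpha) (c0 : 0 < c).
Hypotheses (e0 : 0 < e) (en : e * (8 * n%:R) <= 1) (C0 : 0 < C).
Notation v := (@vol_ R n alpha).
Notation N := (n%:R + 1 + alpha).
Hypothesis kernel_ge : forall t d (z w : Cn R n),
  0 < t -> t <= 1 / 4 -> 0 < d -> d <= 1 / 4 -> qbox e t z -> qbox e d w ->
  2^-1 * (4 * Num.max t d) `^ (- c) <= complex.Re (1 / cpowR (1 - hdot z w) c).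
Hypothesis volume_qbox : forall t, 0 < t -> t <= 1 / 4 ->
  ((C^-1 * t `^ N)%:E <= v (qbox e t))%E /\ (v (qbox e t) <= (C * t `^ N)%:E)%E.

Let mBn := @measurable_Bn R n.

Definition radius (k : nat) : R := 4^-1 * 2^-1 ^+ k.

Let r k := radius k.
Let Q k : set (Cn R n) := qbox e (r k).

Let r0 k : 0 < r k. Proof. by rewrite mulr_gt0// exprn_gt0. Qed.

Let r_half i j : (i < j)%N -> r j <= r i / 2.
Proof.
move=> ij; rewrite /r /radius -mulrA; apply: ler_wpM2l => //.
by rewrite -exprSr; apply: ler_wiXn2l => //; lra.
Qed.

Let r_le i j : (i <= j)%N -> r j <= r i.
Proof.
move=> ij; rewrite /r /radius; apply: ler_wpM2l => //.
by apply: ler_wiXn2l => //; lra.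
Qed.

Let r4 k : r k <= 1 / 4.
Proof. by apply: le_trans (r_le (leq0n k)) _; rewrite /r /radius expr0 mulr1;
  lra. Qed.

Let QB k : Q k `<=` Bn. Proof. exact: (qbox_Bn n0 e0 en (r0 k) (r4 k)). Qed.

Let mQ k : measurable (Q k). Proof. exact: measurable_qbox. Qed.

Let Q_disjoint i j z : Q i z -> Q j z -> i = j.
Proof.
have n1 : 1 <= n%:R :> R by rewrite ler1n.
have e8 : e <= 1 / 8 by have h1 := en; have h2 := e0; nra.
move=> Qi Qj; apply/eqP; rewrite eqn_leq; apply/andP; split; rewrite leqNgt;
  apply/negP => ij.
  have := qbox_disjoint n0 e8 (r0 i) (r_half ij).
  by rewrite -subset0 => /(_ z); apply.
have := qbox_disjoint n0 e8 (r0 j) (r_half ij).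
by rewrite -subset0 => /(_ z); apply.
Qed.

Let V k : R := fine (v (Q k)).

Let VE k : v (Q k) = (V k)%:E.
Proof.
by rewrite /V fineK// ge0_fin_numE ?measure_ge0//;
  exact: (vol_lty n0 alpha1 (mQ k)).
Qed.

Let V_ge k : C^-1 * r k `^ N <= V k.
Proof. by have [] := volume_qbox (r0 k) (r4 k); rewrite -/(Q k) VE lee_fin. Qed.

Let V_le k : V k <= C * r k `^ N.
Proof. by have [] := volume_qbox (r0 k) (r4 k);
  rewrite -/(Q k) VE !lee_fin. Qed.

Let V0 k : 0 < V k.
Proof. by apply: lt_le_trans (V_ge k);
  rewrite mulr_gt0 ?invr_gt0// powR_gt0. Qed.

Definition step (K : nat) (b : nat -> R) (z : Cn R n) : R :=
  \sum_(k < K) b k * \1_(Q k) z.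

Let step_in K b k z : (k < K)%N -> Q k z -> step K b z = b k.
Proof.
move=> kK Qk; rewrite /step (bigD1 (Ordinal kK))//= indicE mem_set// mulr1 big1
  ?addr0//.
move=> j jk; rewrite indicE memNset ?mulr0// => Qj.
by move/eqP: jk; apply; apply/val_inj => /=; exact: Q_disjoint Qj Qk.
Qed.

Let step_out K b z : (forall k, (k < K)%N -> ~ Q k z) -> step K b z = 0.
Proof.
move=> h; rewrite /step big1// => j _; rewrite indicE memNset ?mulr0//.
exact: h.
Qed.

Let stepP K z : (exists2 k, (k < K)%N & Q k z) \/ (forall k,
  (k < K)%N -> ~ Q k z).
Proof.
have [h|h] := pselect (exists2 k, (k < K)%N & Q k z); [by left|right].
by move=> k kK Qk; apply: h; exists k.
Qed.

Let step_ge0 K b : (forall k, 0 <= b k) -> forall z, 0 <= step K b z.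
Proof. by move=> b0 z; apply: sumr_ge0 => k _; rewrite mulr_ge0// indicE. Qed.

Let measurable_step K b : measurable_fun setT (step K b).
Proof.
by apply: measurable_sum => k; exact: measurable_funM.
Qed.

Let integral_step K b : (forall k, 0 <= b k) ->
  (\int[v]_(z in Bn) (step K b z)%:E)%E = (\sum_(k < K) b k * V k)%:E.
Proof.
move=> b0.
have -> : (\int[v]_(z in Bn) (step K b z)%:E =
    \int[v]_(z in Bn) \sum_(k < K) (b k)%:E * (\1_(Q k) z)%:E)%E.
  by apply: eq_integral => z _; rewrite /step -sumEFin.
rewrite ge0_integral_sum//; last 2 first.
- by move=> k; apply: emeasurable_funM => //; apply/measurable_EFinP;
    exact: measurable_indic.
- by move=> k z _; rewrite mule_ge0 ?lee_fin// indicE.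
rewrite -sumEFin; apply: eq_bigr => k _.
rewrite ge0_integralZl ?lee_fin//; last first.
  by apply/measurable_EFinP; exact: measurable_indic.
rewrite EFinM -VE; congr (_ * _)%E.
by rewrite integral_indic// setIidl.
Qed.

Definition cstep K b (z : Cn R n) : R[i] := (step K b z)%:C%C.

Let normc_cstep K b : (forall k, 0 <= b k) -> forall z,
  normc (cstep K b z) = step K b z.
Proof.
by move=> b0 z; rewrite /cstep /= expr0n addr0 sqrtr_sqr ger0_norm// step_ge0.
Qed.

Let measurable_cstep K b : measurable_fun Bn (cstep K b).
Proof.
apply: measurable_fun_complex => //=.
by apply: measurable_funS (measurable_step K b).
Qed.

(** All coefficients and kernel bounds are nonnegative, so the boxes contribute without cancellation
    and the real part alone bounds the image from below. *)
Let Re_Kop_step K (b kap : nat -> R) (z : Cn R n) :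
  (forall k, 0 <= b k) -> (forall k, 0 <= kap k) -> Bn z ->
  (forall k w, (k < K)%N -> Q k w ->
     kap k <= complex.Re (1 / cpowR (1 - hdot z w) c)) ->
  \sum_(k < K) b k * kap k * V k <= complex.Re (Kop c alpha (cstep K b) z).
Proof.
move=> b0 k0 Bz hk.
pose h w := complex.Re (cstep K b w / cpowR (1 - hdot z w) c).
have hE w : h w = step K b w * complex.Re (1 / cpowR (1 - hdot z w) c).
  by rewrite /h div1r; case: (_^-1) => x y /=; rewrite mul0r subr0.
have mh : measurable_fun Bn h.
  exact: (measurable_fun_section mBn mBn
    (measurable_Re_kernel c (measurable_cstep K b)) Bz).
have sh w : Bn w -> step K (fun k => b k * kap k) w <= h w.
  move=> Bw; rewrite hE; have [[k kK Qk]|hN] := stepP K w.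
    by rewrite !(step_in _ kK Qk) ler_wpM2l// hk.
  by rewrite !(step_out _ hN) mul0r.
have bk0 k : 0 <= b k * kap k by rewrite mulr_ge0.
have h0 w : Bn w -> 0 <= h w.
  by move=> Bw; apply: le_trans (sh w Bw); exact: step_ge0.
pose D := ((1 - sqnorm z) / 2) `^ (- c).
have uz : 0 < 1 - sqnorm z by rewrite subr_gt0.
have hD w : Bn w -> h w <= step K b w * D.
  move=> Bw; rewrite hE; apply: ler_wpM2l; first exact: step_ge0.
  apply: le_trans (Re_le_normc _) _; rewrite normc_div_cpowR;
    last exact: Re_hdot_gt0.
  rewrite normc1 mulr1 /D !powRN lef_pV2 ?posrE ?powR_gt0 ?normc_hdot_gt0
    ?divr_gt0//.
  apply: ge0_ler_powR; first exact: ltW.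
  - by rewrite nnegrE divr_ge0// ltW.
  - by rewrite nnegrE normc_ge0.
  - by have := normc_hdot_ge Bz Bw; lra.
(* A lower bound for [fine] of an integral presupposes that the integral is finite; at a fixed z of
   the ball the kernel is bounded by [D]. *)
have fin_h : (\int[v]_(w in Bn) (h w)%:E < +oo)%E.
  apply: (@le_lt_trans _ _ (\int[v]_(w in Bn) (D%:E * (step K b w)%:E))%E).
    apply: ge0_le_integral => //.
    - exact/measurable_EFinP.
    - apply: emeasurable_funM => //; apply/measurable_EFinP.
      exact: measurable_funS (measurable_step K b).
    - by move=> w Bw; rewrite -EFinM lee_fin mulrC hD.
  rewrite ge0_integralZl//; last 3 first.
  - by apply/measurable_EFinP; apply: measurable_funS (measurable_step K b).
  - by move=> w _; rewrite lee_fin step_ge0.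
  - by rewrite lee_fin powR_ge0.
  by rewrite integral_step// -EFinM ltry.
have -> : complex.Re (Kop c alpha (cstep K b) z) = fine (\int[v]_(w in Bn) (h
  w)%:E)%E by [].
rewrite -lee_fin fineK; last first.
  by rewrite ge0_fin_numE// integral_ge0// => w Bw; rewrite lee_fin h0.
rewrite -(integral_step K bk0); apply: ge0_le_integral => //.
- by move=> w _; rewrite lee_fin step_ge0.
- by apply/measurable_EFinP; apply: measurable_funS (measurable_step _ _).
- exact/measurable_EFinP.
Qed.

Let int_powR_step K (b : nat -> R) (p : R) : 0 < p -> (forall k, 0 <= b k) ->
  (\int[v]_(z in Bn) (normc (cstep K b z) `^ p)%:E)%E =
  (\sum_(k < K) b k `^ p * V k)%:E.
Proof.
move=> p0 b0; rewrite -(integral_step K (b := fun k => b k `^ p)); last first.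
  by move=> k; exact: powR_ge0.
apply: eq_integral => z _; congr EFin; rewrite normc_cstep//.
have [[k kK Qk]|hN] := stepP K z; first by rewrite !(step_in _ kK Qk).
by rewrite !(step_out _ hN) powR0// gt_eqF.
Qed.

Let ind (K k : nat) : R := (k == K)%:R.

Let ind0 K k : 0 <= ind K k. Proof. by rewrite /ind. Qed.

Let sum_ind K (F : nat -> R) : \sum_(k < K.+1) ind K k * F k = F K.
Proof.
rewrite big_ord_recr /= /ind eqxx mul1r big1 ?add0r// => k _.
by rewrite (ltn_eqF (ltn_ord k)) mul0r.
Qed.

Let normLp_ind K (p : R) : 0 < p ->
  normLp alpha p%:E (cstep K.+1 (ind K)) = (V K `^ p^-1)%:E.
Proof.
move=> p0; rewrite normLp_finE// int_powR_step// poweR_EFin; congr (_ `^ _)%:E.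
rewrite -[RHS](sum_ind K); apply: eq_bigr => k _; congr (_ * _).
by rewrite /ind; case: eqP => _; rewrite ?powR1// powR0// gt_eqF.
Qed.

Let normLp_cstep_oo K (b : nat -> R) : (forall k, 0 <= b k <= 1) ->
  (normLp alpha +oo (cstep K b) <= 1%:E)%E.
Proof.
move=> b01; apply: normLp_oo_le => // z Bz; rewrite normc_cstep; last first.
  by move=> k; have /andP[] := b01 k.
have [[k kK Qk]|hN] := stepP K z; last by rewrite step_out.
by rewrite (step_in _ kK Qk); have /andP[] := b01 k.
Qed.

Let kap k : R := 2^-1 * (4 * r k) `^ (- c).

Let kap0 k : 0 < kap k.
Proof. by rewrite mulr_gt0// powR_gt0// mulr_gt0. Qed.

Let kernel_Q i j z w : (i <= j)%N -> Q i z -> Q j w ->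
  kap i <= complex.Re (1 / cpowR (1 - hdot z w) c).
Proof.
move=> ij Qz Qw; apply: le_trans (kernel_ge (r0 i) (r4 i) (r0 j) (r4 j) Qz Qw).
by rewrite /kap max_l// r_le.
Qed.

Let kernel_Q' i j z w : (i <= j)%N -> Q j z -> Q i w ->
  kap i <= complex.Re (1 / cpowR (1 - hdot z w) c).
Proof.
move=> ij Qz Qw; apply: le_trans (kernel_ge (r0 j) (r4 j) (r0 i) (r4 i) Qz Qw).
by rewrite /kap max_r// r_le.
Qed.

(** Seen from a larger box Q k, the box Q K acts like a point of mass [V K]: the kernel is governed
    by the larger radius r k only. *)
Let Kop_ind_ge K k z : (k <= K)%N -> Q k z ->
  kap k * V K <= normc (Kop c alpha (cstep K.+1 (ind K)) z).
Proof.
move=> kK Qk; apply: le_trans (Re_le_normc _).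
have := @Re_Kop_step K.+1 (ind K) (fun j => if j == K then kap k else 0) z (ind0
  K) _ (QB Qk).
have -> : \sum_(j < K.+1) ind K j * (if (j : nat) == K then kap k else 0) * V j
  = kap k * V K.
  under eq_bigr do rewrite -mulrA.
  by rewrite (sum_ind K (fun j => (if j == K then kap k else 0) * V j)) eqxx.
apply.
  by move=> j; case: ifP => // _; exact: ltW.
move=> j w jK Qw; case: eqP => [jE|_]; first by rewrite jE in Qw;
  exact: kernel_Q Qk Qw.
have [|jk] := leqP k j; first by move=> kj; apply: le_trans (kernel_Q kj Qk Qw);
  exact: ltW.
by apply: le_trans (kernel_Q' (ltnW jk) Qk Qw); exact: ltW.
Qed.

Let Lp_ind K (p : R) : 0 < p -> Lp alpha p%:E (cstep K.+1 (ind K)).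
Proof. by move=> p0; split; [exact: measurable_cstep|rewrite normLp_ind// ltry].
  Qed.

(* The test functions are the indicators of the boxes Q k, as k -> oo. *)
Lemma bounded_Lp_scaling (p q : R) : 1 <= p -> 1 <= q ->
  bounded_Lp alpha p%:E q%:E (@Kop R n c alpha) -> c <= N * (1 + q^-1 - p^-1).
Proof.
move=> p1 q1 [M hM]; rewrite leNgt; apply/negP => hlt.
have p0 : 0 < p by lra.
have q0 : 0 < q by lra.
(* On Q k itself the image is at least [kap k * V k], so its norm has order at least r_k^(- c)
   V_k^(1 + 1/q), against V_k^(1/p) for the indicator. Nonnegativity of [th] lets the lower bound on
   V_k pass to the power. *)
pose th := 1 + q^-1 - p^-1.
have th0 : 0 <= th.
  have : p^-1 <= 1 by rewrite invf_le1.
  have : 0 < q^-1 by rewrite invr_gt0.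
  by rewrite /th; lra.
have step1 k : kap k * V k `^ th <= M.
  have [[mK _] hn] := hM _ (Lp_ind k p0).
  rewrite normLp_ind// -EFinM in hn.
  have MV : 0 <= M * V k `^ p^-1.
    rewrite -lee_fin; apply: le_trans hn; exact: normLp_ge0.
  move/(normLp_fin_leP _ _ q0 MV) : hn => hn.
  have : (((kap k * V k) `^ q * V k)%:E <= ((M * V k `^ p^-1) `^ q)%:E)%E.
    apply: le_trans hn.
    apply: (@le_trans _ _ (\int[v]_(z in Q k) ((kap k * V k) `^ q)%:E)%E).
      by rewrite (integral_cst v (mQ k)) EFinM -VE.
    apply: (@le_trans _ _ (\int[v]_(z in Q k) (normc (Kop c alpha (cstep k.+1
      (ind k)) z) `^ q)%:E)%E).
      apply: ge0_le_integral => //.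
      - by move=> z _; rewrite lee_fin powR_ge0.
      - apply/measurable_EFinP; apply: measurable_funPR;
          apply: measurable_normc.
        exact: measurable_funS (@QB k) mK.
      - move=> z Qz; rewrite lee_fin; apply: ge0_ler_powR; first exact: ltW.
        + by rewrite nnegrE mulr_ge0 ?ltW.
        + by rewrite nnegrE normc_ge0.
        + exact: Kop_ind_ge.
    apply: ge0_subset_integral => //.
    - apply/measurable_EFinP; apply: measurable_funPR; exact: measurable_normc.
    - by move=> z _; rewrite lee_fin powR_ge0.
  rewrite lee_fin => h.
  have Vq : V k = (V k `^ q^-1) `^ q by rewrite -powRrM mulVf ?gt_eqF// powRr1//
    ltW.
  rewrite [X in _ * X]Vq -powRM in h; last 2 first.
  - by rewrite mulr_ge0// ltW.
  - exact: powR_ge0.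
  have {}h : kap k * V k * V k `^ q^-1 <= M * V k `^ p^-1.
    have kV : 0 <= kap k * V k * V k `^ q^-1.
      by apply: mulr_ge0; [apply/ltW/mulr_gt0|exact: powR_ge0].
    rewrite leNgt; apply/negP => h'.
    have := @gt0_ltr_powR R q q0 _ _ MV kV h'.
    by rewrite ltNge h.
  have Vp := powR_gt0 p^-1 (V0 k).
  rewrite -(ler_pM2r Vp); apply: le_trans h; apply: eq_ler.
  have vn : V k != 0 by rewrite gt_eqF.
  have e1 : V k `^ th * V k `^ p^-1 = V k * V k `^ q^-1.
    rewrite -powRD ?vn ?implybT//.
    have -> : th + p^-1 = 1 + q^-1 by rewrite /th; ring.
    by rewrite powRD ?vn ?implybT// powRr1// ltW.
  by rewrite -[LHS]mulrA e1 mulrA.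
pose dl := c - N * th.
have dl0 : 0 < dl by rewrite subr_gt0.
pose A := 2^-1 * 4 `^ (- c) * C^-1 `^ th.
have A0 : 0 < A by rewrite mulr_gt0 ?powR_gt0 ?invr_gt0// mulr_gt0// powR_gt0.
have step2 k : A * r k `^ (- dl) <= M.
  apply: le_trans (step1 k).
  apply: (@le_trans _ _ (kap k * (C^-1 * r k `^ N) `^ th)).
    have CV0 : 0 <= C^-1 by rewrite invr_ge0 ltW.
    apply: eq_ler; rewrite /kap /A (powRM _ CV0 (powR_ge0 _ _)) -powRrM.
    rewrite (@powRM _ 4)//; last exact: ltW.
    have -> : r k `^ (- dl) = r k `^ (- c) * r k `^ (N * th).
      by rewrite -powRD ?(gt_eqF (r0 k)) ?implybT//; congr powR; rewrite /dl;
        ring.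
    ring.
  apply: ler_wpM2l; first exact: ltW.
  apply: ge0_ler_powR => //.
  - by rewrite nnegrE mulr_ge0 ?powR_ge0// invr_ge0 ltW.
  - by rewrite nnegrE ltW.
(* As exp x >= 1 + x, the power r_k^(- dl) grows at least linearly in k, which suffices against the
   fixed bound M. *)
have step3 (k : nat) : A * (1 + k%:R * (dl * ln 2)) <= M.
  apply: le_trans (step2 k); apply: ler_wpM2l; first exact: ltW.
  rewrite /powR gt_eqF//.
  apply: le_trans (expR_ge1Dx _); rewrite lerD2l.
  have lnr : ln (r k) <= - (k%:R * ln 2).
    have l2 : ln 2^-1 = - ln 2 :> R by rewrite lnV ?posrE.
    rewrite /r /radius lnM ?posrE ?exprn_gt0// lnXn// l2.
    have : ln 4^-1 <= 0 :> R by apply: ln_le0; rewrite invf_le1// ler1n.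
    rewrite mulNrn -mulr_natl; lra.
  have := ler_wpM2l (ltW dl0) lnr; lra.
have ln20 : 0 < ln 2 :> R by rewrite ln_gt0// ltr1n.
have g0 : 0 < A * (dl * ln 2) by apply: mulr_gt0 => //; exact: mulr_gt0.
have := step3 (Num.bound (M / (A * (dl * ln 2)))).
have := archi_boundP (_ : 0 <= M / (A * (dl * ln 2))).
have M0 : 0 <= M.
  by apply: le_trans (step1 0%N); rewrite mulr_ge0 ?powR_ge0// ltW.
move=> /(_ (divr_ge0 M0 (ltW g0))); rewrite ltr_pdivrMr//.
set k := Num.bound _.
have := ltW A0; lra.
Qed.

(* Testing against one small box: at every larger scale the image is as big as
   the kernel, so the scales up to that of the box contribute equally. *)
Lemma not_bounded_Lp_1 : c <= N ->
  ~ bounded_Lp alpha 1 (N / c)%:E (@Kop R n c alpha).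
Proof.
move=> cN [M hM].
have N0 : 0 < N by apply: lt_le_trans cN.
pose q := N / c.
have q0 : 0 < q by rewrite divr_gt0.
have cq : c * q = N by rewrite /q mulrC divfK// gt_eqF.
pose A := 2^-1 `^ q * 4 `^ (- N) * C^-1.
have A0 : 0 < A by rewrite !mulr_gt0 ?powR_gt0 ?invr_gt0.
have key K : A * K%:R <= `|M| `^ q.
  have [[mK _] hn] := hM _ (Lp_ind K ltr01).
  rewrite normLp_ind// invr1 powRr1 -?EFinM in hn; last exact: ltW.
  have MV : 0 <= `|M| * V K by rewrite mulr_ge0// ltW.
  have {}hn : (normLp alpha q%:E (Kop c alpha (cstep K.+1 (ind K))) <=
    (`|M| * V K)%:E)%E.
    apply: le_trans hn _; rewrite lee_fin; apply: ler_wpM2r;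
      [exact: ltW|exact: ler_norm].
  move/(normLp_fin_leP _ _ q0 MV) : hn => hn.
  pose b k := (kap k * V K) `^ q.
  have b0 k : 0 <= b k by exact: powR_ge0.
  have : ((\sum_(k < K) b k * V k)%R%:E <= ((`|M| * V K) `^ q)%:E)%E.
    apply: le_trans hn; rewrite -integral_step//.
    apply: ge0_le_integral => //.
    - by move=> z _; rewrite lee_fin step_ge0.
    - by apply/measurable_EFinP; apply: measurable_funS (measurable_step _ _).
    - apply/measurable_EFinP; apply: measurable_funPR; exact: measurable_normc.
    - move=> z Bz; rewrite lee_fin.
      have [[k kK Qk]|hN] := stepP K z; last by rewrite step_out// powR_ge0.
      rewrite (step_in _ kK Qk) /b; apply: ge0_ler_powR; first exact: ltW.
      + by rewrite nnegrE mulr_ge0 ?ltW.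
      + by rewrite nnegrE normc_ge0.
      + exact: Kop_ind_ge (ltnW kK) Qk.
  rewrite lee_fin powRM//; last exact: ltW.
  move=> h.
  have Vq := powR_gt0 q (V0 K).
  rewrite -(ler_pM2r Vq); apply: le_trans h.
  rewrite -mulrA mulrCA mulr_natl.
  (* Since c q = N, the q-th power of [kap k] has order r_k^(- N) and cancels V_k; each of the K
     scales contributes at least A. *)
  apply: (@le_trans _ _ (\sum_(k < K) A * V K `^ q)).
    by rewrite sumr_const card_ord.
  apply: ler_sum => k _; rewrite /b powRM; [|exact: ltW|exact: ltW].
  rewrite [leRHS]mulrAC; apply: ler_wpM2r; first exact: ltW.
  apply: le_trans (ler_wpM2l _ (V_ge k)); last exact: powR_ge0.
  have -> : kap k `^ q = 2^-1 `^ q * (4 `^ (- N) * r k `^ (- N)).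
    have h2 : (0:R) <= 2^-1 by rewrite invr_ge0.
    rewrite /kap (powRM q h2 (powR_ge0 _ _)) -powRrM mulNr cq powRM//.
    exact: ltW.
  have e1 : r k `^ (- N) * r k `^ N = 1.
    by rewrite powRN mulVf// gt_eqF// powR_gt0.
  apply: eq_ler; transitivity (A * (r k `^ (- N) * r k `^ N));
    first by rewrite e1 mulr1.
  rewrite /A; ring.
have := key (Num.bound (`|M| `^ q / A)).
have := archi_boundP (divr_ge0 (powR_ge0 `|M| q) (ltW A0)).
rewrite ltr_pdivrMr// mulrC => h1 h2.
by have := lt_le_trans h1 h2; rewrite ltxx.
Qed.

(** For k < K the contribution of Q k is of order r_k^(c - N) r_k^(- c) r_k^N = 1, because z lies in
    the smaller box Q K and r_k governs the kernel. *)
Let dual_step_ge K z : Q K z ->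
  (2^-1 * 4 `^ (- c) * C^-1) * K%:R <=
  normc (Kop c alpha (cstep K (fun k => r k `^ (c - N))) z).
Proof.
move=> Qz; apply: le_trans (Re_le_normc _).
apply: le_trans (Re_Kop_step (kap := kap) _ _ (QB Qz) _).
- rewrite mulr_natr -[in leLHS](card_ord K) -sumr_const; apply: ler_sum => k _.
  have h : 0 <= r k `^ (c - N) * kap k by rewrite mulr_ge0 ?powR_ge0// ltW.
  apply: le_trans (ler_wpM2l h (V_ge k)); apply: eq_ler.
  rewrite /kap powRM//; last exact: ltW.
  have rn : r k != 0 by rewrite gt_eqF.
  have -> : r k `^ (c - N) = r k `^ c / r k `^ N.
    by rewrite powRB ?rn ?implybT.
  rewrite !powRN; field.
  by rewrite !gt_eqF ?powR_gt0.
- by move=> k; exact: powR_ge0.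
- by move=> k; exact: ltW.
- by move=> k w kK Qw; exact: kernel_Q' (ltnW kK) Qz Qw.
Qed.

(* The functions sum_(k < K) r_k^(c - N) 1_(Q k) have norm of order K^(1/p),
   while their images are of order K on Q K, and 1/p < 1. *)
Lemma not_bounded_Lp_oo (p : \bar R) : c <= N ->
  p = (N%:E / (N - c)%:E)%E -> ~ bounded_Lp alpha p +oo (@Kop R n c alpha).
Proof.
move=> cN pE [M hM].
have N0 : 0 < N by apply: lt_le_trans cN.
pose b k := r k `^ (c - N).
have b0 k : 0 <= b k by exact: powR_ge0.
pose A := 2^-1 * 4 `^ (- c) * C^-1.
have A0 : 0 < A by rewrite !mulr_gt0 ?powR_gt0 ?invr_gt0.
have key K x : 0 <= x -> (normLp alpha p (cstep K b) <= x%:E)%E ->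
  A * K%:R <= `|M| * x.
  move=> x0 hx.
  have [|_ hn] := hM (cstep K b).
    by split; [exact: measurable_cstep|exact: le_lt_trans hx (ltry _)].
  rewrite -lee_fin.
  apply: (@le_trans _ _ (normLp alpha +oo (Kop c alpha (cstep K b)))).
    apply: (normLp_oo_ge n0 alpha1 (mQ K) (@QB K)).
      by rewrite VE lte_fin.
    by move=> z Qz; exact: dual_step_ge.
  apply: le_trans hn _.
  apply: (@le_trans _ _ (`|M|%:E * normLp alpha p (cstep K b))%E).
    by apply: lee_wpmul2r; [exact: normLp_ge0|rewrite lee_fin ler_norm].
  by rewrite EFinM; apply: lee_wpmul2l.
(* For c = N the exponent is +oo and all coefficients r_k^(c - N) are 1: the test functions have
   norm at most 1 while their images grow like K. *)
move: cN; rewrite le_eqVlt => /predU1P[cE|cN].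
  have pE' : p = +oo%E.
    by rewrite pE -cE subrr inve0 gt0_muley// lte_fin.
  have {}key K : A * K%:R <= `|M| * 1.
    apply: key => //; rewrite pE'; apply: normLp_cstep_oo => k.
    by rewrite /b cE subrr powRr0 ler01 lexx.
  have := key (Num.bound (`|M| / A)).
  have := archi_boundP (divr_ge0 (normr_ge0 M) (ltW A0)).
  rewrite ltr_pdivrMr// mulrC mulr1 => h1 h2.
  by have := lt_le_trans h1 h2; rewrite ltxx.
have Nc0 : 0 < N - c by rewrite subr_gt0.
(* The finite value of p itself: (c - N) p' = - N, so each box adds at most C to the p'-th power of
   the norm. *)
pose p' := N / (N - c).
have p'0 : 0 < p' by rewrite divr_gt0.
have pE' : p = p'%:E by rewrite pE inver gt_eqF// -EFinM.
have p'V : p'^-1 = 1 - c / N by rewrite /p' invf_div; field; rewrite gt_eqF.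
have nrm K : (normLp alpha p (cstep K b) <= ((C * K%:R) `^ p'^-1)%:E)%E.
  rewrite pE'; apply/normLp_fin_leP => //; first exact: powR_ge0.
  rewrite int_powR_step// lee_fin -powRrM mulVf ?gt_eqF// powRr1; last first.
    by rewrite mulr_ge0// ltW.
  rewrite mulr_natr -[in leRHS](card_ord K) -sumr_const; apply: ler_sum => k _.
  have h : 0 <= b k `^ p' by exact: powR_ge0.
  apply: le_trans (ler_wpM2l h (V_le k)) _; apply: eq_ler.
  rewrite /b -powRrM.
  have -> : (c - N) * p' = - N by rewrite /p'; field; rewrite gt_eqF.
  rewrite powRN; field.
  by rewrite gt_eqF// powR_gt0.
have cN0 : 0 < c / N by rewrite divr_gt0.
have key2 (K : nat) : (0 < K)%N -> A * K%:R `^ (c / N) <= `|M| * C `^ p'^-1.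
  move=> K0; have K0' : 0 < K%:R :> R by rewrite ltr0n.
  have := key K _ (powR_ge0 _ _) (nrm K).
  rewrite powRM//; last exact: ltW.
  move=> h.
  rewrite -(ler_pM2r (powR_gt0 p'^-1 K0')); apply: le_trans (le_trans h _).
    rewrite -mulrA -powRD; last by rewrite (gt_eqF K0') implybT.
    have -> : c / N + p'^-1 = 1 by rewrite p'V; ring.
    by rewrite powRr1// ltW.
  by rewrite mulrA.
(* Chosen so that B^(c / N) exceeds by 1 the bound which [key2] puts on K^(c / N) for every K >
   0. *)
pose B := (`|M| * C `^ p'^-1 / A + 1) `^ (c / N)^-1.
have x0 : 0 <= `|M| * C `^ p'^-1 / A.
  apply: divr_ge0; last exact: ltW.
  by apply: mulr_ge0 => //; exact: powR_ge0.
have B0 : 0 <= B by exact: powR_ge0.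
have hB := archi_boundP B0.
have K0 : (0 < Num.bound B)%N.
  by rewrite -(ltr_nat R); exact: le_lt_trans hB.
have := key2 _ K0; rewrite mulrC -ler_pdivlMr// => h.
have : B `^ (c / N) <= (Num.bound B)%:R `^ (c / N).
  by apply: ge0_ler_powR; rewrite ?nnegrE//; exact: ltW.
rewrite /B -powRrM mulVf ?gt_eqF// powRr1; last by lra.
by move=> h2; have := le_trans h2 h; lra.
Qed.

End step_functions.

(** * The exponents p and q: assembling the four cases *)

Section characterization.
Variables (R : realType) (n : nat) (alpha c : R).
Notation N := (n%:R + 1 + alpha).
Notation T := (@Kop R n c alpha).
Hypotheses (n0 : (0 < n)%N) (alpha1 : -1 < alpha) (c0 : 0 < c) (cN : c <= N).

Let N0 : 0 < N. Proof. exact: lt_le_trans cN. Qed.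

Let cN0 : 0 < c / N. Proof. exact: divr_gt0. Qed.

Let cN1 : c / N <= 1. Proof. by rewrite ler_pdivrMr// mul1r. Qed.

Let scaling (p q : R) : 1 <= p -> 1 <= q ->
  bounded_Lp alpha p%:E q%:E T -> p^-1 + c / N - 1 <= q^-1.
Proof.
have [e [e0 en] he] := kernel_qbox_ge n0 c0.
have [C C0 hC] := vol_qbox n0 alpha1 e0 en.
move=> p1 q1 h.
have := bounded_Lp_scaling n0 alpha1 c0 e0 en C0 he hC p1 q1 h.
by rewrite mulrC -ler_pdivrMr//; lra.
Qed.

Let not_bounded_1 : ~ bounded_Lp alpha 1 (N / c)%:E T.
Proof.
have [e [e0 en] he] := kernel_qbox_ge n0 c0.
have [C C0 hC] := vol_qbox n0 alpha1 e0 en.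
exact: (not_bounded_Lp_1 n0 alpha1 c0 e0 en C0 he hC cN).
Qed.

Let not_bounded_oo (p : \bar R) : p = (N%:E / (N - c)%:E)%E ->
  ~ bounded_Lp alpha p +oo T.
Proof.
have [e [e0 en] he] := kernel_qbox_ge n0 c0.
have [C C0 hC] := vol_qbox n0 alpha1 e0 en.
exact: (not_bounded_Lp_oo n0 alpha1 c0 e0 en C0 he hC cN).
Qed.

(** Comparison with the extended quotient becomes the sign of one real number, also for c = N, where
    both sides hold: p < +oo and 1/p > 0. *)
Lemma lt_critical_exponent (p : R) : 0 < p ->
  (p%:E < N%:E / (N - c)%:E)%E = (0 < p^-1 + c / N - 1).
Proof.
move=> p0.
have E : p^-1 + c / N - 1 = (N - p * (N - c)) / (p * N).
  by field; rewrite !gt_eqF.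
rewrite E pmulr_lgt0 ?invr_gt0 ?mulr_gt0// subr_gt0.
move: cN; rewrite le_eqVlt => /predU1P[->|cN'].
  by rewrite subrr inve0 gt0_muley ?lte_fin// ltry mulr0 N0.
have h : 0 < N - c by rewrite subr_gt0.
by rewrite inver gt_eqF// -EFinM lte_fin ltr_pdivlMr.
Qed.

Lemma gt_critical_exponent (p : R) : 0 < p ->
  (N%:E / (N - c)%:E < p%:E)%E = (p^-1 + c / N - 1 < 0).
Proof.
move=> p0.
have E : p^-1 + c / N - 1 = - ((p * (N - c) - N) / (p * N)).
  by field; rewrite !gt_eqF.
rewrite E oppr_lt0 pmulr_lgt0 ?invr_gt0 ?mulr_gt0// subr_gt0.
move: cN; rewrite le_eqVlt => /predU1P[->|cN'].
  by rewrite subrr inve0 gt0_muley ?lte_fin// mulr0 [RHS]lt_gtF//.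
have h : 0 < N - c by rewrite subr_gt0.
by rewrite inver gt_eqF// -EFinM lte_fin ltr_pdivrMr.
Qed.

Lemma EFin_dual_exponent (p : R) : 0 < p ->
  (p%:E^-1 + c%:E / N%:E - 1)%E = (p^-1 + c / N - 1)%:E.
Proof. by move=> p0; rewrite !inver !gt_eqF// -EFinM -EFinD -EFinB. Qed.

(** With k = 1/p + c/N - 1 > 0 the point (p, 1/k) is on the critical line, and p <= 1/k because c <=
    N; smaller q follow since v_alpha is finite. *)
Lemma bounded_Lp_subcritical (p q : R) : 1 < p -> 1 <= q ->
  0 < p^-1 + c / N - 1 -> p^-1 + c / N - 1 <= q^-1 ->
  bounded_Lp alpha p%:E q%:E T.
Proof.
move=> p1 q1 k0 kq; have p0 : 0 < p by lra.
have q0 : 0 < q by lra.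
have cN1' := cN1.
pose k := p^-1 + c / N - 1.
have qk : q <= k^-1 by rewrite -[leLHS]invrK lef_pV2// posrE invr_gt0.
apply: (@bounded_Lp_mono _ _ _ n0 alpha1 T p%:E (k^-1)%:E).
- by rewrite lee_fin ltW.
- exact: lexx.
- by rewrite lee_fin.
- by rewrite lee_fin.
- apply: bounded_Lp_critical => //; last by rewrite invrK.
  by rewrite -[leLHS]invrK lef_pV2 ?posrE ?invr_gt0// /k; lra.
Qed.

(** Lowering p slightly, to 1/p1 = 1 - c/N + d, only enlarges the domain and leads to the
    subcritical case with 1/p1 + c/N - 1 = d. The bound d <= 1/q admits the given q, and d <= c / (2
    N) keeps p1 > 1. *)
Lemma bounded_Lp_at_critical (p q : \bar R) : p = (N%:E / (N - c)%:E)%E ->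
  (1 <= q)%E -> (q < +oo)%E -> bounded_Lp alpha p q T.
Proof.
move=> pE; case: q => [q| |]//; rewrite lee_fin => q1 _.
have q0 : 0 < q by lra.
have cN1' := cN1; have cN0' := cN0.
pose d := Num.min q^-1 (c / N / 2).
have d0 : 0 < d by rewrite lt_min invr_gt0 q0 divr_gt0.
have dq : d <= q^-1 by rewrite ge_min lexx.
have dc : d <= c / N / 2 by rewrite ge_min lexx orbT.
pose p1 := (1 - c / N + d)^-1.
have p10 : 0 < p1 by rewrite invr_gt0; lra.
have p11 : 1 < p1 by rewrite /p1 invf_gt1; lra.
apply: (@bounded_Lp_mono _ _ _ n0 alpha1 T p1%:E q%:E).
- by rewrite lee_fin ltW.
- by rewrite pE ltW// lt_critical_exponent// invrK; lra.
- by rewrite lee_fin.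
- exact: lexx.
- by apply: bounded_Lp_subcritical => //; rewrite invrK; lra.
Qed.

(** It suffices to map some finite exponent r <= p beyond the critical one into L^oo. For p = +oo
    this forces c < N, and 1/r may be half of 1 - c/N. *)
Lemma bounded_Lp_supercritical (p q : \bar R) : (1 <= p)%E ->
  (N%:E / (N - c)%:E < p)%E -> (1 <= q)%E -> bounded_Lp alpha p q T.
Proof.
move=> p1 hp q1.
suff [r [r1 rp rc]] : exists r : R, [/\ 1 < r,
  (r%:E <= p)%E & r^-1 + c / N - 1 < 0].
  apply: (@bounded_Lp_mono _ _ _ n0 alpha1 T r%:E +oo%E) => //.
  - by rewrite lee_fin ltW.
  - by rewrite leey.
  - by apply: bounded_Lp_oo => //; lra.
case: p p1 hp => [r| |]//.
  rewrite lee_fin => r1 hr.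
  have r0 : 0 < r by lra.
  exists r; split => //; last by rewrite -gt_critical_exponent.
  have cN0' := cN0; move: hr; rewrite gt_critical_exponent// => hr.
  rewrite -[ltRHS]invrK -[ltLHS]invrK ltf_pV2 ?posrE ?invr_gt0 ?invr1//; lra.
move=> _ hp.
have cN' : c / N < 1.
  rewrite ltr_pdivrMr// mul1r lt_neqAle cN andbT; apply/eqP => cE.
  by move: hp; rewrite -cE subrr inve0 gt0_muley// lte_fin.
have cN0' := cN0.
pose r := 2 / (1 - c / N).
exists r; rewrite leey; split => //.
  by rewrite /r ltr_pdivlMr ?subr_gt0//; lra.
by rewrite /r invf_div; lra.
Qed.

(** If q >= N / c, boundedness would descend to the exponent N / c, which is at least 1 and has been
    excluded. *)
Lemma bounded_Lp_1_lt (q : \bar R) : (1 <= q)%E ->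
  bounded_Lp alpha 1 q T -> (q < N%:E / c%:E)%E.
Proof.
move=> q1 h; rewrite inver gt_eqF// -EFinM ltNge; apply/negP => hq.
apply: not_bounded_1; apply: (bounded_Lp_mono n0 alpha1 _ _ _ hq h) => //.
by rewrite lee_fin ler_pdivlMr// mul1r.
Qed.

Lemma bounded_Lp_subcritical_le (p q : \bar R) : (1 < p)%E -> (1 <= q)%E ->
  (p < N%:E / (N - c)%:E)%E -> bounded_Lp alpha p q T ->
  (p^-1 + c%:E / N%:E - 1 <= q^-1)%E.
Proof.
case: p => [p| |]//; last by move=> _ _; rewrite ltNge leey.
rewrite lte_fin => p1 q1 hp h.
have p0 : 0 < p by lra.
rewrite EFin_dual_exponent//; move: hp; rewrite lt_critical_exponent// => k0.
case: q q1 h => [q| |]//; rewrite ?lee_fin.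
  move=> q1 h; rewrite inver gt_eqF ?lee_fin; last by lra.
  by apply: scaling h => //; exact: ltW.
(* Boundedness into L^oo would give every finite q; taking 1/q as half of the positive number 1/p +
   c/N - 1 violates the scaling inequality. *)
move=> _ h; exfalso; have cN1' := cN1.
pose q := (2^-1 * (p^-1 + c / N - 1))^-1.
have p1' : p^-1 < 1 by rewrite invf_lt1.
have q1 : 1 <= q by rewrite -[leLHS]invrK lef_pV2 ?posrE ?invr1//; lra.
have /(scaling (ltW p1) q1) : bounded_Lp alpha p%:E q%:E T.
  apply: (bounded_Lp_mono n0 alpha1 _ (lexx _) _ _ h).
  - by rewrite lee_fin ltW.
  - by rewrite lee_fin.
  - by rewrite leey.
by rewrite /q invrK; lra.
Qed.

Lemma bounded_Lp_at_critical_lt (p q : \bar R) : p = (N%:E / (N - c)%:E)%E ->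
  bounded_Lp alpha p q T -> (q < +oo)%E.
Proof.
by move=> pE h; rewrite ltey; apply/eqP => qE; move: h; rewrite qE;
  exact: not_bounded_oo.
Qed.

End characterization.

Local Open Scope ereal_scope.

(* In the extended reals x / 0 = +oo for 0 < x and +oo^-1 = 0, so that the
   conventions for c = n + 1 + alpha and for infinite exponents hold. *)
Theorem corollary5p2 (R : realType) (n : nat) (alpha c : R) (p q : \bar R)
    (N := (n%:R + 1 + alpha)%R)
    (hn : (0 < n)%N) (halpha : (-1 < alpha)%R)
    (hc0 : (0 < c)%R) (hcN : (c <= N)%R)
    (hp : 1 <= p) (hq : 1 <= q) :
  bounded_Lp alpha p q (@Kop R n c alpha) <->
  [\/ p = 1 /\ q < N%:E / c%:E,
      [/\ 1 < p, p < N%:E / (N - c)%:E & p^-1 + c%:E / N%:E - 1 <= q^-1],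
      p = N%:E / (N - c)%:E /\ q < +oo |
      N%:E / (N - c)%:E < p].
Proof.
split=> [h|].
  move: hp; rewrite le_eqVlt => /predU1P[p1|p1].
    by apply: Or41; split=> //; apply: bounded_Lp_1_lt => //; rewrite p1.
  have [pN|pN|pN] := ltgtP p (N%:E / (N - c)%:E).
  - by apply: Or42; split=> //; exact: bounded_Lp_subcritical_le h.
  - exact: Or44.
  - by apply: Or43; split=> //; exact: bounded_Lp_at_critical_lt h.

case=> [[-> qN]|[p1 pN pq]|[pE qoo]|pN].
- move: q hq qN => [q| |]//; last by move=> _; rewrite ltNge leey.
  rewrite lee_fin inver gt_eqF// -EFinM lte_fin ltr_pdivlMr// mulrC => q1 qN.
  exact: bounded_Lp_1.
- move: p hp p1 pN pq => [p| |]//; last by move=> _ _; rewrite ltNge leey.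
  rewrite lte_fin => _ p1 pN.
  have p0 : (0 < p)%R by lra.
  rewrite (EFin_dual_exponent hc0 hcN p0).
  have k0 : (0 < p^-1 + c / N - 1)%R by rewrite -(lt_critical_exponent hc0 hcN).
  move: q hq => [q| |]//; last by move=> _; rewrite invey lee_fin leNgt k0.
  rewrite lee_fin => q1; rewrite inver gt_eqF ?lee_fin; last by lra.
  exact: bounded_Lp_subcritical.
- exact: bounded_Lp_at_critical.
- exact: bounded_Lp_supercritical.
Qed.
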